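(* Let $\mathbb{R}_{\mathcal{S}}$ be any o-minimal expansion of the field of real numbers $\mathbb{R}$. Then: 1) there are exactly four different objects of $\mathbf{LDS}(\mathbb{R}_{\mathcal{S}})$ that come from $\mathbb{R}_{\mathcal{S}}^1$, namely $\mathbb{R}_{\mathcal{S}}$, $(\mathbb{R}_{\mathcal{S}})_{loc}$, $(\mathbb{R}_{\mathcal{S}})_{loc,+}$ and $(\mathbb{R}_{\mathcal{S}})_{loc,-}$; 2) there are uncountably many different objects of $\mathbf{LDS}(\mathbb{R}_{\mathcal{S}})$ that come from $\mathbb{R}_{\mathcal{S}}^2$.
   Context: Let $R$ be an o-minimal expansion of a real closed field; ''definable'' means definable in $R$ with parameters. Generalized topological space: a set $M$ with a family of subsets (the open sets) and a collection of families of open sets (the admissible families; such a family is an admissible covering of its union) such that: (A1) $\emptyset$ and $M$ are open; (A2) finite unions and finite intersections of open sets are open; (A3) finite families of open sets are admissible; (A4) the union of an admissible family is open; (A5) if $\{U_i\}$ is admissible and $V\subseteq\bigcup_i U_i$ is open, then $\{V\cap U_i\}$ is admissible; (A6) if $\{U_i\}$ is admissible and for each $i$ the family $\{V_{ij}\}_j$ is admissible with union $U_i$, then $\{V_{ij}\}_{i,j}$ is admissible; (A7) if $\{U_i\}$ is a family of open sets, $\{V_j\}$ is admissible with the same union, and each $V_j$ is contained in some $U_i$, then $\{U_i\}$ is admissible; (A8) if $\{U_i\}$ is admissible, $V\subseteq \bigcup_i U_i$ and each $V\cap U_i$ is open, then $V$ is open. A map is strictly continuous if preimages of admissible families are admissible.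 A space over $R$ is a pair $(M,O_M)$ with $M$ a generalized topological space and $O_M$ a function sheaf of rings: $O_M(U)$ is a subring of the ring of all functions $U\to R$ for each open $U$, restrictions are set-theoretic, and the sheaf property holds for admissible coverings. A morphism $f:(M,O_M)\to(N,O_N)$ is a strictly continuous map with $h\circ f\in O_M(f^{-1}(V))$ for all open $V\subseteq N$ and $h\in O_N(V)$. An open subspace is an open subset with the restricted structure. A definable set $D\subseteq R^n$ is regarded as a space over $R$: its open sets are the relatively open definable subsets, its admissible families are the families of open sets for which finitely many members already cover the union, and $O_D(U)$ is the ring of continuous definable functions $U\to R$. An affine definable space is a space over $R$ isomorphic to a definable subset of some $R^n$; a definable space is a space with a finite open covering by affine definable open subspaces; a locally definable space is a space with an admissible covering by affine definable open subspaces. $\mathbf{LDS}(R)$ is the category of locally definable spaces over $R$ and their morphisms as spaces. The strong topology on a locally definable space is the topology having the open sets of the generalized topology as a basis. An object $N$ of $\mathbf{LDS}(R)$ comes from $R^k$ if the underlying topological space of $N$ (with the strong topology) equals the standard topological space $R^k$ and for each $x\in R^k$ both $N$ and the affine space $R^k$ induce on an open box $B$ containing $x$ the same definable open subspace. Two such objects are different if they are not equal as spaces. The admissible union of a family of definable spaces (compatible on open intersections) is the space on the union for which the family is an admissible covering by open subspaces. For $R=\mathbb{R}_{\mathcal{S}}$: $\mathbb{R}_{\mathcal{S}}$ denotes the affine definable real line; $(\mathbb{R}_{\mathcal{S}})_{loc}$ is the admissible union of the intervals $(-n,n)$, $n\in\mathbb{N}$; $(\mathbb{R}_{\mathcal{S}})_{loc,+}$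 is the admissible union of the intervals $(-\infty,n)$, $n\in\mathbb{N}$; $(\mathbb{R}_{\mathcal{S}})_{loc,-}$ is the admissible union of the intervals $(-n,+\infty)$, $n\in\mathbb{N}$.
   Formalization: Objects count as different when they differ as generalized topological spaces; structure sheaves are not compared. With sheaves, part 1 fails: pull back the affine line by a piecewise linear homeomorphism of the line with infinitely many, locally finitely many, breakpoints. *)

(* Defs.v *)
From HB Require Import structures.
From mathcomp Require Import all_boot all_order all_algebra.
From mathcomp Require Import all_classical all_reals all_analysis.

Set Implicit Arguments.
Unset Strict Implicit.
Unset Printing Implicit Defensive.

Import Order.TTheory GRing.Theory Num.Theory.
Import numFieldNormedType.Exports.

Local Open Scope classical_set_scope.
Local Open Scope ring_scope.

(* The symbols added to those of the ordered field; the latter are part of the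
   syntax of terms and formulas below. *)
Record expansion (R : realType) := Expansion {
  fsym : Type;
  farity : fsym -> nat;
  finterp : forall f : fsym, 'rV[R]_(farity f) -> R;
  rsym : Type;
  rarity : rsym -> nat;
  rinterp : forall r : rsym, set 'rV[R]_(rarity r)
}.

Section Definability.
Variables (R : realType) (S : expansion R).

(* [term n] and [formula n] have their free variables indexed by ['I_n];
   parameters from R enter as the constants [TCst]. *)
Inductive term (n : nat) : Type :=
| TVar of 'I_n
| TCst of R
| TAdd of term n & term n
| TOpp of term n
| TMul of term n & term n
| TFun (f : fsym S) of ('I_(farity f) -> term n).

Inductive formula (n : nat) : Type :=
| FEq of term n & term n
| FLt of term n & term n
| FRel (r : rsym S) of ('I_(rarity r) -> term n)
| FNot of formula n
| FAnd of formula n & formula n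
| FEx of formula n.+1.

Fixpoint teval n (x : 'rV[R]_n) (t : term n) : R :=
  match t with
  | TVar i => x ord0 i
  | TCst c => c
  | TAdd t1 t2 => teval x t1 + teval x t2
  | TOpp t1 => - teval x t1
  | TMul t1 t2 => teval x t1 * teval x t2
  | TFun f a => finterp (\row_i teval x (a i))
  end.

(* In [FEx phi] the bound variable is variable 0 of [phi]. *)
Fixpoint sat n (x : 'rV[R]_n) (phi : formula n) : Prop :=
  match phi in formula _ return Prop with
  | FEq t1 t2 => teval x t1 = teval x t2
  | FLt t1 t2 => teval x t1 < teval x t2
  | FRel r a => rinterp (\row_i teval x (a i))
  | FNot phi1 => ~ sat x phi1
  | FAnd phi1 phi2 => sat x phi1 /\ sat x phi2
  | FEx phi1 => exists y : R, sat (row_mx (\row_(_ < 1) y) x : 'rV[R]_n.+1) phi1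
  end.

Definition definable n (A : set 'rV[R]_n) : Prop :=
  exists phi : formula n, A = [set x | sat x phi].

(* MathComp intervals may be open, half-open, closed, unbounded or reduced to
   a point. *)
Definition o_minimal : Prop :=
  forall A : set 'rV[R]_1, definable A ->
  exists s : seq (interval R),
    A = [set x | has (fun i : interval R => x ord0 ord0 \in i) s].

End Definability.

(* A generalized topological space whose underlying set [gpts] is a subset of
   the type [T].  Families of open sets are sets of sets: by axiom (A7),
   admissibility does not depend on an indexing.  The record carries no axiom,
   so that equality of records is equality of the data. *)
Record gtsData (T : Type) := GtsData {
  gpts : set T;
  gopen : set (set T);
  gadm : set (set (set T))
}.

Record is_gts T (X : gtsData T) : Prop := IsGts {
  gopen_sub : forall U, gopen X U -> U `<=` gpts X;
  gadm_open : forall C, gadm X C -> C `<=` gopen X;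
  gts_A1 : gopen X set0 /\ gopen X (gpts X);
  gts_A2 : forall C, finite_set C -> C `<=` gopen X ->
    gopen X (\bigcup_(U in C) U) /\
    gopen X (gpts X `&` \bigcap_(U in C) U);
  gts_A3 : forall C, finite_set C -> C `<=` gopen X -> gadm X C;
  gts_A4 : forall C, gadm X C -> gopen X (\bigcup_(U in C) U);
  gts_A5 : forall C V, gadm X C -> gopen X V -> V `<=` \bigcup_(U in C) U ->
    gadm X [set V `&` U | U in C];
  gts_A6 : forall C (D : set T -> set (set T)), gadm X C ->
    (forall U, C U -> gadm X (D U) /\ \bigcup_(V in D U) V = U) ->
    gadm X (\bigcup_(U in C) D U);
  gts_A7 : forall C D, C `<=` gopen X -> gadm X D ->
    \bigcup_(V in D) V = \bigcup_(U in C) U ->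
    (forall V, D V -> exists2 U, C U & V `<=` U) -> gadm X C;
  gts_A8 : forall C V, gadm X C -> V `<=` \bigcup_(U in C) U ->
    (forall U, C U -> gopen X (V `&` U)) -> gopen X V
}.

Definition strictly_continuous T T' (X : gtsData T) (Y : gtsData T')
    (f : T -> T') : Prop :=
  f @` gpts X `<=` gpts Y /\
  forall C, gadm Y C -> gadm X [set gpts X `&` f @^-1` V | V in C].

(* A function U -> R is represented by any of its extensions to [T]:
   [sheaf X U] is the set of all [f : T -> R] whose restriction to U belongs to
   O_X(U) (see [sheaf_ext]).  Two sheaves are thus equal iff the records are;
   [sheaf_open] discards the junk values at sets that are not open. *)
Record spaceData (R : realType) (T : Type) := SpaceData {
  gts : gtsData T;
  sheaf : set T -> set (T -> R)
}.

Record is_space (R : realType) T (X : spaceData R T) : Prop := IsSpace {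
  space_gts : is_gts (gts X);
  sheaf_open : forall U f, sheaf X U f -> gopen (gts X) U;
  sheaf_ext : forall U f g, (forall x, U x -> f x = g x) ->
    sheaf X U f -> sheaf X U g;
  sheaf1 : forall U, gopen (gts X) U -> sheaf X U (cst 1);
  sheafB : forall U f g, sheaf X U f -> sheaf X U g -> sheaf X U (f \- g);
  sheafM : forall U f g, sheaf X U f -> sheaf X U g -> sheaf X U (f \* g);
  sheaf_restr : forall U V f, gopen (gts X) V -> V `<=` U ->
    sheaf X U f -> sheaf X V f;
  sheaf_glue : forall C (g : set T -> T -> R), gadm (gts X) C ->
    (forall U, C U -> sheaf X U (g U)) ->
    (forall U V, C U -> C V -> forall x, (U `&` V) x -> g U x = g V x) ->
    exists2 f, sheaf X (\bigcup_(U in C) U) f &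
      forall U, C U -> forall x, U x -> f x = g U x
}.

Definition space_morphism (R : realType) T T'
    (X : spaceData R T) (Y : spaceData R T') (f : T -> T') : Prop :=
  strictly_continuous (gts X) (gts Y) f /\
  forall V h, sheaf Y V h -> sheaf X (gpts (gts X) `&` f @^-1` V) (h \o f).

Definition space_iso (R : realType) T T'
    (X : spaceData R T) (Y : spaceData R T') : Prop :=
  exists f : T -> T', exists g : T' -> T,
    [/\ space_morphism X Y f, space_morphism Y X g,
        forall x, gpts (gts X) x -> g (f x) = x &
        forall y, gpts (gts Y) y -> f (g y) = y].

Definition subspace_on (R : realType) T (X : spaceData R T) (U : set T) :
    spaceData R T := {|
  gts := {|
    gpts := U;
    gopen := [set V | gopen (gts X) V /\ V `<=` U];
    gadm := [set C | gadm (gts X) C /\ forall V, C V -> V `<=` U] |};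
  sheaf := fun V => [set f | V `<=` U /\ sheaf X V f] |}.

Definition def_open (R : realType) (S : expansion R) n (D : set 'rV[R]_n) :
    set (set 'rV[R]_n) :=
  [set U | definable S U /\ exists2 W : set 'rV[R]_n, open W & U = D `&` W].

Definition graph_on (R : realType) n (U : set 'rV[R]_n) (f : 'rV[R]_n -> R) :
    set 'rV[R]_(n + 1) :=
  [set row_mx x (\row_(_ < 1) f x) | x in U].

Definition def_space (R : realType) (S : expansion R) n (D : set 'rV[R]_n) :
    spaceData R 'rV[R]_n := {|
  gts := {|
    gpts := D;
    gopen := def_open S D;
    gadm := [set C | C `<=` def_open S D /\
      exists C', [/\ finite_set C', C' `<=` C &
                     \bigcup_(U in C') U = \bigcup_(U in C) U]] |};
  sheaf := fun U => [set f | [/\ def_open S D U, {within U, continuous f} &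
                                 definable S (graph_on U f)]] |}.

Section LocallyDefinable.
Variables (R : realType) (S : expansion R).

Definition affine_definable_space T (X : spaceData R T) : Prop :=
  is_space X /\
  exists n (D : set 'rV[R]_n), definable S D /\ space_iso X (def_space S D).

Definition definable_space T (X : spaceData R T) : Prop :=
  is_space X /\
  exists C, [/\ finite_set C, C `<=` gopen (gts X),
    \bigcup_(U in C) U = gpts (gts X) &
    forall U, C U -> affine_definable_space (subspace_on X U)].

Definition locally_definable_space T (X : spaceData R T) : Prop :=
  is_space X /\
  exists C, [/\ gadm (gts X) C, \bigcup_(U in C) U = gpts (gts X) &
    forall U, C U -> affine_definable_space (subspace_on X U)].

End LocallyDefinable.

Definition strong_open T (X : gtsData T) : set (set T) :=
  [set W | exists2 C, C `<=` gopen X & W = \bigcup_(U in C) U].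

Definition open_box (R : realType) k (a b : 'rV[R]_k) : set 'rV[R]_k :=
  [set y | forall i, a ord0 i < y ord0 i < b ord0 i].

Definition comes_from (R : realType) (S : expansion R) (k : nat) :
    set (spaceData R 'rV[R]_k) :=
  [set N |
    [/\ locally_definable_space S N,
        gpts (gts N) = setT,
        strong_open (gts N) = [set W | open W] &
        forall x : 'rV[R]_k, exists a b : 'rV[R]_k,
          [/\ open_box a b x, gopen (gts N) (open_box a b),
              definable_space S (subspace_on N (open_box a b)) &
              subspace_on N (open_box a b) =
              subspace_on (def_space S setT) (open_box a b)]]].

Arguments comes_from {R} S k _.

(* Objects are counted up to equality of the underlying generalized topological
   spaces.  Equality of the structure sheaves must not be required as well: if
   phi : R -> R is a piecewise linear homeomorphism with infinitely many, locally
   finitely many, breakpoints, then the pullback by phi of the affine line has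
   the same open sets and admissible families as the affine line, and agrees
   with it on every bounded interval, but phi is a section of its sheaf that is
   not definable. *)
Definition distinct_spaces (R : realType) T (F : set (spaceData R T)) :
    set (gtsData T) :=
  [set gts N | N in F].

(* [Y] is the admissible union of the family [F]; it is determined by [F], see
   [admissible_union_unique] below. *)
Definition is_admissible_union (R : realType) T (F : set (spaceData R T))
    (Y : spaceData R T) : Prop :=
  [/\ is_space Y,
      gpts (gts Y) = \bigcup_(X in F) gpts (gts X),
      gadm (gts Y) [set gpts (gts X) | X in F] &
      forall X, F X -> subspace_on Y (gpts (gts X)) = X].

Section AdmissibleUnionUnique.
Variables (R : realType) (T : Type) (F : set (spaceData R T)).

Lemma gopenI (X : gtsData T) U V :
  is_gts X -> gopen X U -> gopen X V -> gopen X (U `&` V).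
Proof.
move=> gX oU oV.
have sub : [set U; V] `<=` gopen X by move=> ? [->|->].
have [_] := gts_A2 gX (finite_set2 U V) sub.
suff -> : gpts X `&` \bigcap_(W in [set U; V]) W = U `&` V by [].
apply/seteqP; split=> [x [_ Ix]|x [Ux Vx]].
  by split; apply: Ix; [left|right].
by split=> [|W [->|->]//]; exact: gopen_sub oU _ Ux.
Qed.

Let pieces : set (set T) := [set gpts (gts X) | X in F].

Variables Y Y' : spaceData R T.
Hypotheses (uY : is_admissible_union F Y) (uY' : is_admissible_union F Y').

Lemma piece_open M : pieces M -> gopen (gts Y) M.
Proof. by case: uY => sY _ + _; move/(gadm_open (space_gts sY)); apply. Qed.

Lemma subspace_eq M : pieces M -> subspace_on Y M = subspace_on Y' M.
Proof.
case: uY uY' => _ _ _ + [_ _ _] + [X FX <-].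
by move=> /(_ _ FX) -> /(_ _ FX) ->.
Qed.

Lemma piece_gopen M V : pieces M -> V `<=` M ->
  gopen (gts Y) V -> gopen (gts Y') V.
Proof.
move=> pM VM oV.
have : gopen (gts (subspace_on Y M)) V by [].
by rewrite subspace_eq// => -[].
Qed.

Lemma piece_gadm M C : pieces M -> (forall V, C V -> V `<=` M) ->
  gadm (gts Y) C -> gadm (gts Y') C.
Proof.
move=> pM CM aC.
have : gadm (gts (subspace_on Y M)) C by [].
by rewrite subspace_eq// => -[].
Qed.

Lemma piece_sheaf M V f : pieces M -> V `<=` M ->
  sheaf Y V f -> sheaf Y' V f.
Proof.
move=> pM VM oV.
have : sheaf (subspace_on Y M) V f by [].
by rewrite subspace_eq// => -[].
Qed.

Lemma sub_pieces V : gopen (gts Y) V -> V `<=` \bigcup_(M in pieces) M.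
Proof.
case: uY => sY eY _ _ oV x Vx.
have : gpts (gts Y) x by exact: gopen_sub (space_gts sY) _ oV _ Vx.
by rewrite eY => -[X FX Xx]; exists (gpts (gts X)) => //; exists X.
Qed.

Lemma admissible_union_gopen V : gopen (gts Y) V -> gopen (gts Y') V.
Proof.
move=> oV; case: uY uY' => sY _ _ _ [sY' _ aY' _].
apply: (gts_A8 (space_gts sY') aY' (sub_pieces oV)) => M pM.
apply: (piece_gopen pM) => [x []//|].
exact: gopenI (space_gts sY) oV (piece_open pM).
Qed.

Lemma admissible_union_gadm C : gadm (gts Y) C -> gadm (gts Y') C.
Proof.
move=> aC; case: uY uY' => sY _ _ _ [sY' _ aY' _].
have gY := space_gts sY; have gY' := space_gts sY'.
pose W := \bigcup_(U in C) U; have oW : gopen (gts Y) W := gts_A4 gY aC.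
have aW := gts_A5 gY' aY' (admissible_union_gopen oW) (sub_pieces oW).
pose D (N : set T) := [set N `&` U | U in C].
have aD : forall N, [set W `&` M | M in pieces] N ->
    gadm (gts Y') (D N) /\ \bigcup_(V in D N) V = N.
  move=> _ [M pM <-]; split.
    apply: (piece_gadm pM) => [_ [U CU <-] x [[]]//|].
    apply: (gts_A5 gY aC); last by move=> x [].
    exact: gopenI gY oW (piece_open pM).
  apply/seteqP; split=> [x [_ [U CU <-] []]//|x [[U CU Ux] Mx]].
  exists ((W `&` M) `&` U); first by exists U.
  by split=> //; split=> //; exists U.
apply: (gts_A7 gY' _ (gts_A6 gY' aW aD)).
- by move=> U /(gadm_open gY aC); exact: admissible_union_gopen.
- apply/seteqP; split=> [x [_ [_ [M pM <-]] [U CU <-] [_ Ux]]|x Wx].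
    by exists U.
  have [M pM Mx] := sub_pieces oW Wx; have [U CU Ux] := Wx.
  exists ((W `&` M) `&` U) => //.
  by exists (W `&` M); [exists M|exists U].
- by move=> _ [_ [M pM <-]] [U CU <-]; exists U => // x [].
Qed.

Lemma admissible_union_sheaf U f : sheaf Y U f -> sheaf Y' U f.
Proof.
move=> sf; case: uY uY' => sY _ _ _ [sY' _ aY' _].
have gY := space_gts sY; have gY' := space_gts sY'.
have oU := sheaf_open sY sf.
have aU := gts_A5 gY' aY' (admissible_union_gopen oU) (sub_pieces oU).
have eU : \bigcup_(V in [set U `&` M | M in pieces]) V = U.
  apply/seteqP; split=> [x [_ [M pM <-] []]//|x Ux].
  have [M pM Mx] := sub_pieces oU Ux.
  by exists (U `&` M) => //; exists M.
have [|//|h sh hf] := sheaf_glue sY' (g := fun=> f) aU.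
  move=> _ [M pM <-]; apply: (piece_sheaf pM) => [x []//|].
  apply: (sheaf_restr sY _ _ sf) => [|x []//].
  exact: gopenI gY oU (piece_open pM).
rewrite eU in sh; apply: (sheaf_ext sY' _ sh) => x Ux.
have [V pV Vx] : (\bigcup_(V in [set U `&` M | M in pieces]) V) x by rewrite eU.
exact: hf pV _ Vx.
Qed.

End AdmissibleUnionUnique.

Lemma admissible_union_unique (R : realType) T (F : set (spaceData R T)) Y Y' :
  is_admissible_union F Y -> is_admissible_union F Y' -> Y = Y'.
Proof.
move=> uY uY'; have eqpts : gpts (gts Y) = gpts (gts Y').
  by case: uY uY' => _ -> _ _ [_ -> _ _].
have eqo : gopen (gts Y) = gopen (gts Y').
  by apply/seteqP; split=> V; apply: admissible_union_gopen; eassumption.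
have eqa : gadm (gts Y) = gadm (gts Y').
  by apply/seteqP; split=> V; apply: admissible_union_gadm; eassumption.
have eqs : sheaf Y = sheaf Y'.
  apply/funext => U; apply/seteqP.
  by split=> V; apply: admissible_union_sheaf; eassumption.
case: Y Y' {uY uY'} eqpts eqo eqa eqs => [[? ? ?] ?] [[? ? ?] ?] /=.
by move=> -> -> -> ->.
Qed.

Definition real_line (R : realType) (S : expansion R) : spaceData R 'rV[R]_1 :=
  def_space S setT.

Definition loc_family (R : realType) (S : expansion R) :
    set (spaceData R 'rV[R]_1) :=
  range (fun n : nat =>
    def_space S [set x : 'rV[R]_1 | - n%:R < x ord0 ord0 < n%:R]).

Definition locp_family (R : realType) (S : expansion R) :
    set (spaceData R 'rV[R]_1) :=
  range (fun n : nat => def_space S [set x : 'rV[R]_1 | x ord0 ord0 < n%:R]).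

Definition locm_family (R : realType) (S : expansion R) :
    set (spaceData R 'rV[R]_1) :=
  range (fun n : nat => def_space S [set x : 'rV[R]_1 | - n%:R < x ord0 ord0]).

(* Main.v *)
(* Let N come from the line and let U be an affine open subspace of N.  On
   bounded intervals N agrees with the affine line, so U is an open subset of R
   with a homeomorphism F onto a definable D in R^n, but F is only known to be
   definable on the bounded parts of U.  Key fact: if A is a subset of U and F(A)
   is definable, then A contains or misses a neighbourhood of each of the two
   ends of the line.  This is shown by induction on the number of coordinates of
   F that are not constant on A.  Let h be one of them.  Its fibers in A are
   controlled by induction; its values at local extrema and at non-interior
   points of A form a countable definable set, hence a finite one; and since
   intervals are uncountable, h is proper on A over all but finitely many values.
   So h maps A \cap (e,e'), where e and e' are not in A, onto a set that is
   clopen in the complement of a finite set; this complement has finitely many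
   components, hence A \cap (e,e') meets one of finitely many fibers.

   If moreover U contains a neighbourhood of one end, then a smaller one is open
   in N: otherwise no definable subset of D separates the two ends, some
   coordinate is injective on both of them together, and its images of the two
   ends, being disjoint intervals, are separated by a threshold.  Hence N is
   determined by which of the two ends are contained in a member of an admissible
   affine covering.

   In the plane, for each slope l the half-planes y < l x + n form an increasing
   covering.  The half-plane of slope l is contained in none of slope l' <> l, so
   the admissible unions of these coverings are pairwise different. *)
Require Import Defs.
From HB Require Import structures.
From mathcomp Require Import all_boot all_order all_algebra.
From mathcomp Require Import all_classical all_reals all_analysis.
From mathcomp Require Import finmap ring lra zify.

Set Implicit Arguments.
Unset Strict Implicit.
Unset Printing Implicit Defensive.

Import Order.TTheory GRing.Theory Num.Theory.
Import numFieldNormedType.Exports.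

Local Open Scope classical_set_scope.
Local Open Scope ring_scope.

(** * Definable predicates *)

(** Unbounded sets have a definable description only in the chart D, while countability is argued on
    the line. The proof plays the two against each other: a set of values that is definable when
    read in D and countable when read on the line is finite, because a definable set of reals is
    finite or contains an interval. Once sets are known to be constant near each end, an open subset
    of a piece is a bounded definable open set together with at most two tails. One obstacle
    remains: the chart could tie the two ends together, so that a tail is open only jointly with the
    opposite one. This is why the ends must be separated before the pieces of the four model spaces
    can be recognized inside N. Admissible families then need no further analysis, because affine
    pieces are small: on them an admissible family has a finite subfamily with the same union. *)

Section Definable.
Variables (R : realType) (S : expansion R).

Lemma cons_row0 n y (z : 'rV[R]_n) :
  (row_mx (\row_(_ < 1) y) z : 'rV_n.+1) ord0 ord0 = y.
Proof.
have -> : (ord0 : 'I_n.+1) = lshift n (ord0 : 'I_1) by exact: val_inj.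
by apply: etrans (row_mxEl _ _ _ _) _; rewrite mxE.
Qed.

Lemma cons_rowS n y (z : 'rV[R]_n) j :
  (row_mx (\row_(_ < 1) y) z : 'rV_n.+1) ord0 (lift ord0 j) = z ord0 j.
Proof.
have -> : (lift ord0 j : 'I_n.+1) = rshift 1 j by exact: val_inj.
exact: row_mxEr.
Qed.

Fixpoint tsubst m n (s : 'I_m -> term S n) (t : term S m) : term S n :=
  match t with
  | TVar i => s i
  | TCst c => TCst S n c
  | TAdd t1 t2 => TAdd (tsubst s t1) (tsubst s t2)
  | TOpp t1 => TOpp (tsubst s t1)
  | TMul t1 t2 => TMul (tsubst s t1) (tsubst s t2)
  | TFun f a => TFun (fun i => tsubst s (a i))
  end.

Lemma teval_subst m n (s : 'I_m -> term S n) (t : term S m) (x : 'rV[R]_n) :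
  teval x (tsubst s t) = teval (\row_i teval x (s i)) t.
Proof.
elim: t => /= [i|c|t1 -> t2 ->|t1 ->|t1 -> t2 ->|f a IH] //; first by rewrite mxE.
by congr finterp; apply/rowP => i; rewrite !mxE.
Qed.

Definition lift_subst m n (s : 'I_m -> term S n) (i : 'I_m.+1) : term S n.+1 :=
  if unlift ord0 i is Some j
  then tsubst (fun k => TVar S (lift ord0 k)) (s j) else TVar S ord0.

Fixpoint fsubst m (phi : formula S m) :
    forall n, ('I_m -> term S n) -> formula S n :=
  match phi with
  | FEq t1 t2 => fun _ s => FEq (tsubst s t1) (tsubst s t2)
  | FLt t1 t2 => fun _ s => FLt (tsubst s t1) (tsubst s t2)
  | FRel r a => fun _ s => FRel (fun i => tsubst s (a i))
  | FNot phi1 => fun _ s => FNot (fsubst phi1 s)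
  | FAnd phi1 phi2 => fun _ s => FAnd (fsubst phi1 s) (fsubst phi2 s)
  | FEx phi1 => fun _ s => FEx (fsubst phi1 (lift_subst s))
  end.

Lemma sat_subst m (phi : formula S m) n (s : 'I_m -> term S n) (x : 'rV[R]_n) :
  sat x (fsubst phi s) <-> sat (\row_i teval x (s i)) phi.
Proof.
elim: phi n s x => {m} m /= => [t1 t2|t1 t2|r a|phi IH|phi IH psi IH'|phi IH] n s x.
- by rewrite !teval_subst.
- by rewrite !teval_subst.
- suff -> : (\row_i teval x (tsubst s (a i)))
    = (\row_i teval (\row_i0 teval x (s i0)) (a i)) by [].
  by apply/rowP => i; rewrite !mxE teval_subst.
- by rewrite IH.
- by rewrite IH IH'.
- suff E y : sat (row_mx (\row_(_ < 1) y) x : 'rV_n.+1) (fsubst phi (lift_subst s))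
    <-> sat (row_mx (\row_(_ < 1) y) (\row_i teval x (s i)) : 'rV_m.+1) phi.
    by split=> -[y /E ?]; exists y.
  rewrite IH.
  suff -> : \row_i teval (row_mx (\row_(_ < 1) y) x : 'rV_n.+1) (lift_subst s i)
     = (row_mx (\row_(_ < 1) y) (\row_i teval x (s i)) : 'rV_m.+1) by [].
  apply/rowP => i; rewrite mxE /lift_subst.
  case: unliftP => [j|] -> /=; last by rewrite !cons_row0.
  rewrite cons_rowS mxE teval_subst; congr teval.
  by apply/rowP => k; rewrite mxE /= cons_rowS.
Qed.

(* Definable predicates on environments [v : nat -> R]; quantifiers are handled
   in de Bruijn style, the bound variable being [v 0]. *)
Definition dfn (P : (nat -> R) -> Prop) : Prop :=
  exists N (phi : formula S N), forall v : nat -> R, sat (\row_i v i) phi <-> P v.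

Definition dterm (t : (nat -> R) -> R) : Prop :=
  exists N (tau : term S N), forall v : nat -> R, teval (\row_i v i) tau = t v.

Lemma dterm_widen N N' (tau : term S N) : (N <= N')%N ->
  exists tau' : term S N',
    forall v : nat -> R, teval (\row_i v i) tau' = teval (\row_i v i) tau.
Proof.
move=> le; exists (tsubst (fun i => TVar S (widen_ord le i)) tau) => v.
by rewrite teval_subst; congr teval; apply/rowP => i; rewrite !mxE /= mxE.
Qed.

Lemma dfn_widen N N' (phi : formula S N) : (N <= N')%N ->
  exists phi' : formula S N',
    forall v : nat -> R, sat (\row_i v i) phi' <-> sat (\row_i v i) phi.
Proof.
move=> le; exists (fsubst phi (fun i => TVar S (widen_ord le i))) => v.
rewrite sat_subst.
suff -> : \row_i teval (\row_i0 v i0) (TVar S (widen_ord le i)) = \row_i v i by [].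
by apply/rowP => i; rewrite !mxE /= mxE.
Qed.

Lemma dterm_var k : dterm (fun v => v k).
Proof. by exists k.+1, (TVar S ord_max) => v /=; rewrite mxE. Qed.

Lemma dterm_cst c : dterm (fun=> c).
Proof. by exists 0%N, (TCst S 0 c). Qed.

Lemma dterm_pair t u : dterm t -> dterm u -> exists N (a b : term S N),
  forall v : nat -> R, teval (\row_i v i) a = t v /\ teval (\row_i v i) b = u v.
Proof.
move=> [N [a ea]] [M [b eb]].
have [a' ea'] := dterm_widen a (leq_maxl N M).
have [b' eb'] := dterm_widen b (leq_maxr N M).
by exists (maxn N M), a', b' => v; rewrite ea' eb' ea eb.
Qed.

Lemma dtermD t u : dterm t -> dterm u -> dterm (fun v => t v + u v).
Proof.
move=> dt du; have [N [a [b e]]] := dterm_pair dt du.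
by exists N, (TAdd a b) => v /=; have [-> ->] := e v.
Qed.

Lemma dtermM t u : dterm t -> dterm u -> dterm (fun v => t v * u v).
Proof.
move=> dt du; have [N [a [b e]]] := dterm_pair dt du.
by exists N, (TMul a b) => v /=; have [-> ->] := e v.
Qed.

Lemma dtermN t : dterm t -> dterm (fun v => - t v).
Proof. by move=> [N [a ea]]; exists N, (TOpp a) => v /=; rewrite ea. Qed.

Lemma dtermB t u : dterm t -> dterm u -> dterm (fun v => t v - u v).
Proof. by move=> dt du; apply: dtermD => //; apply: dtermN. Qed.

Lemma dterm_row n (t : 'I_n -> (nat -> R) -> R) j : dterm (t j) ->
  dterm (fun v => (\row_i t i v) ord0 j).
Proof. by move=> [N [a ea]]; exists N, a => v; rewrite ea mxE. Qed.

Lemma eq_dfn P Q : (forall v, P v <-> Q v) -> dfn P -> dfn Q.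
Proof. by move=> e [N [phi h]]; exists N, phi => v; rewrite h e. Qed.

Lemma dfn_eq t u : dterm t -> dterm u -> dfn (fun v => t v = u v).
Proof.
move=> dt du; have [N [a [b e]]] := dterm_pair dt du.
by exists N, (FEq a b) => v /=; have [-> ->] := e v.
Qed.

Lemma dfn_lt t u : dterm t -> dterm u -> dfn (fun v => t v < u v).
Proof.
move=> dt du; have [N [a [b e]]] := dterm_pair dt du.
by exists N, (FLt a b) => v /=; have [-> ->] := e v.
Qed.

Lemma dfn_not P : dfn P -> dfn (fun v => ~ P v).
Proof. by move=> [N [phi h]]; exists N, (FNot phi) => v /=; rewrite h. Qed.

Lemma dfn_and P Q : dfn P -> dfn Q -> dfn (fun v => P v /\ Q v).
Proof.
move=> [N [a ea]] [M [b eb]].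
have [a' ea'] := dfn_widen a (leq_maxl N M).
have [b' eb'] := dfn_widen b (leq_maxr N M).
by exists (maxn N M), (FAnd a' b') => v /=; rewrite ea' eb' ea eb.
Qed.

Lemma dfn_or P Q : dfn P -> dfn Q -> dfn (fun v => P v \/ Q v).
Proof.
move=> dP dQ; apply: (@eq_dfn (fun v => ~ (~ P v /\ ~ Q v))).
  by move=> v; rewrite -not_orE notK.
by apply: dfn_not; apply: dfn_and; apply: dfn_not.
Qed.

Lemma dfn_imp P Q : dfn P -> dfn Q -> dfn (fun v => P v -> Q v).
Proof.
move=> dP dQ; apply: (@eq_dfn (fun v => ~ (P v /\ ~ Q v))).
  by move=> v; rewrite not_andE notK -implyE.
by apply: dfn_not; apply: dfn_and => //; apply: dfn_not.
Qed.

Lemma dfn_cst (P : Prop) : dfn (fun=> P).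
Proof.
have [h|h] := pselect P.
  by apply: (@eq_dfn (fun=> 0 = 0 :> R)) => //; apply: dfn_eq; exact: dterm_cst.
apply: (@eq_dfn (fun=> 0 = 1 :> R)); last by apply: dfn_eq; exact: dterm_cst.
by move=> v; split=> // /esym/eqP; rewrite oner_eq0.
Qed.

Lemma dfn_le t u : dterm t -> dterm u -> dfn (fun v => t v <= u v).
Proof.
move=> dt du; apply: (@eq_dfn (fun v => ~ (u v < t v))).
  by move=> v; rewrite leNgt; split=> [/negP|/negP].
by apply: dfn_not; apply: dfn_lt.
Qed.

Lemma dfn_norm_lt t u : dterm t -> dterm u -> dfn (fun v => `|t v| < u v).
Proof.
move=> dt du; apply: (@eq_dfn (fun v => - u v < t v /\ t v < u v)).
  by move=> v; rewrite ltr_norml; split=> [[-> ->]//|/andP].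
by apply: dfn_and; apply: dfn_lt => //; apply: dtermN.
Qed.

Lemma dfn_norm_le t u : dterm t -> dterm u -> dfn (fun v => `|t v| <= u v).
Proof.
move=> dt du; apply: (@eq_dfn (fun v => - u v <= t v /\ t v <= u v)).
  by move=> v; rewrite ler_norml; split=> [[-> ->]//|/andP].
by apply: dfn_and; apply: dfn_le => //; apply: dtermN.
Qed.

Lemma dfn_fin n (P : 'I_n -> (nat -> R) -> Prop) :
  (forall i, dfn (P i)) -> dfn (fun v => forall i, P i v).
Proof.
elim: n P => [P _|n IH P dP].
  by apply: (eq_dfn _ (dfn_cst True)) => v; split=> // _ [].
apply: (@eq_dfn (fun v => P ord0 v /\ forall i, P (lift ord0 i) v)).
  move=> v; split=> [[P0 PS] i|h]; last by split.
  by case: (unliftP ord0 i) => [j|] ->.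
by apply: dfn_and => //; apply: IH.
Qed.

Lemma dfn_ex (Q : R -> (nat -> R) -> Prop) :
  dfn (fun v => Q (v 0%N) (fun k => v k.+1)) -> dfn (fun v => exists y, Q y v).
Proof.
move=> [N [phi h]]; have [psi e] := dfn_widen phi (leqnSn N).
exists N, (FEx psi) => v /=.
pose w y k := if k is k'.+1 then v k' else y.
have E y : sat (row_mx (\row_(_ < 1) y) (\row_i v i) : 'rV_N.+1) psi <-> Q y v.
  transitivity (Q (w y 0%N) (fun k => w y k.+1)); last by [].
  rewrite -h -e.
  suff -> : (row_mx (\row_(_ < 1) y) (\row_(i < N) v i) : 'rV_N.+1)
            = \row_(i < N.+1) w y i by [].
  apply/rowP => i; rewrite mxE.
  by case: (unliftP ord0 i) => [j|] ->; rewrite (cons_row0, cons_rowS) ?mxE.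
by split=> -[y /E ?]; exists y.
Qed.

Lemma dfn_all (Q : R -> (nat -> R) -> Prop) :
  dfn (fun v => Q (v 0%N) (fun k => v k.+1)) -> dfn (fun v => forall y, Q y v).
Proof.
move=> dQ; apply: (@eq_dfn (fun v => ~ exists y, ~ Q y v)).
  move=> v; split=> [h y|h [y]]; last by apply.
  by apply: contrapT => nQ; apply: h; exists y.
by apply: dfn_not; apply: (@dfn_ex (fun y v => ~ Q y v)); apply: dfn_not.
Qed.

Lemma dfn_exr n (Q : 'rV[R]_n -> (nat -> R) -> Prop) :
  dfn (fun v => Q (\row_i v i) (fun k => v (n + k)%N)) ->
  dfn (fun v => exists x, Q x v).
Proof.
elim: n Q => [|n IH] Q dQ.
  apply: eq_dfn dQ => v; split=> [h|[x]]; first by exists (\row_i v i).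
  by rewrite (_ : x = \row_i v i) //; apply/rowP => -[].
pose cons y (x : 'rV[R]_n) : 'rV[R]_n.+1 :=
  \row_i if unlift ord0 i is Some j then x ord0 j else y.
apply: (@eq_dfn (fun v => exists x, exists y, Q (cons y x) v)).
  move=> v; split=> [[x [y h]]|[x h]]; first by exists (cons y x).
  exists (\row_j x ord0 (lift ord0 j)), (x ord0 ord0).
  rewrite (_ : cons _ _ = x) //; apply/rowP => i; rewrite mxE.
  by case: unliftP => [j|] -> //; rewrite mxE.
apply: (IH (fun x v => exists y, Q (cons y x) v)).
apply: (@dfn_ex (fun y v => Q (cons y (\row_i v i)) (fun k => v (n + k)%N))) => /=.
apply: eq_dfn dQ => v.
rewrite (_ : cons _ _ = \row_i v i) //; apply/rowP => i; rewrite !mxE.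
by case: unliftP => [j|] -> //; rewrite mxE.
Qed.

Lemma dfn_allr n (Q : 'rV[R]_n -> (nat -> R) -> Prop) :
  dfn (fun v => Q (\row_i v i) (fun k => v (n + k)%N)) ->
  dfn (fun v => forall x, Q x v).
Proof.
move=> dQ; apply: (@eq_dfn (fun v => ~ exists x, ~ Q x v)).
  move=> v; split=> [h y|h [y]]; last by apply.
  by apply: contrapT => nQ; apply: h; exists y.
by apply: dfn_not; apply: (@dfn_exr _ (fun x v => ~ Q x v)); apply: dfn_not.
Qed.

(** Substitution needs terms over one number of variables; a formula uses only finitely many of the
    [t k], so a common bound exists. *)
Lemma dterm_common N (t : nat -> (nat -> R) -> R) :
  (forall k, (k < N)%N -> dterm (t k)) ->
  exists M, forall k, (k < N)%N -> exists tau : term S M,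
    forall v : nat -> R, teval (\row_i v i) tau = t k v.
Proof.
elim: N => [|N IH] dt; first by exists 0%N.
have [k kN|M hM] := IH; first by apply: dt; exact: leqW.
have [M' [tau etau]] := dt N (leqnn _).
exists (maxn M M') => k; rewrite ltnS leq_eqVlt => /orP[/eqP ->|/hM [tau' etau']].
  have [sigma es] := dterm_widen tau (leq_maxr M M').
  by exists sigma => v; rewrite es.
have [sigma es] := dterm_widen tau' (leq_maxl M M').
by exists sigma => v; rewrite es.
Qed.

Lemma dfn_subst P (t : nat -> (nat -> R) -> R) :
  (forall k, dterm (t k)) -> dfn P -> dfn (fun v => P (fun k => t k v)).
Proof.
move=> dt [N [phi h]].
have [M /(_ _ (ltn_ord _)) hM] := @dterm_common N t (fun k _ => dt k).
have {hM}[tau etau] := choice hM.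
exists M, (fsubst phi tau) => v; rewrite sat_subst -h.
rewrite (_ : \row_i teval _ (tau i) = \row_i t i v) //.
by apply/rowP => i; rewrite !mxE.
Qed.

Lemma definable_dfn n (A : set 'rV[R]_n) :
  definable S A <-> dfn (fun v => A (\row_i v i)).
Proof.
split=> [[phi ->]|[N [phi h]]]; first by exists n, phi => v.
(* The formula may mention variables beyond [n]. They are set to 0 both in the formula ([s]) and in
   the environment ([ext]), which [A] does not see. *)
pose s (i : 'I_N) : term S n := if insub (i :
  nat) is Some j then TVar S j else TCst S n 0.
pose ext (x : 'rV[R]_n) (k : nat) : R := if insub k is Some j then x ord0 j else 0.
have extE x : \row_(i < n) ext x i = x by apply/rowP => i; rewrite mxE /ext valK.
exists (fsubst phi s); apply/seteqP; split=> x /=; rewrite sat_subst.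
  rewrite -{1}(extE x) -h; congr sat.
  by apply/rowP => i; rewrite !mxE /ext /s; case: insubP.
rewrite -{2}(extE x) -h; congr sat.
by apply/rowP => i; rewrite !mxE /ext /s; case: insubP.
Qed.

Lemma dfn_set n (A : set 'rV[R]_n) (t : 'I_n -> (nat -> R) -> R) :
  definable S A -> (forall i, dterm (t i)) -> dfn (fun v => A (\row_i t i v)).
Proof.
move=> /definable_dfn dA dt.
pose t' k := if insub k is Some j then t j else fun=> 0.
have dt' k : dterm (t' k) by rewrite /t'; case: insub => //; exact: dterm_cst.
apply: eq_dfn (dfn_subst dt' dA) => v.
suff -> : \row_i t' i v = \row_i t i v by [].
by apply/rowP => i; rewrite !mxE /t' valK.
Qed.

Lemma definable_set n (P : 'rV[R]_n -> Prop) :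
  dfn (fun v => P (\row_i v i)) -> definable S [set x | P x].
Proof. by move=> h; apply/definable_dfn. Qed.

Lemma definableT n : definable S (setT : set 'rV[R]_n).
Proof. by apply: definable_set; exact: dfn_cst. Qed.

Lemma definable0 n : definable S (set0 : set 'rV[R]_n).
Proof. by apply/definable_dfn; exact: dfn_cst. Qed.

Lemma definableI n (A B : set 'rV[R]_n) :
  definable S A -> definable S B -> definable S (A `&` B).
Proof. by rewrite !definable_dfn; exact: dfn_and. Qed.

Lemma definableU n (A B : set 'rV[R]_n) :
  definable S A -> definable S B -> definable S (A `|` B).
Proof. by rewrite !definable_dfn; exact: dfn_or. Qed.

Lemma definableD n (A B : set 'rV[R]_n) :
  definable S A -> definable S B -> definable S (A `\` B).
Proof.
by rewrite !definable_dfn => dA dB; apply: dfn_and => //; apply: dfn_not.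
Qed.

Lemma definable_bigcup n (C : set (set 'rV[R]_n)) :
  finite_set C -> (forall A, C A -> definable S A) ->
  definable S (\bigcup_(A in C) A).
Proof.
move=> /finite_seqP[s ->]; elim: s => [_|A s IH dC].
  rewrite (_ : \bigcup_(A in _) A = set0); first exact: definable0.
  by apply/seteqP; split=> x // [].
rewrite (_ : \bigcup_(B in _) B = A `|` \bigcup_(B in [set` s]) B).
  apply: definableU; first by apply: dC => /=; rewrite mem_head.
  by apply: IH => B sB; apply: dC => /=; rewrite in_cons sB orbT.
apply/seteqP; split=> [x [B /= +] Bx|x].
  by rewrite in_cons => /predU1P[<-|sB]; [left|right; exists B].
case=> [Ax|[B /= sB Bx]]; first by exists A => //=; rewrite mem_head.
by exists B => //=; rewrite in_cons sB orbT.
Qed.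

End Definable.

(** * Definable sets of the line *)

Section OMinimal.
Variables (R : realType) (S : expansion R).
Hypothesis S_omin : o_minimal S.

Local Notation dfn1 A := (dfn S (fun v => A (v 0%N))).

Lemma dfn1_itvs (A : set R) : dfn1 A ->
  exists s : seq (interval R), forall x, A x <-> has (fun i => x \in i) s.
Proof.
move=> dA; have /S_omin[s As] : definable S [set x : 'rV[R]_1 | A (x ord0 ord0)].
  by apply: definable_set; apply: eq_dfn dA => v; rewrite mxE.
exists s => x; have := congr1 (@^~ (\row_(_ < 1) x)) As => /=.
by rewrite mxE => ->.
Qed.

(** Countable sets have Lebesgue measure zero, the interval has measure [b - a]. *)
Lemma itv_uncountable (a b : R) : a < b -> ~ countable [set x | a < x < b].
Proof.
move=> ab /countable_lebesgue_measure0 /eqP.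
rewrite (_ : [set x | _] = `]a, b[%classic); last first.
  by apply/seteqP; split=> x /=; rewrite in_itv.
rewrite lebesgue_measure_itv /= lte_fin ab -EFinD eqe subr_eq0 => /eqP ba.
by rewrite ba ltxx in ab.
Qed.

(** Each interval of the decomposition has at most one point or, by convexity, contains everything
    between two of its points. *)
Lemma dfn1_finite_or_itv (A : set R) : dfn1 A ->
  finite_set A \/ exists a b, a < b /\ forall x, a < x < b -> A x.
Proof.
move=> /dfn1_itvs[s As].
have {As} -> : A = [set x | has (fun i => x \in i) s].
  by apply/seteqP; split=> x /=; rewrite As.
elim: s => [|i s [fs|[a [b [ab h]]]]] /=.
- by left; rewrite (_ : [set _ | _] = set0) // -subset0 => x.
- have [[a [b [ai bi ab]]]|one] :=
    pselect (exists a b, [/\ a \in i, b \in i & a < b]).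
    right; exists a, b; split=> // x /andP[ax xb].
    apply/orP; left; apply: (interval_is_interval ai bi).
    by rewrite !ltW.
  left; apply: (@sub_finite_set _ _
      ([set x | x \in i] `|` [set x | has (fun i => x \in i) s])).
    by move=> x /= /orP[]; [left|right].
  rewrite finite_setU; split=> //.
  have [[x xi]|n] := pselect (exists x, x \in i); last first.
    by rewrite (_ : [set _ | _] = set0) // -subset0 => x xi; apply: n; exists x.
  apply: (@sub_finite_set _ _ [set x]); last exact: finite_set1.
  move=> y yi /=; apply/eqP; apply: contrapT => /negP; rewrite neq_lt.
  by move=> /orP[xy|xy]; apply: one; [exists y, x|exists x, y].
- by right; exists a, b; split=> // x /h ->; rewrite orbT.
Qed.

(** Turns counting into finiteness: the set has to be definable, but the reason for its countability
    need not be. *)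
Lemma countable_dfn1_finite (A : set R) : dfn1 A -> countable A -> finite_set A.
Proof.
move=> dA cA; have [//|[a [b [ab h]]]] := dfn1_finite_or_itv dA.
by case: (itv_uncountable ab); apply: sub_countable cA; exact: subset_card_le.
Qed.

(** An interval that contains [x0] and misses some later [y] misses everything after [y]. *)
Lemma dfn1_pinfty (A : set R) : dfn1 A ->
  exists M, (forall x, M < x -> A x) \/ (forall x, M < x -> ~ A x).
Proof.
move=> /dfn1_itvs[s As].
suff [M [h|h]] : exists M : R,
    (forall x, M < x -> has (fun i : interval R => x \in i) s) \/
    (forall x, M < x -> ~~ has (fun i : interval R => x \in i) s).
- by exists M; left=> x /h /As.
- by exists M; right=> x /h /negP + /As.
elim: s {As} => [|i s [M [h|h]]]; first by exists 0; right.
  by exists M; left => x /h /= ->; rewrite orbT.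
have [[x0 x0i]|n] := pselect (exists x, x \in i); last first.
  exists M; right=> x /h /= /negbTE ->; rewrite orbF; apply/negP => xi.
  by apply: n; exists x.
have [[y [yx yi]]|all] := pselect (exists y, x0 < y /\ y \notin i).
  exists (Num.max M y); right=> x; rewrite gt_max => /andP[/h /negbTE Mx yltx] /=.
  rewrite Mx orbF; apply: contra yi => xi.
  by apply: (interval_is_interval x0i xi); rewrite !ltW.
exists x0; left=> x x0x /=; rewrite (_ : x \in i) //.
by apply: contrapT => /negP xi; apply: all; exists x.
Qed.

(* One point in each of the intervals that make up [A]. *)
Lemma dfn1_test_points (A : set R) : dfn1 A ->
  exists T : set R, finite_set T /\ forall t, A t -> exists x, T x /\
    forall y, Num.min t x <= y <= Num.max t x -> A y.
Proof.
move=> /dfn1_itvs[s As].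
pose pt (i : interval R) := xget 0 [set x | x \in i].
exists [set x | x \in map pt s]; split.
  by apply/finite_seqP; exists (map pt s).
move=> t /As /hasP[i si ti]; exists (pt i); split; first exact: map_f.
move=> y yP; apply/As/hasP; exists i => //.
have pi : pt i \in i by rewrite /pt; case: xgetP => [x -> //|/(_ t)].
move: yP; have [tp|tp] := leP t (pt i).
  exact: (interval_is_interval ti pi).
exact: (interval_is_interval pi ti).
Qed.

End OMinimal.

(** * Values at local extrema; the sup norm in coordinates *)

Lemma countable_range_rat2 (T : Type) (f : rat * rat -> T) : countable (range f).
Proof. exact: card_le_trans (card_image_le _ _) (countableP _). Qed.

Lemma countable_setU (T : Type) (A B : set T) :
  countable A -> countable B -> countable (A `|` B).
Proof.
move=> cA cB; rewrite -bigcup2E; apply: bigcup_countable => // -[|[|]] //=.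
Qed.

(** A local maximum is a maximum over some interval with rational ends, and that interval determines
    the value. *)
Lemma countable_local_max (R : realType) (A : set R) (f : R -> R) :
  countable [set f u | u in [set u | A u /\ exists2 d, 0 < d &
    forall w, A w -> `|w - u| < d -> f w <= f u]].
Proof.
pose P (p : rat * rat) t := exists u, [/\ A u, ratr p.1 < u < ratr p.2, f u = t &
  forall w, A w -> ratr p.1 < w < ratr p.2 -> f w <= t].
have Puniq p s t : P p s -> P p t -> s = t.
  move=> [u [Au up <- hu]] [w [Aw wp <- hw]].
  by apply/eqP; rewrite eq_le hu // hw.
apply: sub_countable (countable_range_rat2 (fun p => xget 0 (P p))).
apply: subset_card_le => _ [u [Au [d d0 hd]] <-].
have [q] := @rat_in_itvoo R (u - d) u ltac:(lra).
have [r] := @rat_in_itvoo R u (u + d) ltac:(lra).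
rewrite !in_itv /= => /andP[r1 r2] /andP[q1 q2].
have Pu : P (q, r) (f u).
  exists u; split=> //=; first by rewrite q2 r1.
  by move=> w Aw /andP[qw wr]; apply: hd => //; rewrite ltr_norml; apply/andP;
    split; lra.
exists (q, r) => //=; case: xgetP => [t -> /Puniq|/(_ _ Pu)//]; exact.
Qed.

Lemma countable_local_min (R : realType) (A : set R) (f : R -> R) :
  countable [set f u | u in [set u | A u /\ exists2 d, 0 < d &
    forall w, A w -> `|w - u| < d -> f u <= f w]].
Proof.
have := countable_local_max A (fun u => - f u).
move=> /(card_le_trans (card_image_le -%R _)); apply: sub_countable.
apply: subset_card_le => _ [u [Au [d d0 hd]] <-].
exists (- f u); last by rewrite opprK.
exists u => //; split=> //; exists d => // w Aw wu.
by rewrite lerN2; exact: hd.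
Qed.

Lemma within_continuous_dist (R : realType) (V W : normedModType R) (A : set V)
    (f : V -> W) :
  (forall x, A x -> forall e, 0 < e -> exists2 d, 0 < d &
     forall y, A y -> `|y - x| < d -> `|f y - f x| < e) ->
  {within A, continuous f}.
Proof.
move=> h; apply/subspace_continuousP => x Ax.
apply/cvgrPdist_lt => e e0; have [d d0 hd] := h x Ax e e0.
rewrite near_withinE; apply/nbhs_ballP; exists d => //= y.
rewrite -ball_normE /= => xy Ay.
by rewrite distrC; apply: hd => //; rewrite distrC.
Qed.

Lemma norm_row_lt (R : realType) n (x : 'rV[R]_n) (e : R) : 0 < e ->
  `|x| < e <-> forall i, `|x ord0 i| < e.
Proof.
move=> e0; rewrite [ltLHS]/Num.Def.normr /= mx_normrE; split=> [h i|h].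
  by apply: le_lt_trans h; apply: (le_bigmax _ (fun ij => `|x ij.1 ij.2|) (ord0, i)).
by apply: bigmax_lt => // -[i j] _ /=; rewrite (ord1 i).
Qed.

Ltac dterm_tac := repeat (cbv beta; first
  [ apply: dterm_cst | apply: dterm_var | apply: dtermB | apply: dtermD
  | apply: dtermM | apply: dtermN | apply: dterm_row ]).

Ltac dfn_tac := repeat (cbv beta; first
  [ apply: dfn_cst | apply: dfn_and | apply: dfn_or | apply: dfn_imp
  | apply: dfn_not | apply: dfn_fin => ? | apply: dfn_ex | apply: dfn_all
  | apply: dfn_exr | apply: dfn_allr
  | apply: dfn_norm_lt; dterm_tac | apply: dfn_norm_le; dterm_tac
  | apply: dfn_lt; dterm_tac | apply: dfn_le; dterm_tac
  | apply: dfn_eq; dterm_tac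
  | apply: dfn_set; [assumption|move=> ?; dterm_tac] ]).

(** * Affine pieces of the line *)

Section Ends.
Variable R : realType.

(* [s = false] is the end [+oo], [s = true] is [-oo]. *)
Definition toward (s : bool) (u : R) := if s then - u else u.
Definition eventually_in (s : bool) (A : set R) :=
  exists M, forall u, M < toward s u -> A u.
Definition eventually_const (A : set R) :=
  forall s, eventually_in s A \/ eventually_in s (~` A).

Lemma towardK s : involutive (toward s).
Proof. by case: s => u //=; rewrite opprK. Qed.

Lemma toward_norm s u : `|toward s u| = `|u|.
Proof. by case: s; rewrite /toward ?normrN. Qed.

Lemma towardB s u w : toward s (u - w) = toward s u - toward s w.
Proof. by case: s => //=; rewrite opprB opprK addrC. Qed.

Lemma eventually_in_sub s (A B : set R) :
  A `<=` B -> eventually_in s A -> eventually_in s B.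
Proof. by move=> AB [M h]; exists M => u /h/AB. Qed.

Lemma eventually_inI s (A B : set R) :
  eventually_in s A -> eventually_in s B -> eventually_in s (A `&` B).
Proof.
move=> [M hM] [N hN]; exists (Num.max M N) => u.
by rewrite gt_max => /andP[/hM ? /hN ?].
Qed.

Lemma eventually_in_ex s (A : set R) M : eventually_in s A ->
  exists2 u, A u & M < toward s u.
Proof.
move=> [N h]; exists (toward s (Num.max M N + 1)).
  by apply: h; rewrite towardK (@le_lt_trans _ _ (Num.max M N)) ?ltrDl // le_max
    lexx orbT.
by rewrite towardK (@le_lt_trans _ _ (Num.max M N)) ?ltrDl // le_max lexx.
Qed.

Lemma eventually_in_bigcap s (I : eqType) (T : set I) (P : I -> set R) :
  finite_set T -> (forall t, T t -> eventually_in s (P t)) ->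
  eventually_in s (\bigcap_(t in T) P t).
Proof.
move=> /finite_seqP[r ->]; elim: r => [_|t r IH h].
  by exists 0 => u _ t.
have ht : eventually_in s (P t) by apply: h; rewrite /= mem_head.
have hr : eventually_in s (\bigcap_(t in [set` r]) P t).
  by apply: IH => q rq; apply: h; rewrite /= in_cons rq orbT.
have [M hM] := eventually_inI ht hr.
exists M => u /hM[Pu Qu] q /=; rewrite in_cons => /predU1P[->//|]; exact: Qu.
Qed.

Lemma eventually_in_le s A : eventually_in s A ->
  exists m : nat, forall u, m%:R < toward s u -> A u.
Proof.
move=> [M h]; exists (Num.truncn `|M|).+1 => u mu; apply: h.
by rewrite (le_lt_trans (ler_norm _)) // (lt_trans _ mu) // truncnS_gt.
Qed.

Lemma eventually_in_contra s (A : set R) :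
  eventually_in s A -> eventually_in s (~` A) -> False.
Proof. by move=> iA iN; have [u []] := eventually_in_ex 0 (eventually_inI iA iN). Qed.

Lemma toward_le_norm s (u : R) : toward s u <= `|u|.
Proof. by rewrite -(toward_norm s); exact: ler_norm. Qed.

Lemma lt_norm_toward M (u : R) : M < `|u| -> exists s, M < toward s u.
Proof.
by have [u0|u0] := ger0P u => Mu; [exists false|exists true].
Qed.

Lemma toward_between s M (a b x : R) : Num.min a b <= x <= Num.max a b ->
  M < toward s a -> M < toward s b -> M < toward s x.
Proof.
by rewrite ge_min le_max /toward => /andP[/orP[?|?] /orP[?|?]]; case: s => ? ?; lra.
Qed.

Lemma eventually_in_both (A : set R) : (forall s, eventually_in s A) ->
  exists M, 0 <= M /\ forall u, M < `|u| -> A u.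
Proof.
move=> iA; have [M hM] := iA false; have [N hN] := iA true.
exists (Num.max 0 (Num.max M N)); split; first by rewrite le_max lexx.
move=> u; rewrite !gt_max => /and3P[_ Mu Nu].
have [u0|u0] := leP 0 u; first by apply: hM; rewrite /= -(ger0_norm u0).
by apply: hN; rewrite /= -(ltr0_norm u0).
Qed.

End Ends.

Section Curve.
Variables (R : realType) (S : expansion R).
Hypothesis S_omin : o_minimal S.
Variables (n : nat) (U : set R) (F : R -> 'rV[R]_n).

Local Notation dfn1 A := (dfn S (fun v => A (v 0%N))).

(** The sup-norm ball, spelled out by coordinates so that it unfolds to a formula. *)
Definition row_close (d : R) (x y : 'rV[R]_n) :=
  forall i, `|y ord0 i - x ord0 i| < d.

(* [F] is a homeomorphism from the open set [U] onto the definable set [F @` U];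
   it is definable on bounded parts of [U] only. *)
Hypothesis F_cont : forall u, U u -> forall e : R, 0 < e ->
  exists2 d : R, 0 < d & forall w, `|w - u| < d -> U w /\ row_close e (F u) (F w).
Hypothesis F_inv : forall u, U u -> forall e : R, 0 < e ->
  exists2 d : R, 0 < d & forall w, U w -> row_close d (F u) (F w) -> `|w - u| < e.
Hypothesis U_def : forall m : R, dfn1 (fun u => U u /\ `|u| <= m).
Hypothesis F_def : forall (m : R) i,
  dfn S (fun v => (U (v 0%N) /\ `|v 0%N| <= m) /\ F (v 0%N) ord0 i = v 1%N).
Hypothesis D_def : definable S (F @` U).

Lemma F_inj u w : U u -> U w -> F u = F w -> u = w.
Proof.
move=> Uu Uw e; apply/eqP; rewrite -subr_eq0 -normr_eq0; apply/eqP.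
apply: contrapT => /eqP; rewrite neq_lt ltNge normr_ge0 /= => wu.
have [d d0 h] := F_inv Uw wu.
suff : `|u - w| < `|u - w| by rewrite ltxx.
by apply: h => // i; rewrite e subrr normr0.
Qed.

(** Definability is asked of the image in the chart; on the line only the bounded parts of [A] turn
    out to be definable ([good_dfn]). *)
Definition good (A : set R) := A `<=` U /\ definable S (F @` A).

Lemma good_img A u : good A -> U u -> (F @` A) (F u) -> A u.
Proof. by move=> [AU _] Uu [w Aw /F_inj <-] //; exact: AU. Qed.

Lemma good_pre A (Q : set 'rV[R]_n) : good A -> definable S Q ->
  good (A `&` F @^-1` Q).
Proof.
move=> [AU dA] dQ; split; first by move=> u [] /AU.
rewrite (_ : _ @` _ = (F @` A) `&` Q); first exact: definableI.
apply/seteqP; split=> [_ [u [Au Qu] <-]|_ [[u Au <-] Qu]]; first by split=> //;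
  exists u.
by exists u.
Qed.

Lemma goodD A B : good A -> good B -> good (A `\` B).
Proof.
move=> gA gB; have [AU dA] := gA; have [_ dB] := gB.
split; first by move=> u [] /AU.
rewrite (_ : _ @` _ = (F @` A) `\` (F @` B)); first exact: definableD.
apply/seteqP; split=> [_ [u [Au nB] <-]|_ [[u Au <-] nB]].
  by split; [exists u|move=> /(good_img gB (AU _ Au))].
by exists u => //; split=> // Bu; apply: nB; exists u.
Qed.

Lemma goodT : good U. Proof. by split. Qed.

(** Over bounded sets the graph of [F] is definable, so definability passes from the line to the
    chart; [good_dfn] goes the other way. *)
Lemma good_bounded B m : dfn1 B -> B `<=` U -> (forall u, B u -> `|u| <= m) ->
  good B.
Proof.
move=> dB BU Bm; split=> //; apply/definable_dfn.
apply: (@eq_dfn _ _ (fun v => exists u, (B u /\ `|u| <= m) /\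
   forall i : 'I_n, (U u /\ `|u| <= m) /\ F u ord0 i = v i)).
  move=> v; split=> [[u [[Bu um] h]]|[u Bu h]].
    by exists u => //; apply/rowP => i; rewrite mxE; case: (h i).
  exists u; split; first by split=> //; exact: Bm.
  by move=> i; split; [split; [exact: BU|exact: Bm]|rewrite h mxE].
apply: dfn_ex; cbv beta; apply: dfn_and; first by apply: dfn_and => //; dfn_tac.
apply: dfn_fin => i.
pose t k v : R := if k is 0%N then v 0%N else v (i.+1).
have dt k : dterm S (t k) by case: k => [|k]; rewrite /t; dterm_tac.
exact: dfn_subst dt (F_def m i).
Qed.

Lemma good_dfn A m : good A -> dfn1 (fun u => A u /\ `|u| <= m).
Proof.
move=> gA; have [AU dA] := gA.
apply: (@eq_dfn _ _ (fun v => (U (v 0%N) /\ `|v 0%N| <= m) /\ exists x,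
   (F @` A) x /\ forall i : 'I_n, (U (v 0%N) /\ `|v 0%N| <= m) /\
     F (v 0%N) ord0 i = x ord0 i)).
  move=> v; split=> [[[Uu um] [x [Ax h]]]|[Au um]]; last first.
    by split; [split=> //; exact: AU|exists (F (v 0%N)); split;
      [exists (v 0%N)|move=> i; split=> //; split=> //; exact: AU]].
  split=> //; apply: (good_img gA) => //.
  by rewrite (_ : F _ = x) //; apply/rowP => i; case: (h i).
apply: dfn_and; first exact: U_def.
apply: dfn_exr; cbv beta; apply: dfn_and; first by dfn_tac.
apply: dfn_fin => i.
pose t k v : R := if k is 0%N then v (n + 0)%N else v i.
have dt k : dterm S (t k) by case: k => [|k]; rewrite /t; dterm_tac.
apply: eq_dfn (dfn_subst dt (F_def m i)) => v /=.
by rewrite mxE.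
Qed.

Lemma compact_img L : compact L -> L `<=` U -> compact (F @` L).
Proof.
move=> cL LU; apply: continuous_compact cL.
apply: within_continuous_dist => u Lu e e0.
have [d d0 h] := F_cont (LU _ Lu) e0; exists d => // w Lw /h[_ Fw].
by apply/norm_row_lt => // i; rewrite !mxE.
Qed.

(** The inverse of [F], continuous by [F_inv], carries [Q] onto this set. *)
Lemma compact_pre Q : compact Q -> Q `<=` F @` U -> compact (U `&` F @^-1` Q).
Proof.
move=> cQ QU; pose G x := xget 0 [set u | U u /\ F u = x].
have FG x : Q x -> U (G x) /\ F (G x) = x.
  by move=> /QU[u Uu Fu]; rewrite /G; case: xgetP => [w -> //|/(_ u)[]].
have -> : U `&` F @^-1` Q = G @` Q.
  apply/seteqP; split=> [u [Uu Qu]|_ [x Qx <-]].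
    by exists (F u) => //; have [Ux e] := FG _ Qu; exact: F_inj e.
  by have [Ux e] := FG _ Qx; split=> //=; rewrite e.
apply: continuous_compact cQ; apply: within_continuous_dist => x Qx e e0.
have [Ux Fx] := FG _ Qx; have [d d0 h] := F_inv Ux e0; exists d => // y Qy yx.
have [Uy Fy] := FG _ Qy; apply: h => // i.
by move/norm_row_lt: yx => /(_ d0 i); rewrite Fx Fy !mxE.
Qed.

(** * Fibers of one coordinate on a good set *)

Section Fibers.
Variables (A : set R) (j : 'I_n).
Hypothesis gA : good A.
Local Notation h u := (F u ord0 j).
Local Notation DA := (F @` A).

Let AU : A `<=` U. Proof. by case: gA. Qed.
Let dA : definable S DA. Proof. by case: gA. Qed.

(* Read on [D]: local extrema of the [j]-th coordinate on [F @` A], and points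
   that are not interior to [F @` A]. *)
Definition singular (x : 'rV[R]_n) : Prop :=
  (exists d, 0 < d /\ forall y, DA y -> row_close d x y -> y ord0 j <= x ord0 j) \/
  (exists d, 0 < d /\ forall y, DA y -> row_close d x y -> x ord0 j <= y ord0 j) \/
  (forall d, 0 < d -> exists y, ((F @` U) y /\ ~ DA y) /\ row_close d x y).

Lemma definable_singular : definable S (singular : set 'rV[R]_n).
Proof. apply: definable_set; rewrite /singular /row_close; dfn_tac. Qed.

Definition sing_pts : set R := A `&` F @^-1` singular.
Definition sing_vals : set R := [set h u | u in sing_pts].

Lemma interior_or_singular u : A u -> ~ singular (F u) ->
  exists2 d, 0 < d & forall w, `|w - u| < d -> A w.
Proof.
move=> Au /not_orP[_ /not_orP[_ /existsNP[e /not_implyP[e0 ne]]]].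
have [d d0 hd] := F_cont (AU Au) e0; exists d => // w /hd[Uw Fw].
apply: (good_img gA) => //; apply: contrapT => nw; apply: ne.
by exists (F w); do 2 split => //; exists w.
Qed.

Lemma regular_nonmax u e : A u -> ~ singular (F u) -> 0 < e ->
  exists w, [/\ A w, `|w - u| < e & h u < h w].
Proof.
move=> Au /not_orP[nm _] e0; have [d d0 hd] := F_inv (AU Au) e0.
apply: contrapT => nw; apply: nm; exists d; split=> // _ [w Aw <-] /hd cl.
rewrite leNgt; apply/negP => lt; apply: nw; exists w; split=> //.
by apply: cl; exact: AU.
Qed.

Lemma regular_nonmin u e : A u -> ~ singular (F u) -> 0 < e ->
  exists w, [/\ A w, `|w - u| < e & h w < h u].
Proof.
move=> Au /not_orP[_ /not_orP[nm _]] e0; have [d d0 hd] := F_inv (AU Au) e0.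
apply: contrapT => nw; apply: nm; exists d; split=> // _ [w Aw <-] /hd cl.
rewrite leNgt; apply/negP => lt; apply: nw; exists w; split=> //.
by apply: cl; exact: AU.
Qed.

(** The part of [A] with norm at most [m] is definable, hence so is the set [B m] of its
    non-interior points. [B m] contains no interval, so it is finite, and the sets [B m] cover the
    boundary points in question. *)
Lemma countable_boundary : countable [set u | A u /\
  forall d, 0 < d -> exists w, `|w - u| < d /\ ~ A w].
Proof.
pose B (m : nat) := [set u | A u /\ `|u| <= m%:R /\ forall d, 0 < d ->
  exists w, `|w - u| < d /\ ~ (A w /\ `|w| <= m%:R)] .
apply: (@sub_countable _ _ _ (\bigcup_m B m)).
  apply: subset_card_le => u [Au nu].
  have um : `|u| <= (Num.truncn `|u|).+1%:R by exact/ltW/truncnS_gt.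
  exists (Num.truncn `|u|).+1 => //; split=> //; split=> // d d0.
  by have [w [wu nAw]] := nu d d0; exists w; split=> // -[].
apply: bigcup_countable => // m _; apply: finite_set_countable.
have dB : dfn1 (B m).
  have dAm := good_dfn m%:R gA.
  apply: (@eq_dfn _ _ (fun v => (A (v 0%N) /\ `|v 0%N| <= m%:R) /\ forall d, 0 < d ->
     exists w, `|w - v 0%N| < d /\ ~ (A w /\ `|w| <= m%:R))).
    by move=> v; rewrite /B /=; split=> [[[? ?] ?]|[? [? ?]]].
  apply: dfn_and => //; apply: dfn_all; cbv beta; apply: dfn_imp; first by dfn_tac.
  apply: dfn_ex; cbv beta; apply: dfn_and; first by dfn_tac.
  exact: dfn_not dAm.
have [//|[a [b [ab hB]]]] := dfn1_finite_or_itv S_omin dB.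
have /hB[_ [_ /(_ ((b - a) / 2))[|w [wab []]]]] :
  a < (a + b) / 2 < b by apply/andP; split; lra.
  by lra.
have /hB[Aw [wm _]] //: a < w < b.
by move: wab; rewrite ltr_norml => /andP[? ?]; apply/andP; split; lra.
Qed.

Lemma dfn_sing_vals : dfn1 sing_vals.
Proof.
have ds := definable_singular.
apply: (@eq_dfn _ _ (fun v => exists x, (DA x /\ singular x) /\ x ord0 j = v 0%N)).
  move=> v; split=> [[_ [[[u Au <-] su] <-]]|[u [Au su] <-]]; first by exists u.
  by exists (F u); split=> //; split=> //; exists u.
by apply: dfn_exr; cbv beta; apply: dfn_and; [apply: dfn_and|]; dfn_tac.
Qed.

(** Definable, since [singular] is read in the chart. Countable, since on the line a singular point
    is a local extremum, and these have countably many values, or one of the countably many boundary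
    points of [A]. *)
Lemma finite_sing_vals : finite_set sing_vals.
Proof.
apply: (countable_dfn1_finite S_omin dfn_sing_vals).
apply: (@sub_countable _ _ _
  ([set h u | u in [set u | A u /\ exists2 d, 0 < d &
    forall w, A w -> `|w - u| < d -> h w <= h u]] `|`
   ([set h u | u in [set u | A u /\ exists2 d, 0 < d &
    forall w, A w -> `|w - u| < d -> h u <= h w]] `|`
   [set h u | u in [set u | A u /\
    forall d, 0 < d -> exists w, `|w - u| < d /\ ~ A w]])));
  last first.
  apply: countable_setU; first exact: countable_local_max.
  apply: countable_setU; first exact: countable_local_min.
  exact: card_le_trans (card_image_le _ _) countable_boundary.
apply: subset_card_le => _ [u [Au su] <-].
case: su => [[d [d0 hd]]|[[d [d0 hd]]|hs]].
- left; exists u => //; split=> //; have [e e0 he] := F_cont (AU Au) d0.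
  by exists e => // w Aw /he[_ cl]; apply: (hd (F w)) => //; exists w.
- right; left; exists u => //; split=> //; have [e e0 he] := F_cont (AU Au) d0.
  by exists e => // w Aw /he[_ cl]; apply: (hd (F w)) => //; exists w.
- right; right; exists u => //; split=> // d d0.
  have [e e0 he] := F_inv (AU Au) d0.
  have [_ [[[w Uw <-] nw] cl]] := hs e e0.
  by exists w; split; [exact: he|move=> Aw; apply: nw; exists w].
Qed.

Let fib t := A `&` [set u | h u = t].

Lemma good_fiber t : good (fib t).
Proof.
apply: (good_pre gA (Q := [set x | x ord0 j = t])).
by apply: definable_set; dfn_tac.
Qed.

Hypothesis fib_ev : forall t, eventually_const (fib t).

(** On a tail filled by the fiber the coordinate is constant, so every point there would be a local
    extremum. The point at [M + 1] is used because its neighbours at distance below 1 stay beyond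
    [M]. *)
Lemma fiber_out t s : ~ sing_vals t -> eventually_in s (~` fib t).
Proof.
move=> nt; have [[M fM]|//] := fib_ev t s.
have Mu : M < toward s (toward s (M + 1)) by rewrite towardK; lra.
have [Au hu] := fM _ Mu.
have nu : ~ singular (F (toward s (M + 1))).
  by move=> su; apply: nt; exists (toward s (M + 1)).
have [w [Aw wu]] := regular_nonmax Au nu ltr01.
have [_ ->] : fib t w; last by rewrite hu ltxx.
apply: fM; move: wu; rewrite -(toward_norm s) towardB towardK.
by rewrite ltr_norml => /andP[? ?]; lra.
Qed.

(** The fiber avoids both ends, hence is bounded and definable; an interval inside it would consist
    of local extrema. *)
Lemma finite_fiber t : ~ sing_vals t -> finite_set (fib t).
Proof.
move=> nt.
have [m hm] := eventually_in_le (fiber_out false nt).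
have [k hk] := eventually_in_le (fiber_out true nt).
pose B := [set u | fib t u /\ `|u| <= (m + k)%:R].
have dB : dfn1 B := good_dfn (m + k)%:R (good_fiber t).
have -> : fib t = B.
  apply/seteqP; split=> u [Au hu] //; split=> //.
  have um := ler0n R m; have uk := ler0n R k.
  rewrite natrD ler_norml; apply/andP; split.
    by rewrite lerNl leNgt; apply/negP => ku; apply: (hk u) => //=; lra.
  by rewrite leNgt; apply/negP => ku; apply: (hm u) => //=; lra.
have [//|[a [b [ab hB]]]] := dfn1_finite_or_itv S_omin dB.
have /hB[[Au hu] _] : a < (a + b) / 2 < b by apply/andP; split; lra.
have nu : ~ singular (F ((a + b) / 2)).
  by move=> su; apply: nt; exists ((a + b) / 2).
have [|w [Aw wu]] := regular_nonmax Au nu (e := (b - a) / 2); first by lra.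
suff /hB[[_ ->] _] : a < w < b by rewrite hu ltxx.
by move: wu; rewrite ltr_norml => /andP[? ?]; apply/andP; split; lra.
Qed.

(** A compact exhaustion of the interior of [A]: the uniform margin makes each [core m] closed
    although [A] need not be. *)
Definition core (m : nat) : set R := [set u | (A u /\ `|u| <= m%:R) /\
  forall w, `|w - u| < m.+1%:R^-1 -> A w].

Lemma compact_core m : compact (core m).
Proof.
apply: (subclosed_compact _ (@segment_compact R (- m%:R) m%:R)).
- move=> u clu; have near d : 0 < d -> exists2 v, core m v & `|u - v| < d.
    move=> d0; have [v [Kv]] := clu _ (nbhsx_ballx u d d0).
    by rewrite -ball_normE /= => uv; exists v.
  have cu w : `|w - u| < m.+1%:R^-1 -> A w.
    move=> wu; have [|v [_ Kv] uv] := near (m.+1%:R^-1 - `|w - u|).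
      by rewrite subr_gt0.
    by apply: Kv; apply: le_lt_trans (ler_distD u w v) _; rewrite -ltrBrDl.
  have pos : 0 < m.+1%:R^-1 :> R by rewrite invr_gt0.
  split=> //; split; first by apply: cu; rewrite subrr normr0.
  rewrite leNgt; apply/negP => mu.
  have [|v [[_ vm] _] uv] := near (`|u| - m%:R); first by lra.
  by have := ler_distD v u 0; rewrite !subr0; lra.
- by move=> u [[_]]; rewrite ler_norml /= in_itv.
Qed.

Lemma good_core m : good (core m).
Proof.
apply: (@good_bounded _ m%:R); [|by move=> u [[/AU]]|by move=> u [[]]].
have dm := good_dfn m%:R gA; have dm1 := good_dfn m.+1%:R gA.
(* The margin is at most 1, so the points [w] have norm at most [m + 1], and [A] may be replaced by
   its definable truncation there. *)
apply: (@eq_dfn _ _ (fun v => (A (v 0%N) /\ `|v 0%N| <= m%:R) /\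
   forall w, `|w - v 0%N| < m.+1%:R^-1 -> A w /\ `|w| <= m.+1%:R)).
  move=> v; split=> [[Av hv]|[Av hv]]; split=> // w wv; first by case: (hv w wv).
  split; first exact: hv.
  have w1 : `|w - v 0%N| < 1.
    by apply: lt_le_trans wv _; rewrite invf_le1 // ler1n.
  have := ler_distD (v 0%N) w 0; rewrite !subr0 -natr1; case: Av; lra.
apply: dfn_and => //; apply: dfn_all; cbv beta; apply: dfn_imp; first by dfn_tac.
exact: dm1.
Qed.

Lemma fiber_core t : ~ sing_vals t -> exists m, fib t `<=` core m.
Proof.
move=> nt; have /finite_seqP[r er] := finite_fiber nt.
suff [m hm] : exists m : nat, forall u, u \in r -> fib t u -> core m u.
  by exists m => u fu; apply: hm => //; move: (fu); rewrite er.
have core_mono m k : (m <= k)%N -> core m `<=` core k.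
  move=> mk u [[Au um] hu]; split.
    by split=> //; apply: le_trans um _; rewrite ler_nat.
  move=> w wu; apply: hu; apply: lt_le_trans wu _.
  by rewrite lef_pV2 ?posrE // ler_nat.
elim: r {er} => [|u r [m hm]]; first by exists 0%N.
have [fu|nfu] := pselect (fib t u); last first.
  by exists m => w; rewrite in_cons => /predU1P[->//|]; exact: hm.
have [Au hu] := fu.
have [|d d0 hd] := interior_or_singular Au.
  by move=> su; apply: nt; exists u.
(* The summands keep the points already treated, bound [u], and make the margin at most [d]. *)
pose k := (m + (Num.truncn `|u|).+1 + (Num.truncn d^-1).+1)%N.
exists k => w; rewrite in_cons => /predU1P[->{w} _|rw fw]; last first.
  by apply: (core_mono m); [rewrite /k -addnA leq_addr|exact: hm].
split; first split=> //.
  apply: (@le_trans _ _ (Num.truncn `|u|).+1%:R); first exact/ltW/truncnS_gt.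
  by rewrite ler_nat /k; lia.
move=> w wu; apply: hd; apply: lt_le_trans wu _.
rewrite invf_ple ?posrE //.
apply: (@le_trans _ _ (Num.truncn d^-1).+1%:R); first exact/ltW/truncnS_gt.
by rewrite ler_nat /k; lia.
Qed.

(* Over a good value, no end of a branch of the curve escapes. *)
Definition proper_at t := exists e, 0 < e /\
  compact (DA `&` [set x | `|x ord0 j - t| <= e]).

(** Closed and bounded, written by coordinates: this is a first-order condition, so [proper_at]
    becomes definable in [t]. *)
Lemma compact_rowE (Q : set 'rV[R]_n) : compact Q <->
  (exists M, forall x, Q x -> forall i, `|x ord0 i| <= M) /\
  (forall y, (forall d, 0 < d -> exists x, Q x /\ row_close d y x) -> Q y).
Proof.
split=> [cQ|[[M hM] cl]].
  split.
    have [M [Mr hM]] := compact_bounded cQ; exists (M + 1) => x Qx i.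
    have /hM/(_ x Qx) xM : M < M + 1 by rewrite ltrDl.
    rewrite leNgt; apply/negP => lt.
    have pos : 0 < `|x ord0 i| by apply: le_lt_trans lt; exact: le_trans xM.
    by have /norm_row_lt := le_lt_trans xM lt; move=> /(_ pos i); rewrite ltxx.
  move=> y hy; apply: (compact_closed (@norm_hausdorff _ _) cQ).
  move=> B /nbhs_ballP[d /= d0 dB]; have [x [Qx xy]] := hy d d0.
  exists x; split=> //; apply: dB; rewrite -ball_normE /= distrC.
  by apply/norm_row_lt => // i; rewrite !mxE; exact: xy.
apply: bounded_closed_compact.
  have pos : 0 < `|M| + 1 by have := normr_ge0 M; lra.
  exists (`|M| + 1); split; first exact: num_real.
  move=> N MN x Qx; apply/ltW/(lt_trans _ MN)/norm_row_lt => // i.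
  by have := hM x Qx i; have := ler_norm M; lra.
move=> y cy; apply: cl => d d0; have [x [Qx]] := cy _ (nbhsx_ballx y d d0).
rewrite -ball_normE /= distrC => /norm_row_lt h'; exists x; split=> // i.
by have := h' d0 i; rewrite !mxE.
Qed.

Lemma dfn_improper : dfn1 (fun t => ~ proper_at t).
Proof.
apply: dfn_not; apply: (@eq_dfn _ _ (fun v => exists e, 0 < e /\
  ((exists M, forall x, DA x /\ `|x ord0 j - v 0%N| <= e ->
     forall i, `|x ord0 i| <= M) /\
   (forall y, (forall d, 0 < d -> exists x,
      (DA x /\ `|x ord0 j - v 0%N| <= e) /\ row_close d y x) ->
      DA y /\ `|y ord0 j - v 0%N| <= e)))).
  by move=> v; split=> -[e [e0 /compact_rowE h]]; exists e.
by rewrite /row_close; dfn_tac.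
Qed.

(* The sets [T m] of values whose fiber lies in the compact set [core m] exhaust
   the regular values; by uncountability one of them contains an interval. *)
Lemma finite_improper : finite_set [set t | ~ proper_at t].
Proof.
have [//|[a [b [ab bad]]]] := dfn1_finite_or_itv S_omin dfn_improper.
pose T (m : nat) : set R := fun t =>
  (forall x, DA x -> x ord0 j = t -> (F @` core m) x) /\ (a < t /\ t < b).
have dT m : dfn1 (T m).
  have [_ dK] := good_core m; rewrite /T; dfn_tac.
have [m infT] : exists m, ~ finite_set (T m).
  apply: contrapT => /forallNP fT; apply: (itv_uncountable ab).
  apply: (@sub_countable _ _ _ (sing_vals `|` \bigcup_m T m)).
    apply: subset_card_le => t /andP[at_ tb].
    have [st|nt] := pselect (sing_vals t); [by left|right].
    have [m hm] := fiber_core nt; exists m => //; split=> // _ [u Au <-] ut.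
    by exists u => //; apply: hm.
  apply: countable_setU; first exact/finite_set_countable/finite_sing_vals.
  apply: bigcup_countable => // m _; apply: finite_set_countable.
  exact: contrapT (fT m).
have [//|[c [d [cd hT]]]] := dfn1_finite_or_itv S_omin (dT m).
have cdm : c < (c + d) / 2 < d by apply/andP; split; lra.
have [_ /andP/bad[]] := hT _ cdm.
(* Around the midpoint of [c] and [d] this radius keeps the values between [c] and [d], where [DA]
   coincides with the compact image of [core m]. *)
exists ((d - c) / 4); split; first by lra.
set t := (c + d) / 2.
have -> : DA `&` [set x | `|x ord0 j - t| <= (d - c) / 4]
  = F @` core m `&` [set x | `|x ord0 j - t| <= (d - c) / 4].
  apply/seteqP; split=> x [Ax xt]; split=> //;
    last by have [u [[Au _] _] <-] := Ax; exists u.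
  have /hT[] : c < x ord0 j < d; last by move=> + _; apply.
  by move: xt; rewrite /t /= ler_norml => /andP[? ?]; apply/andP; split; lra.
apply: compact_closedI; first by apply: compact_img (@compact_core m) _ => u [[/AU]].
move=> y cy; rewrite /= leNgt; apply/negP => lt.
have [|x [/= xt]] := cy _ (nbhsx_ballx y (`|y ord0 j - t| - (d - c) / 4) _).
  by lra.
rewrite -ball_normE /= => /norm_row_lt => /(_ _ j); rewrite !mxE => yx.
have {}yx := yx ltac:(lra).
have := ler_distD (x ord0 j) (y ord0 j) t; lra.
Qed.

Lemma continuous_coord a b : a <= b -> (forall u, a <= u <= b -> U u) ->
  {within `[a, b], continuous (fun u => h u)}.
Proof.
move=> ab abU; apply: within_continuous_dist => u; rewrite /= in_itv => /abU Uu e e0.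
by have [d d0 hd] := F_cont Uu e0; exists d => // w _ /hd[_ cl]; exact: cl.
Qed.

Lemma IVT_coord a b t : (forall u, Num.min a b <= u <= Num.max a b -> U u) ->
  h a <= t <= h b -> exists2 u, Num.min a b <= u <= Num.max a b & h u = t.
Proof.
move=> abU /andP[hat tb]; have mM : Num.min a b <= Num.max a b.
  by rewrite le_max ge_min lexx.
have [|u] := @IVT R (fun u => h u) _ _ t mM (continuous_coord mM abU).
  move: (lexx t); have [ab|ab] := leP a b => _;
    by rewrite ge_min le_max hat tb ?orbT.
by rewrite in_itv; exists u.
Qed.

Lemma coord_image_clopen e e' : ~ A e -> ~ A e' ->
  (forall w, A w -> e < w < e' -> ~ sing_vals (h w)) ->
  open [set h w | w in A `&` [set w | e < w < e']] /\
  forall t, proper_at t -> closure [set h w | w in A `&` [set w | e < w < e']] t ->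
    [set h w | w in A `&` [set w | e < w < e']] t.
Proof.
move=> nAe nAe' reg; set I := A `&` _; split.
  rewrite openE => _ [u [Au ue] <-].
  have nu : ~ singular (F u) by move=> su; apply: (reg u) => //; exists u.
  have [d d0 hd] := interior_or_singular Au nu; case/andP: (ue) => eu ue'.
  pose c := Num.min d (Num.min (u - e) (e' - u)).
  have c0 : 0 < c by rewrite !lt_min d0 !subr_gt0 eu ue'.
  have hc w : `|w - u| < c -> I w.
    rewrite !lt_min => /andP[/hd Aw /andP[]].
    rewrite !ltr_norml => /andP[? ?] /andP[? ?].
    by split=> //; apply/andP; split; lra.
  (* Near a regular point the coordinate takes smaller and larger values inside [I]; the
     intermediate value theorem fills in a neighbourhood of [h u]. *)
  have [w [Aw wu lt]] := regular_nonmin Au nu c0.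
  have [w' [Aw' w'u lt']] := regular_nonmax Au nu c0.
  apply/nbhs_ballP; exists (Num.min (h u - h w) (h w' - h u)).
    by rewrite /= lt_min !subr_gt0 lt lt'.
  move=> t; rewrite -ball_normE /= lt_min => /andP[].
  rewrite !ltr_norml => /andP[? ?] /andP[? ?].
  have seg v : Num.min w w' <= v <= Num.max w w' -> I v.
    move: wu w'u; rewrite !ltr_norml => /andP[? ?] /andP[? ?].
    rewrite ge_min le_max => /andP[/orP[?|?] /orP[?|?]]; apply: hc;
      by rewrite ltr_norml; apply/andP; split; lra.
  have [|v /seg Iv <-] := @IVT_coord w w' t (fun v sv => AU (proj1 (seg v sv))).
    by apply/andP; split; lra.
  by exists v.
move=> t [d [d0 cQ]] clt.
(* Properness makes [Q] compact, in the chart and hence on the line. As [e] and [e'] are not in [A],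
   the open interval cuts [Q] in the same set as the closed one, so [I] is compact over the values
   near [t]. *)
pose Q := U `&` F @^-1` (DA `&` [set x | `|x ord0 j - t| <= d]).
have {}cQ : compact Q.
  by apply: compact_pre cQ _ => _ [[u Au <-] _]; exists u => //; exact: AU.
have QE u : Q u <-> A u /\ `|h u - t| <= d.
  split=> [[Uu [/(good_img gA Uu) Au ?]]//|[Au ut]].
  by split; [exact: AU|split=> //; exists u].
have cIQ : compact (I `&` Q).
  have -> : I `&` Q = Q `&` `[e, e']%classic.
    apply/seteqP; split=> u [].
      move=> [Au /andP[eu ue']] Qu; split=> //.
      by rewrite /= in_itv /= !ltW.
    move=> /QE[Au ut]; rewrite /= in_itv /= => /andP[eu ue'].
    split; last exact/QE; split=> //=; rewrite !lt_neqAle eu ue' !andbT.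
    by apply/andP; split; apply/eqP => ?; [apply: nAe|apply: nAe']; congruence.
  by apply: compact_closedI cQ _; exact: itv_closed.
have chIQ : compact [set h u | u in I `&` Q].
  apply: continuous_compact cIQ; apply: within_continuous_dist => u [[Au _] _] q q0.
  have [r r0 hr] := F_cont (AU Au) q0.
  by exists r => // w _ /hr[_ cl]; exact: cl.
suff [u [Iu _] <-] : [set h u | u in I `&` Q] t by exists u.
apply: (compact_closed (@norm_hausdorff _ _) chIQ) => B Bt.
have [_ [[u Iu <-] [Bu ut]]] := clt _ (filterI Bt (nbhsx_ballx t d d0)).
exists (h u); split=> //; exists u => //; split=> //; apply/QE.
case: Iu => Au _; split=> //; move: ut; rewrite -ball_normE /= distrC.
exact: ltW.
Qed.

Lemma fiber_test_values : exists T : set R, finite_set T /\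
  forall e e' u, ~ A e -> ~ A e' -> e < u < e' -> A u ->
    exists w, [/\ A w, e < w < e' & T (h w)].
Proof.
pose c := [set t | ~ proper_at t] `|` sing_vals.
have dc : dfn1 (~` c).
  apply: dfn_not; apply: dfn_or; first exact: dfn_improper.
  exact: dfn_sing_vals.
have [T0 [fT0 hT0]] := dfn1_test_points S_omin dc.
(* All bad values, and one test value in each interval of the complement of the bad values. *)
exists (c `|` T0); split.
  by rewrite !finite_setU; split=> //; split;
    [exact: finite_improper|exact: finite_sing_vals].
move=> e e' u nAe nAe' ue Au; apply: contrapT => nT.
have reg w : A w -> e < w < e' -> ~ c (h w) /\ ~ T0 (h w).
  by move=> Aw we; split=> hw; apply: nT; exists w; split=> //; [left|right].
have [oI clI] : open [set h w | w in A `&` [set w | e < w < e']] /\ _ :=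
  coord_image_clopen nAe nAe' (fun w Aw we sw => (reg w Aw we).1 (or_intror sw)).
move: oI clI; set K := [set h w | w in _] => oI clI.
have Ku : K (h u) by exists u.
have [x [Tx sx]] := hT0 _ (reg _ Au ue).1.
pose sg := `[Num.min (h u) x, Num.max (h u) x]%classic.
have sgP y : sg y -> ~ c y by rewrite /sg /= in_itv => /sx.
have cs : connected sg by apply/connected_intervalP; exact: interval_is_interval.
(* [sg] joins [h u] to a test value without meeting a bad value, and [K] is open and closed along
   it; so the test value is attained, which was excluded. *)
have eK : sg `&` K = sg.
  apply: cs.
  - by exists (h u); split=> //; rewrite /sg /= in_itv /= ge_min le_max lexx.
  - by exists K.
  - exists (closure K); first exact: closed_closure.
    apply/seteqP; split=> y [sy Ky]; split=> //; first exact: subset_closure.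
    by apply: clI => //; apply: contrapT => ny; apply: (sgP _ sy); left.
have [_ [w [Aw we] hw]] : (sg `&` K) x.
  by rewrite eK /sg /= in_itv /= ge_min le_max lexx !orbT.
by case: (reg w Aw we); rewrite hw.
Qed.

Lemma fibers_eventually_const : eventually_const A.
Proof.
have [T [fT hT]] := fiber_test_values => s.
have [[t [Tt it]]|nin] := pselect (exists t, T t /\ eventually_in s (fib t)).
  by left; apply: eventually_in_sub it => u [].
have [M hM] : eventually_in s (\bigcap_(t in T) (~` fib t)).
  apply: eventually_in_bigcap => // t Tt; have [it|//] := fib_ev t s.
  by case: nin; exists t.
(* Beyond [M] the complement of [A] is convex: a point of [A] between two missing points would give
   a point of a test fiber, and these fibers end before [M]. *)
have nocomp e e' u : M < toward s e -> toward s e < toward s u < toward s e' ->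
    ~ A e -> ~ A e' -> ~ A u.
  move=> Me /andP[eu ue'] nAe nAe' Au.
  have [w [Aw we Tw]] : exists w, [/\ A w, toward s e < toward s w & T (h w)].
    case: s {hM nin} Me eu ue' => /= Me eu ue'.
      have [|w [Aw /andP[_ ?] Tw]] := hT e' e u nAe' nAe _ Au.
        by rewrite -ltrN2 ue' -ltrN2 eu.
      by exists w; split=> //; rewrite ltrN2.
    have [|w [Aw /andP[? _] Tw]] := hT e e' u nAe nAe' _ Au.
      by rewrite eu ue'.
    by exists w.
  by apply: (hM w (lt_trans Me we) _ Tw).
have [[e [Me nAe]]|all] := pselect (exists e, M < toward s e /\ ~ A e); last first.
  by left; exists M => u Mu; apply: contrapT => nAu; apply: all; exists u.
have [[u [eu Au]]|none] := pselect (exists u, toward s e < toward s u /\ A u).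
  left; exists (toward s u) => w uw; apply: contrapT => nAw.
  by apply: (nocomp e w u) => //; rewrite eu.
by right; exists (toward s e) => u eu Au; apply: none; exists u.
Qed.

End Fibers.

Lemma good_eventually_const A : good A -> eventually_const A.
Proof.
(* Only the coordinates of index below [k] may vary on [A]. For [k = 0] injectivity of [F] leaves at
   most one point; passing to a fiber of coordinate [k] makes that coordinate constant too. *)
suff H k : (k <= n)%N -> forall A, good A ->
    (forall i : 'I_n, (k <= i)%N -> exists c, forall u, A u -> F u ord0 i = c) ->
    eventually_const A.
  by move=> gA; apply: (H n) => // i; rewrite leqNgt ltn_ord.
elim: k => [_ {}A gA cA s|k IH kn {}A gA cA].
  have [c hc] := choice (fun i => cA i (leq0n _)).
  have [AU _] := gA; right.
  have [[u Au]|nA] := pselect (exists u, A u); last first.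
    by exists 0 => u _ Au; apply: nA; exists u.
  exists (toward s u) => w uw Aw; move: uw.
  rewrite (F_inj (AU _ Au) (AU _ Aw)) ?ltxx //.
  by apply/rowP => i; rewrite !hc.
apply: (@fibers_eventually_const A (Ordinal kn)) => // t.
apply: (IH (ltnW kn)) => [|i]; first exact: good_fiber.
rewrite leq_eqVlt => /orP[/eqP ki|/cA[c hc]]; last by exists c => u [/hc].
by exists t => u [_ <-]; congr (F u _ _); exact: val_inj.
Qed.

Lemma good_outside A M : good A -> good (A `&` [set u | M < `|u|]).
Proof.
move=> gA.
have gB : good [set u | A u /\ `|u| <= M].
  apply: (@good_bounded _ M); first exact: good_dfn gA.
    by move=> u [Au _]; case: gA => + _; apply.
  by move=> u [].
rewrite (_ : _ `&` _ = A `\` [set u | A u /\ `|u| <= M]); first exact: goodD.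
apply/seteqP; split=> u /= [Au].
  by move=> Mu; split=> // -[_]; rewrite leNgt Mu.
by move=> nM; split=> //; rewrite ltNge; apply/negP => uM; apply: nM.
Qed.

(** Rolle's theorem, with an extremum in place of a zero of the derivative. *)
Lemma same_value_singular (j : 'I_n) a b : a < b -> (forall u, a <= u <= b -> U u) ->
  F a ord0 j = F b ord0 j -> exists2 c, a < c < b & sing_pts U j c.
Proof.
move=> ab abU hab.
have ct := continuous_coord (j := j) (ltW ab) abU.
(* [singular] compares with all nearby points of the chart. By [F_inv] those near the image of [c]
   come from the arc between [a] and [b], so an extremum over the arc suffices. *)
have inside c : a < c < b -> exists2 d, 0 < d & forall y,
    (F @` U) y -> row_close d (F c) y -> exists2 w, a <= w <= b & F w = y.
  move=> /andP[ac cb].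
  have Uc : U c by apply: abU; rewrite !ltW.
  have [|d d0 hd] := F_inv Uc (e := Num.min (c - a) (b - c)).
    by rewrite lt_min !subr_gt0 ac cb.
  exists d => // _ [w Uw <-] /(hd _ Uw).
  rewrite lt_min !ltr_norml => /andP[/andP[? ?] /andP[? ?]].
  by exists w => //; apply/andP; split; lra.
have [c + maxc] := EVT_max (ltW ab) ct; rewrite in_itv /= => cab.
have {}maxc w : a <= w <= b -> F w ord0 j <= F c ord0 j.
  by move=> wab; apply: maxc; rewrite in_itv.
have [d + mind] := EVT_min (ltW ab) ct; rewrite in_itv /= => dab.
have {}mind w : a <= w <= b -> F d ord0 j <= F w ord0 j.
  by move=> wab; apply: mind; rewrite in_itv.
have ends c' : a <= c' <= b -> ~ a < c' < b -> F c' ord0 j = F a ord0 j.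
  move=> /andP[]; rewrite !le_eqVlt => /predU1P[->//|ac /predU1P[->//|cb]].
  by rewrite ac cb.
have maxi c' : a < c' < b -> (forall w, a <= w <= b -> F w ord0 j <= F c' ord0 j) ->
    sing_pts U j c'.
  move=> cab' hc'; split; first by apply: abU; case/andP: cab' => ? ?; rewrite !ltW.
  have [e e0 he] := inside _ cab'.
  by left; exists e; split=> // y Uy /(he _ Uy)[w wab <-]; exact: hc'.
have [ci|nci] := pselect (a < c < b); first by exists c => //; exact: maxi.
have [di|ndi] := pselect (a < d < b).
  exists d => //; split; first exact: abU.
  have [e e0 he] := inside _ di.
  by right; left; exists e; split=> // y Uy /(he _ Uy)[w wab <-]; exact: mind.
(* Both extrema sit at the ends, where the values agree, so the coordinate is constant on the arc
   and any interior point will do. *)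
exists ((a + b) / 2); first by apply/andP; split; lra.
apply: maxi; first by apply/andP; split; lra.
move=> w /maxc; rewrite (ends c) // -(ends d) // => /le_trans; apply.
by apply: mind; apply/andP; split; lra.
Qed.

(** * Separating the two ends of the line inside the chart *)

Section Separation.
Hypothesis in_both : forall s, eventually_in s U.
Hypothesis nosep : forall A, good A -> forall s,
  eventually_in s A -> eventually_in (~~ s) (~` A) -> False.

(** The assumption to be refuted, combined with the dichotomy at each end: good sets cannot tell the
    ends apart. *)
Let in_all A s s' : good A -> eventually_in s A -> eventually_in s' A.
Proof.
move=> gA iA; have [->//|ss'] := eqVneq s' s.
have {ss'}-> : s' = ~~ s by case: s s' ss' {iA} => -[].
by have [//|/(nosep gA iA)] := good_eventually_const gA (~~ s).
Qed.

Let out_all A s s' : good A -> eventually_in s (~` A) -> eventually_in s' (~` A).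
Proof.
move=> gA iA; have [/(in_all s gA) iA'|//] := good_eventually_const gA s'.
by have := eventually_in_contra iA' iA.
Qed.

Let level (j : 'I_n) t := U `&` [set u | F u ord0 j = t].

Let good_level j t : good (level j t).
Proof. exact: good_fiber goodT t. Qed.

(** If every coordinate were constant near one end, [F] would identify the points [M + 1] and
    [M + 2] there. *)
Lemma nonconstant_coord : exists j : 'I_n, forall t s,
  eventually_in s (~` level j t).
Proof.
apply: contrapT => nj.
have cj j : exists t, eventually_in false (level j t).
  apply: contrapT => nt; apply: nj; exists j => t s.
  apply: (@out_all _ false); first exact: good_level.
  have [it|//] := good_eventually_const (good_level j t) false.
  by case: nt; exists t.
have [t ht] := choice cj.
have [M hM] : eventually_in false (U `&` \bigcap_(j in setT) level j (t j)).
  by apply: eventually_inI => //; apply: eventually_in_bigcap => //;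
    exact: finite_finset.
have [U1 h1] := hM (M + 1) ltac:(rewrite /=; lra).
have [U2 h2] := hM (M + 2) ltac:(rewrite /=; lra).
have : M + 1 = M + 2; last by lra.
apply: F_inj => //; apply/rowP => j.
by have [_ ->] := h1 j I; have [_ ->] := h2 j I.
Qed.

(** Beyond all singular points, [same_value_singular] gives injectivity on each tail. Equal values
    on opposite tails pair a point [u] with a point [w]. Having a mate with a larger [i]-th
    coordinate is a definable condition in the chart, so it holds near both ends or near none, and
    either case excludes distinct [u] and [w]. *)
Lemma injective_tails : exists (j : 'I_n) M, [/\ 0 <= M,
  forall t s, eventually_in s (~` level j t), forall u, M < `|u| -> U u &
  forall u w, M < `|u| -> M < `|w| -> F u ord0 j = F w ord0 j -> u = w].
Proof.
have [j hj] := nonconstant_coord; exists j.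
(* Singular points take finitely many values, and each level avoids both ends. *)
have outX s : eventually_in s (~` sing_pts U j).
  have := @eventually_in_bigcap _ s _ (sing_vals U j) (fun t => ~` level j t)
    (finite_sing_vals j goodT) (fun t _ => hj t s).
  apply: eventually_in_sub => u nu Xu.
  by apply: (nu (F u ord0 j)); [exists u|split=> //; case: Xu].
have [M [M0 hM]] := eventually_in_both (fun s => eventually_inI (in_both s) (outX s)).
have tail_inj s u w : M < toward s u -> M < toward s w ->
    F u ord0 j = F w ord0 j -> u = w.
  wlog uw : u w / u < w => [hw|].
    have [/hw h|/hw h ? ? ?|//] := ltgtP u w; first exact: h.
    by apply/esym/h.
  move=> Mu Mw huw.
  have seg x : u <= x <= w -> M < `|x|.
    move=> ux; apply: lt_le_trans (toward_le_norm s x).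
    apply: (toward_between _ Mu Mw).
    by rewrite ge_min le_max; case/andP: ux => -> ->; rewrite orbT.
  have [|c /andP[uc cw] Xc] := same_value_singular uw _ huw.
    by move=> x /seg/hM[].
  by have [|_] := hM c; [by apply: seg; rewrite !ltW|].
pose E := U `&` [set u | M < `|u|].
have gE : good E by exact: good_outside goodT.
have EP (u : R) : M < `|u| -> E u by move=> Mu; split=> //; have [] := hM u.
pose Q i : set 'rV[R]_n := fun x =>
  exists y, (F @` E) y /\ (y ord0 j = x ord0 j /\ x ord0 i < y ord0 i).
have gA i : good (E `&` F @^-1` Q i).
  apply: good_pre => //; have [_ dE] := gE.
  by apply: definable_set; rewrite /Q; dfn_tac.
have AP i u : (E `&` F @^-1` Q i) u -> exists v,
    [/\ E v, F v ord0 j = F u ord0 j & F u ord0 i < F v ord0 i].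
  by move=> [_ [_ [[v Ev <-] [? ?]]]]; exists v.
(* If the mates exist near the ends: [u] and [w] are the only points of [E] with their value, so
   each would have the strictly larger [i]-th coordinate. *)
have [[i iA]|nA] := pselect (exists i, eventually_in false (E `&` F @^-1` Q i)).
  have [N [N0 hN]] := eventually_in_both (fun s => in_all s (gA i) iA).
  have NM (u : R) : N < `|u| -> M < `|u| by move=> Nu; have [[]] := hN u Nu.
  exists N; split=> // [u /NM/EP[]//|u w Nu Nw huw].
  have [su Mu] := lt_norm_toward (NM _ Nu).
  have [sw Mw] := lt_norm_toward (NM _ Nw).
  have [esw|nsw] := eqVneq su sw; first by apply: (tail_inj su) => //; rewrite esw.
  have fib v : E v -> F v ord0 j = F u ord0 j -> v = u \/ v = w.
    move=> [_ /lt_norm_toward[sv Mv]] hv.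
    have [ev|nv] := eqVneq sv su.
      by left; apply: (tail_inj su) => //; rewrite -ev.
    right; apply: (tail_inj sw); rewrite ?hv //.
    by rewrite (_ : sw = sv) //; case: su sw sv nsw nv {Mu Mw Mv} => [] [] [].
  have [v [Ev hv lt]] := AP _ _ (hN _ Nu).
  have [v' [Ev' hv' lt']] := AP _ _ (hN _ Nw).
  have [ev|ev] := fib _ Ev hv; first by rewrite ev ltxx in lt.
  have [ev'|ev'] := fib _ Ev' (etrans hv' (esym huw));
    last by rewrite ev' ltxx in lt'.
  by move: lt lt'; rewrite ev ev' => lt /(lt_trans lt); rewrite ltxx.
(* Otherwise, far out, two points with the same [j]-th coordinate do not exceed each other in any
   coordinate, hence have the same image. *)
have outA i : eventually_in false (~` (E `&` F @^-1` Q i)).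
  have [iA|//] := good_eventually_const (gA i) false.
  by case: nA; exists i.
have [N [N0 hN]] := @eventually_in_both _ (\bigcap_(i in setT) ~` (E `&` F @^-1` Q i))
  (fun s => eventually_in_bigcap (@finite_finset _ _) (fun i _ =>
    out_all s (gA i) (outA i))).
exists (Num.max M N); split=> // [|u|u w].
- by rewrite le_max M0.
- by rewrite gt_max => /andP[/EP[]].
rewrite !gt_max => /andP[/EP Eu /hN Nu] /andP[/EP Ew /hN Nw] huw.
have le x y i : E x -> E y -> F x ord0 j = F y ord0 j ->
    ~ (E `&` F @^-1` Q i) x -> F y ord0 i <= F x ord0 i.
  move=> Ex Ey hxy nx; rewrite leNgt; apply/negP => lt; apply: nx; split=> //.
  by exists (F y); split; first exists y.
have [[Uu _] [Uw _]] := (Eu, Ew).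
apply: F_inj => //; apply/rowP => i; apply/eqP; rewrite eq_le.
by rewrite (le w u) ?(le u w) //; [exact: Nu|exact: Nw].
Qed.

Lemma ends_separated : False.
Proof.
have [j [M [M0 outj MU inj]]] := injective_tails.
pose pt s : R := toward s (M + 1).
have Mpt s : M < toward s (pt s) by rewrite /pt towardK; lra.
have norm s u : M < toward s u -> M < `|u|.
  by move=> h; apply: lt_le_trans (toward_le_norm s u).
have disj s u v : M < toward s u -> M < toward (~~ s) v -> u <> v.
  by move=> Mu Mv e; move: Mu Mv; rewrite e; case: s {e} => /=; lra.
have [s hs] : exists s, F (pt s) ord0 j < F (pt (~~ s)) ord0 j.
  have [lt|gt|e] := ltgtP (F (pt false) ord0 j) (F (pt true) ord0 j).
  - by exists false.
  - by exists true.
  - by case: (disj false _ _ (Mpt false) (Mpt true)); apply: inj e;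
    exact: norm (Mpt _).
have ivt s' a b t : M < toward s' a -> M < toward s' b ->
    F a ord0 j <= t <= F b ord0 j -> exists2 x, M < toward s' x & F x ord0 j = t.
  move=> Ma Mb tab.
  have seg x : Num.min a b <= x <= Num.max a b -> M < toward s' x.
    by move=> xab; exact: toward_between Ma Mb.
  have [x xab <-] := IVT_coord (fun x xab => MU x (norm _ _ (seg x xab))) tab.
  by exists x => //; exact: seg.
(* The values on a tail form an interval; reaching the value at [pt (~~ s)] from the tail at [s]
   would contradict injectivity. *)
have lt1 u : M < toward s u -> F u ord0 j < F (pt (~~ s)) ord0 j.
  move=> Mu; rewrite ltNge; apply/negP => le.
  have [|x Mx hx] := ivt s (pt s) u (F (pt (~~ s)) ord0 j) (Mpt s) Mu.
    by rewrite le ltW.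
  by case: (disj s _ _ Mx (Mpt _)); apply: inj hx;
    [exact: norm Mx|exact: norm (Mpt _)].
have lt2 u v : M < toward s u -> M < toward (~~ s) v -> F u ord0 j < F v ord0 j.
  move=> Mu Mv; rewrite ltNge; apply/negP => le.
  have [|x Mx hx] := ivt (~~ s) v (pt (~~ s)) (F u ord0 j) Mv (Mpt _).
    by rewrite le; exact/ltW/lt1.
  by case: (disj s _ _ Mu Mx); apply: inj (esym hx); [exact: norm Mu|exact: norm Mx].
pose V := [set F u ord0 j | u in [set u | M < toward s u]].
have supV : has_sup V.
  split; first by exists (F (pt s) ord0 j); exists (pt s) => //; exact: Mpt.
  by exists (F (pt (~~ s)) ord0 j) => _ [u Mu <-]; exact/ltW/lt1.
pose q := sup V.
pose B := U `&` F @^-1` [set x | q < x ord0 j].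
have gB : good B.
  by apply: good_pre goodT _; apply: definable_set; dfn_tac.
have outB : eventually_in s (~` B).
  exists M => u Mu [_] /=; apply/negP; rewrite -leNgt.
  by apply: (sup_upper_bound supV); exists u.
(* Values on the upper tail are at least [q], and [q] itself is avoided near the end. *)
have inB : eventually_in (~~ s) B.
  apply: eventually_in_sub (eventually_inI (outj q (~~ s)) (_ : eventually_in _
    [set v | M < toward (~~ s) v])); last by exists M.
  move=> v [nv Mv]; have Uv : U v by exact: MU (norm _ _ Mv).
  split=> //=; rewrite lt_neqAle; apply/andP; split.
    by apply/eqP => e; apply: nv.
  apply: ge_sup; first by case: supV.
  by move=> _ [u Mu <-]; exact/ltW/lt2.
exact: eventually_in_contra (in_all s gB inB) outB.
Qed.

End Separation.

Lemma good_tail s : eventually_in s U ->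
  exists b0, forall b, b0 <= b -> good [set u | b < toward s u].
Proof.
move=> iU.
have [A [gA [M hM] [N hN]]] : exists A,
    [/\ good A, eventually_in s A & eventually_in (~~ s) (~` A)].
  have [iU'|oU'] := good_eventually_const goodT (~~ s); last by exists U;
    split=> //; exact: goodT.
  apply: contrapT => nA; apply: ends_separated => [s'|A gA s' iA oA].
    by have [->//|] := eqVneq s' s; case: s s' iU iU' {nA} => -[].
  have [e|ne] := eqVneq s' s; first by apply: nA; exists A; rewrite -e.
  have e : s' = ~~ s by case: s s' ne {iU iU' nA iA oA} => -[].
  (* A set that separates the ends the wrong way round is replaced by its complement in [U]. *)
  apply: nA; exists (U `\` A); split; first exact: goodD goodT gA.
    by apply: eventually_inI => //; rewrite e negbK in oA.
  by rewrite e in iA; apply: eventually_in_sub iA => u Au [].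
exists (Num.max 0 (Num.max M N)) => b; rewrite !ge_max => /and3P[b0 Mb Nb].
rewrite (_ : mkset _ = A `&` [set u | b < `|u|]); first exact: good_outside.
apply/seteqP; split=> u /=.
  move=> bu; split; first by apply: hM; exact: le_lt_trans bu.
  exact: lt_le_trans bu (toward_le_norm s u).
move=> [Au bu]; have [s' bu'] := lt_norm_toward bu.
have [<-//|ne] := eqVneq s' s.
have e : s' = ~~ s by case: s s' ne {iU hM hN bu'} => -[].
by case: (hN u) => //; rewrite -e; exact: le_lt_trans bu'.
Qed.

End Curve.

(** * Open subspaces and admissible unions *)

Section SubSpace.
Variables (R : realType) (T : Type) (X : spaceData R T).
Hypothesis sX : is_space X.
Let gX := space_gts sX.

Lemma eq_spaceData (Y Y' : spaceData R T) : gpts (gts Y) = gpts (gts Y') ->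
  (forall V, gopen (gts Y) V <-> gopen (gts Y') V) ->
  (forall C, gadm (gts Y) C <-> gadm (gts Y') C) ->
  (forall V f, sheaf Y V f <-> sheaf Y' V f) -> Y = Y'.
Proof.
move=> eqp eqo eqa eqs.
have {}eqo : gopen (gts Y) = gopen (gts Y') by apply/seteqP; split=> V /eqo.
have {}eqa : gadm (gts Y) = gadm (gts Y') by apply/seteqP; split=> C /eqa.
have {}eqs : sheaf Y = sheaf Y' by apply/funext => V; apply/seteqP; split=> f /eqs.
by case: Y Y' eqp eqo eqa eqs => [[? ? ?] ?] [[? ? ?] ?] /= -> -> -> ->.
Qed.

Lemma gadm_finite_subcover (Y : gtsData T) (C C' : set (set T)) : is_gts Y ->
  C `<=` gopen Y -> finite_set C' -> C' `<=` C ->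
  \bigcup_(V in C) V `<=` \bigcup_(V in C') V -> gadm Y C.
Proof.
move=> gY oC fC' C'C cov; apply: (gts_A7 gY oC (gts_A3 gY fC' _)).
- by move=> V /C'C/oC.
- by apply/seteqP; split=> // x [V /C'C CV Vx]; exists V.
- by move=> V C'V; exists V => //; exact: C'C.
Qed.

Lemma gadm_super (Y : gtsData T) (C D : set (set T)) : is_gts Y ->
  C `<=` gopen Y -> gadm Y D -> D `<=` C ->
  \bigcup_(V in C) V `<=` \bigcup_(V in D) V -> gadm Y C.
Proof.
move=> gY oC aD DC cov; apply: (gts_A7 gY oC aD).
  by apply/seteqP; split=> // x [V /DC CV Vx]; exists V.
by move=> V DV; exists V => //; exact: DC.
Qed.

Lemma is_space_subspace U : gopen (gts X) U -> is_space (subspace_on X U).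
Proof.
move=> oU; split=> [|V f [VU sf]|V f g fg [VU sf]|V [oV VU]|V f g [VU sf] [_ sg]|V
  f g [VU sf] [_ sg]|V W f [oW WU] WV [VU sf]|C g [aC CU] sg eqg] /=.
- split=> /=.
  + by move=> V [].
  + by move=> C [aC CU] V CV; split; [exact: gadm_open aC _ CV|exact: CU].
  + by split; split=> //; have [] := gts_A1 gX.
  + move=> C fC oC; have [|o1 o2] := gts_A2 gX fC; first by move=> V /oC[].
    split; first by split=> // x [V /oC[_ VU] /VU].
    split; last by move=> x [].
    rewrite (_ : _ `&` _ = U `&` (gpts (gts X) `&` \bigcap_(V in C) V));
      first exact: gopenI.
    apply/seteqP; split=> x [Ux]; last by move=> [].
    by move=> h; split=> //; split=> //; exact: gopen_sub gX _ oU _ Ux.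
  + by move=> C fC oC; split=> [|V /oC[]//]; apply: gts_A3 => // V /oC[].
  + by move=> C [aC CU]; split; [exact: gts_A4|move=> x [V /CU VU /VU]].
  + move=> C V [aC CU] [oV VU] VC; split; first exact: gts_A5.
    by move=> _ [W CW <-] x [/VU].
  + move=> C D [aC CU] h; split.
      by apply: gts_A6 => // V /h[[]].
    by move=> W [V /h[[_ DU] _] DW]; exact: DU.
  + move=> C D oC [aD DU] eCD ref; split; last by move=> V /oC[].
    by apply: (gts_A7 gX _ aD eCD ref) => V /oC[].
  + move=> C V [aC CU] VC oVC; split; first by apply: (gts_A8 gX aC VC) => W /oVC[].
    by move=> x /VC[W /CU WU /WU].
- by split=> //; exact: sheaf_open sf.
- by split=> //; exact: sheaf_ext fg sf.
- by split=> //; exact: sheaf1.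
- by split=> //; exact: sheafB.
- by split=> //; exact: sheafM.
- by split=> //; exact: sheaf_restr sf.
- have [|//|f sf hf] := sheaf_glue sX aC (g := g); first by move=> V /sg[].
  by exists f => //; split=> // x [V /CU VU /VU].
Qed.

End SubSpace.

Section Glue.
Variables (R : realType) (T : Type) (X : spaceData R T) (F : set (set T)).
Hypothesis sX : is_space X.
Hypothesis oF : F `<=` gopen (gts X).
Let gX := space_gts sX.

(* The admissible union of the open subspaces of [X] carried by the members
   of [F]. *)
Definition glue_open (V : set T) := V `<=` \bigcup_(M in F) M /\
  forall M, F M -> gopen (gts X) (V `&` M).

Definition glue_gts : gtsData T := {|
  gpts := \bigcup_(M in F) M;
  gopen := glue_open;
  gadm := [set C | C `<=` glue_open /\
    forall M, F M -> gadm (gts X) [set V `&` M | V in C]] |}.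

Definition glue_space : spaceData R T := {|
  gts := glue_gts;
  sheaf := fun V => [set f | glue_open V /\
    forall M, F M -> sheaf X (V `&` M) f] |}.

Lemma bigcup_setIl (C : set (set T)) (M : set T) :
  \bigcup_(V in [set V `&` M | V in C]) V = (\bigcup_(V in C) V) `&` M.
Proof.
apply/seteqP; split=> [x [_ [V CV <-] [Vx Mx]]|x [[V CV Vx] Mx]].
  by split=> //; exists V.
by exists (V `&` M) => //; exists V.
Qed.

Lemma is_gts_glue : is_gts glue_gts.
Proof.
split=> /=.
- by move=> V [].
- by move=> C [].
- split; split=> //.
    by move=> M FM; rewrite set0I; have [] := gts_A1 gX.
  move=> M FM; rewrite (_ : _ `&` M = M); first exact: oF.
  by apply/seteqP; split=> [x []//|x Mx]; split=> //; exists M.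
- move=> C fC oC; split; split.
  + by move=> x [V /oC[+ _]]; apply.
  + move=> M FM; rewrite -bigcup_setIl.
    apply: (gts_A2 gX _ _).1; first exact: finite_image.
    by move=> _ [V /oC[_ oV] <-]; exact: oV.
  + by move=> x [].
  + move=> M FM.
    have := (gts_A2 gX (finite_image (fun V => V `&` M) fC) _).2.
    move=> /(_ _)/gopenI - /(_ _ gX).
    rewrite (_ : _ `&` M = (gpts (gts X) `&` \bigcap_(V in [set V `&` M | V in C])
      V) `&` M).
      apply=> [_ [V /oC[_ oV] <-]|]; [exact: oV|exact: oF].
    apply/seteqP; split=> x [[Px Cx] Mx]; split=> //; split.
    * exact: gopen_sub gX _ (oF FM) _ Mx.
    * by move=> _ [V CV <-]; split=> //; exact: Cx.
    * by exists M.
    * by move=> V CV; have [] : (V `&` M) x by apply: Cx; exists V.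
- move=> C fC oC; split=> // M FM; apply: gts_A3 => //; first exact: finite_image.
  by move=> _ [V /oC[_ oV] <-]; exact: oV.
- move=> C [oC aC]; split; first by move=> x [V /oC[+ _]]; apply.
  by move=> M FM; rewrite -bigcup_setIl; exact: gts_A4 (aC M FM).
- move=> C V [oC aC] [VF oV] VC; split.
    move=> _ [W CW <-]; split; first by move=> x [/VF].
    move=> M FM; rewrite (_ : _ `&` M = (V `&` M) `&` (W `&` M)).
      by apply: gopenI => //; [exact: oV|case: (oC _ CW) => _; apply].
    by apply/seteqP; split=> [x [[]]|x [[] ? ? []]].
  move=> M FM.
  rewrite (_ : [set _ | _ in _] = [set (V `&` M) `&` W | W in [set W `&` M | W in
    C]]).
    apply: gts_A5 => //; [exact: aC|exact: oV|rewrite bigcup_setIl].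
    by move=> x [/VC].
  rewrite !image_comp; apply: eq_imagel => W CW /=.
  by apply/seteqP; split=> [x [[]]|x [[] ? ? []]].
- move=> C D [oC aC] h; split; first by move=> W [V /h[[oD _] _] /oD].
  move=> M FM.
  (* Different members of [C] may have the same trace on [M], while (A6) in [X] sees only traces;
     [E] pools the families of all members with trace [N]. *)
  pose E N := \bigcup_(V in [set V | C V /\ V `&` M = N]) [set W `&` M | W in D V].
  have -> : [set W `&` M | W in \bigcup_(V in C) D V] =
      \bigcup_(N in [set V `&` M | V in C]) E N.
    apply/seteqP; split=> [_ [W [V CV DW] <-]|_ [_ [V CV <-] [V' [CV' _] [W DW <-]]]].
      by exists (V `&` M); [exists V|exists V => //; exists W].
    by exists W => //; exists V'.
  apply: gts_A6 => //; first exact: aC.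
  move=> _ [V CV <-].
  have EV : \bigcup_(W in E (V `&` M)) W = V `&` M.
    apply/seteqP; split=> [x [_ [V' [CV' <-] [W DW <-]] [Wx Mx]]|x [Vx Mx]].
      by split=> //; rewrite -(h _ CV').2; exists W.
    have [_ eV] := h _ CV; move: Vx; rewrite -{1}eV => -[W DW Wx].
    by exists (W `&` M) => //; exists V => //; exists W.
  split=> //; apply: (gadm_super gX (D := [set W `&` M | W in D V])).
  + move=> _ [V' [CV' _] [W DW <-]]; have [[oD _] _] := h _ CV'.
    by have [_] := oD _ DW; apply.
  + by have [[_ aD] _] := h _ CV; exact: aD.
  + by move=> W DW; exists V.
  + by rewrite EV bigcup_setIl (h _ CV).2.
- move=> C D oC [oD aD] eDC ref; split=> // M FM.
  apply: (gts_A7 gX _ (aD M FM)).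
  + by move=> _ [V /oC[_ oV] <-]; exact: oV.
  + by rewrite !bigcup_setIl eDC.
  + move=> _ [V /ref[W CW VW] <-]; exists (W `&` M); first by exists W.
    by move=> x [/VW].
- move=> C V [oC aC] VC oVC; split.
    by move=> x /VC[W /oC[WF _] /WF].
  move=> M FM; apply: (gts_A8 gX (aC M FM)).
    by rewrite bigcup_setIl => x [/VC].
  move=> _ [W CW <-]; rewrite (_ : _ `&` _ = (V `&` W) `&` M).
    by case: (oVC _ CW) => _; apply.
  by apply/seteqP; split=> [x [[] ? ? []]|x [[]]].
Qed.

Lemma is_space_glue : is_space glue_space.
Proof.
split=> [|V f []//|V f g fg [oV sf]|V oV|V f g [oV sf] [_ sg]|V f g [oV sf] [_
  sg]|V W f oW WV [oV sf]|C g [oC aC] sg eqg] /=.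
- exact: is_gts_glue.
- by split=> // M FM; apply: sheaf_ext (sf M FM) => // x [Vx _]; exact: fg.
- by split=> // M FM; apply: sheaf1 => //; case: oV => _; apply.
- by split=> // M FM; apply: sheafB => //; [exact: sf|exact: sg].
- by split=> // M FM; apply: sheafM => //; [exact: sf|exact: sg].
- split=> // M FM; apply: sheaf_restr (sf M FM) => //; last by move=> x [/WV].
  by case: oW => _; apply.
- pose f x := xget 0 [set y | exists V, [/\ C V, V x & y = g V x]].
  have fE V x : C V -> V x -> f x = g V x.
    move=> CV Vx; rewrite /f; case: xgetP => [y -> [W [CW Wx ->]]|/(_ (g V x))[]].
      exact: eqg.
    by exists V.
  have oW : glue_open (\bigcup_(V in C) V) := gts_A4 is_gts_glue (conj oC aC).
  exists f; last by move=> V CV x Vx; exact: fE.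
  split=> // M FM; rewrite -bigcup_setIl.
  have inC N : [set V `&` M | V in C] N -> exists V, C V /\ N = V `&` M.
    by move=> [V CV <-]; exists V.
  (* Gluing in [X] is indexed by traces, so one member of [C] is chosen for each trace;
     compatibility makes the choice immaterial. *)
  pose g' N := g (xget set0 [set V | C V /\ N = V `&` M]).
  have g'E N x : [set V `&` M | V in C] N -> N x -> g' N x = f x.
    move=> /inC[V [CV eN]]; rewrite /g';
      case: xgetP => [W _ [CW ->] [Wx _]|/(_ V)[]//].
    by rewrite (fE W).
  have [|N N' CN CN' x [Nx N'x]|f' sf' hf'] := sheaf_glue sX (aC M FM) (g := g').
  + move=> N CN; have [V [CV eN]] := inC _ CN; rewrite eN.
    apply: (sheaf_ext sX (f := g V)); last by have [_] := sg _ CV; apply.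
    by move=> x VMx; rewrite g'E -?eN //; [rewrite (fE V)//; case: VMx|rewrite eN].
  + by rewrite !g'E.
  + apply: sheaf_ext sf' => // x [N CN Nx].
    by rewrite (hf' _ CN _ Nx) g'E.
Qed.

Lemma gadm_glue : gadm glue_gts F.
Proof.
have oFG M : F M -> glue_open M.
  by move=> FM; split=> [x Mx|M' FM']; [exists M|apply: gopenI => //; exact: oF].
split=> // M FM; apply: (gadm_super gX (D := [set M])).
- by move=> _ [M' FM' <-]; apply: gopenI => //; exact: oF.
- by apply: gts_A3 => // _ ->; exact: oF.
- by move=> _ ->; exists M => //; rewrite setIid.
- by move=> x [_ [M' FM' <-] []]; exists M.
Qed.

Lemma glue_openE M V : F M -> V `<=` M -> glue_open V <-> gopen (gts X) V.
Proof.
move=> FM VM; split=> [[_ /(_ M FM)]|oV]; first by rewrite (setIidl VM).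
by split=> [x /VM Mx|M' FM']; [exists M|apply: gopenI => //; exact: oF].
Qed.

(** The members of [F] are open in [X], so inside one member the tests on all the others reduce to
    the structure of [X]. *)
Lemma subspace_glue M U : F M -> U `<=` M ->
  subspace_on glue_space U = subspace_on X U.
Proof.
move=> FM UM; apply: eq_spaceData => //= [V|C|V f].
- by split=> -[oV VU]; split=> //; apply/(@glue_openE M) => //;
  exact: subset_trans UM.
- split=> -[].
    move=> [oC aC] CU; split=> //; have := aC M FM.
    rewrite (_ : [set _ | _ in _] = C) //.
    have CM V : C V -> V `&` M = V by move=> /CU VU; apply: setIidl;
      exact: subset_trans UM.
    apply/seteqP; split=> [_ [V CV <-]|V CV]; first by rewrite CM.
    by exists V => //; exact: CM.
  move=> aC CU; split=> //; have oC := gadm_open gX aC; split.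
    by move=> V CV; apply/(glue_openE FM);
      [exact: subset_trans (CU _ CV) UM|exact: oC].
  move=> M' FM'; have aC' := gts_A5 gX aC (V := (\bigcup_(V in C) V) `&` M') _ _.
  have {}aC' := aC' (gopenI gX (gts_A4 gX aC) (oF FM')) (@subIsetl _ _ _).
  rewrite (_ : [set _ | _ in _] = [set ((\bigcup_(V in C) V) `&` M') `&` V | V in
    C]) //.
  apply: eq_imagel => V CV; apply/seteqP; split=> [x [Vx M'x]|x [[_ M'x] Vx]] //.
  by do !split=> //; exists V.
- split=> -[VU].
    move=> [oV sf]; split=> //; have := sf M FM.
    by rewrite setIidl //; exact: subset_trans UM.
  move=> sf; have oV := sheaf_open sX sf; split=> //; split.
    by apply/(glue_openE FM) => //; exact: subset_trans UM.
  move=> M' FM'; apply: sheaf_restr sf => //.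
  by apply: gopenI => //; exact: oF.
Qed.

End Glue.

(** * The affine spaces *)

Lemma open_continuousP (R : realType) n (U : set 'rV[R]_n) (f : 'rV[R]_n -> R) :
  open U -> {within U, continuous f} <->
  forall x, U x -> forall e : R, 0 < e -> exists2 d : R, 0 < d &
    forall y, `|y - x| < d -> U y /\ `|f y - f x| < e.
Proof.
move=> oU; split=> [cf x Ux e e0|h]; last first.
  apply: within_continuous_dist => x Ux e e0.
  by have [d d0 hd] := h x Ux e e0; exists d => // y _ /hd[].
move: cf; rewrite continuous_open_subspace // => cf.
have /cvgrPdist_lt cfx := cf x (mem_set Ux).
have /nbhs_ballP[d d0 hd] : nbhs x (U `&` [set t | `|f x - f t| < e]).
  by apply: filterI; [exact: open_nbhs_nbhs|exact: cfx].
exists d => // y yx.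
have [] : (U `&` [set t | `|f x - f t| < e]) y.
  by apply: hd; rewrite -ball_normE /= distrC.
by rewrite /= distrC.
Qed.

Lemma open_ballP (R : realType) n (W : set 'rV[R]_n) x : open W -> W x ->
  exists2 d, 0 < d & forall y : 'rV[R]_n, (forall i,
    `|y ord0 i - x ord0 i| < d) -> W y.
Proof.
move=> oW Wx; have /nbhs_ballP[d d0 hd] := open_nbhs_nbhs (conj oW Wx).
exists d => // y yx; apply: hd; rewrite -ball_normE /= distrC.
by apply/norm_row_lt => // i; rewrite !mxE.
Qed.

Lemma open_row (R : realType) n (W : set 'rV[R]_n) :
  (forall x, W x -> exists2 d, 0 < d &
     forall y : 'rV[R]_n, (forall i, `|y ord0 i - x ord0 i| < d) -> W y) -> open W.
Proof.
move=> h; rewrite openE => x /h[d d0 hd]; apply/nbhs_ballP; exists d => // y.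
rewrite -ball_normE /= distrC => /norm_row_lt yx; apply: hd => i.
by have := yx d0 i; rewrite !mxE.
Qed.

Lemma bigcup_setIr T (C : set (set T)) (M : set T) :
  \bigcup_(V in [set M `&` V | V in C]) V = M `&` \bigcup_(V in C) V.
Proof.
apply/seteqP; split=> [x [_ [V CV <-] [Mx Vx]]|x [Mx [V CV Vx]]].
  by split=> //; exists V.
by exists (M `&` V) => //; exists V.
Qed.

Lemma finite_bigcap_closed T (P : set (set T)) (C : set (set T)) :
  P setT -> (forall A B, P A -> P B -> P (A `&` B)) ->
  finite_set C -> C `<=` P -> P (\bigcap_(A in C) A).
Proof.
move=> PT PI /finite_seqP[s ->]; elim: s => [_|A s IH sP].
  by rewrite (_ : \bigcap_(A in _) A = setT) //; apply/seteqP; split=> // x _ A.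
rewrite (_ : \bigcap_(A in _) A = A `&` \bigcap_(A in [set` s]) A).
  apply: PI; first by apply: sP; rewrite /= mem_head.
  by apply: IH => B sB; apply: sP; rewrite /= in_cons sB orbT.
apply/seteqP; split=> x.
  move=> h; split; first by apply: h; rewrite /= mem_head.
  by move=> B sB; apply: h; rewrite /= in_cons sB orbT.
by move=> [Ax h] B; rewrite /= in_cons => /predU1P[->//|]; exact: h.
Qed.

Section DefSpace.
Variables (R : realType) (S : expansion R) (k : nat).
Local Notation X := (def_space S (setT : set 'rV[R]_k)).
Implicit Types (U V M D : set 'rV[R]_k) (f g : 'rV[R]_k -> R).

Lemma def_openT U : def_open S setT U <-> definable S U /\ open U.
Proof.
split=> [[dU [W oW eU]]|[dU oU]]; first by split=> //; rewrite eU setTI.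
by split=> //; exists U => //; rewrite setTI.
Qed.

Lemma dfn_graph U f : definable S (graph_on U f) <->
  dfn S (fun v => U (\row_(i < k) v i) /\ f (\row_(i < k) v i) = v k).
Proof.
rewrite definable_dfn.
have E (v : nat -> R) : graph_on U f (\row_i v i) <->
    U (\row_(i < k) v i) /\ f (\row_(i < k) v i) = v k.
  split=> [[x Ux /rowP e]|[Uv fv]].
    have <- : x = \row_(i < k) v i.
      by apply/rowP => i; have := e (lshift 1 i); rewrite row_mxEl !mxE.
    by split=> //; have := e (rshift k ord0); rewrite row_mxEr !mxE /= addn0.
  exists (\row_(i < k) v i) => //; apply/rowP => i.
  rewrite [RHS]mxE; case: (split_ordP i) => j ->.
    by rewrite row_mxEl mxE.
  by rewrite row_mxEr mxE (ord1 j) /= addn0.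
by split; apply: eq_dfn => v; rewrite E.
Qed.

Lemma dfn_graph_subst U f (t : 'I_k -> (nat -> R) -> R) s :
  definable S (graph_on U f) -> (forall i, dterm S (t i)) -> dterm S s ->
  dfn S (fun v => U (\row_i t i v) /\ f (\row_i t i v) = s v).
Proof.
move=> /dfn_graph dg dt ds.
pose t' j := if insub j is Some i then t i else s.
have dt' j : dterm S (t' j) by rewrite /t'; case: insub.
apply: eq_dfn (dfn_subst dt' dg) => v.
have -> : \row_i t' i v = \row_i t i v.
  by apply/rowP => i; rewrite !mxE /t' valK.
by rewrite /t' insubF ?ltnn.
Qed.

Lemma graph_on_ext U f g : (forall x,
  U x -> f x = g x) -> graph_on U f = graph_on U g.
Proof. by move=> fg; apply: eq_imagel => x /fg ->. Qed.

Lemma definable_graph_op U f g (op : R -> R -> R) :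
  (forall s t, dterm S s -> dterm S t -> dterm S (fun v => op (s v) (t v))) ->
  definable S (graph_on U f) -> definable S (graph_on U g) ->
  definable S (graph_on U (fun x => op (f x) (g x))).
Proof.
move=> dop df dg; apply/dfn_graph.
apply: (@eq_dfn _ _ (fun v => exists a b,
  (U (\row_(i < k) v i) /\ f (\row_(i < k) v i) = a) /\
  (U (\row_(i < k) v i) /\ g (\row_(i < k) v i) = b) /\ op a b = v k)).
  move=> v; split=> [[a [b [[Uv <-] [[_ <-] <-]]]]//|[Uv <-]].
  by exists (f (\row_i v i)), (g (\row_i v i)).
apply: dfn_ex; cbv beta; apply: dfn_ex; cbv beta; apply: dfn_and.
  by apply: dfn_graph_subst => // [i|]; dterm_tac.
apply: dfn_and; first by apply: dfn_graph_subst => // [i|]; dterm_tac.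
by apply: dfn_eq; [apply: dop|]; dterm_tac.
Qed.

Lemma definable_graph_restr U V f : definable S V -> V `<=` U ->
  definable S (graph_on U f) -> definable S (graph_on V f).
Proof.
move=> dV VU /dfn_graph df; apply/dfn_graph.
apply: (@eq_dfn _ _ (fun v => V (\row_(i < k) v i) /\
   (U (\row_(i < k) v i) /\ f (\row_(i < k) v i) = v k))).
  by move=> v; split=> [[? []]//|[Vv ?]]; split=> //; split=> //; exact: VU.
apply: dfn_and => //; exact/definable_dfn.
Qed.

Lemma def_open_bigcup (C : set (set 'rV[R]_k)) : finite_set C ->
  C `<=` def_open S setT -> def_open S setT (\bigcup_(V in C) V).
Proof.
move=> fC oC; apply/def_openT; split.
  by apply: definable_bigcup => // V /oC/def_openT[].
by apply: bigcup_open => V /oC/def_openT[].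
Qed.

Lemma def_openI U V : def_open S setT U -> def_open S setT V ->
  def_open S setT (U `&` V).
Proof.
move=> /def_openT[dU oU] /def_openT[dV oV]; apply/def_openT.
by split; [exact: definableI|exact: openI].
Qed.

Lemma is_gts_def : is_gts (gts X).
Proof.
split=> //=.
- by move=> C [].
- split; apply/def_openT; split;
  [exact: definable0|exact: open0|exact: definableT|exact: openT].
- move=> C fC oC; split; first exact: def_open_bigcup.
  rewrite setTI; apply: finite_bigcap_closed => //; last exact: def_openI.
  by apply/def_openT; split; [exact: definableT|exact: openT].
- by move=> C fC oC; split=> //; exists C; split.
- by move=> C [oC [C' [fC' C'C <-]]]; apply: def_open_bigcup => // V /C'C/oC.
- move=> C V [oC [C' [fC' C'C eC']]] oV VC; split.
    by move=> _ [U CU <-]; apply: def_openI => //; exact: oC.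
  exists [set V `&` U | U in C']; split; first exact: finite_image.
    by move=> _ [U CU <-]; exists U => //; exact: C'C.
  by rewrite !bigcup_setIr eC'.
- move=> C D [oC [C' [fC' C'C eC']]] h; split.
    by move=> V [U /h[[oD _] _] /oD].
  have hf U : exists D' : set (set 'rV[R]_k), C U -> [/\ finite_set D', D' `<=` D U &
      \bigcup_(V in D') V = \bigcup_(V in D U) V].
    have [/h[[_ [D' hD']] _]|nCU] := pselect (C U); first by exists D'.
    by exists set0.
  have [D' hD'] := choice hf.
  exists (\bigcup_(U in C') D' U); split.
  + by apply: bigcup_finite => // U /C'C/hD'[].
  + move=> V [U C'U D'V]; have CU := C'C _ C'U.
    by exists U => //; have [_ + _] := hD' _ CU; apply.
  + apply/seteqP; split=> [x [V [U /C'C CU D'V] Vx]|x [V [U CU DV] Vx]].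
      by exists V => //; exists U => //; have [_ + _] := hD' _ CU; apply.
    have : (\bigcup_(U in C) U) x by exists U => //; rewrite -(h _ CU).2; exists V.
    rewrite -eC' => -[U' C'U' U'x]; have CU' := C'C _ C'U'.
    have : (\bigcup_(V in D U') V) x by rewrite (h _ CU').2.
    have [_ _ <-] := hD' _ CU' => -[V' D'V' V'x].
    by exists V' => //; exists U'.
- move=> C D oC [oD [D' [fD' D'D eD']]] eDC ref; split=> //.
  have hf V : exists U, D V -> C U /\ V `<=` U.
    have [/ref[U CU VU]|nDV] := pselect (D V); first by exists U.
    by exists set0.
  have [r hr] := choice hf.
  exists (r @` D'); split; first exact: finite_image.
    by move=> _ [V /D'D/hr[CV _] <-].
  rewrite -eDC -eD'; apply/seteqP; split=> [x [_ [V D'V <-] rVx]|x [V D'V Vx]].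
    by rewrite eD' eDC; exists (r V) => //; have [] := hr _ (D'D _ D'V).
  by exists (r V); [exists V|have [_] := hr _ (D'D _ D'V); apply].
- move=> C V [oC [C' [fC' C'C eC']]] VC oVC.
  rewrite (_ : V = \bigcup_(U in [set V `&` U | U in C']) U).
    apply: def_open_bigcup; first exact: finite_image.
    by move=> _ [U /C'C/oVC oVU <-].
  by rewrite bigcup_setIr eC' setIidl.
Qed.

Lemma is_space_def : is_space X.
Proof.
split=> [|V f []//|U f g fg [oU cf df]|U oU|U f g [oU cf df] [_ cg dg]|U f g [oU cf
  df] [_ cg dg]|U V f oV VU [oU cf df]|C g aC sg eqg] /=.
- exact: is_gts_def.
- have [dU oU'] := (def_openT _).1 oU.
  split=> //; last by rewrite -(graph_on_ext fg).
  move: cf; rewrite !open_continuousP // => cf x Ux e e0.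
  have [d d0 hd] := cf x Ux e e0; exists d => // y /hd[Uy ?].
  by split=> //; rewrite -!fg.
- split=> //; first by apply: continuous_subspaceT; exact: cst_continuous.
  have [/definable_dfn dU _] := (def_openT _).1 oU.
  apply/dfn_graph; apply: dfn_and => //.
  by apply: dfn_eq; [exact: dterm_cst|exact: dterm_var].
- have [dU oU'] := (def_openT _).1 oU; split=> //.
    move: cf cg; rewrite !continuous_open_subspace // => cf cg x Ux.
    by apply: continuousB; [exact: cf|exact: cg].
  by apply: (definable_graph_op (op := fun a b => a - b)) => //; exact: dtermB.
- have [dU oU'] := (def_openT _).1 oU; split=> //.
    move: cf cg; rewrite !continuous_open_subspace // => cf cg x Ux.
    by apply: continuousM; [exact: cf|exact: cg].
  by apply: (definable_graph_op (op := fun a b => a * b)) => //; exact: dtermM.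
- split=> //; first exact: continuous_subspaceW cf.
  by apply: definable_graph_restr df => //; have [] := (def_openT _).1 oV.
- have oC := gts_A4 is_gts_def aC; have [dC oC'] := (def_openT _).1 oC.
  pose f x := xget 0 [set y | exists V, [/\ C V, V x & y = g V x]].
  have fE V x : C V -> V x -> f x = g V x.
    move=> CV Vx; rewrite /f; case: xgetP => [y -> [W [CW Wx ->]]|/(_ (g V x))[]].
      exact: eqg.
    by exists V.
  exists f; last by move=> V CV x Vx; exact: fE.
  split=> //.
    apply/open_continuousP => // x [V CV Vx] e e0.
    have [oV cV dV] := sg _ CV; have [_ oV'] := (def_openT _).1 oV.
    have [d d0 hd] := (open_continuousP _ oV').1 cV x Vx e e0.
    exists d => // y /hd[Vy ?]; split; first by exists V.
    by rewrite !(fE V).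
  have [_ [C' [fC' C'C eC']]] := aC.
  (* Here admissibility must mean finiteness: the graph of the glued function is a finite union of
     definable graphs. *)
  rewrite (_ : graph_on _ f = \bigcup_(G in [set graph_on V (g V) | V in C']) G).
    apply: definable_bigcup; first exact: finite_image.
    by move=> _ [V /C'C/sg[] _ _ ? <-].
  rewrite -eC'; apply/seteqP; split=> [_ [x [V C'V Vx] <-]|_ [_ [V C'V <-] [x Vx
    <-]]].
    exists (graph_on V (g V)); first by exists V.
    by exists x => //; rewrite (fE V) //; exact: C'C.
  by exists x; [exists V|rewrite (fE V) //; exact: C'C].
Qed.

Lemma def_space_open D : def_open S setT D -> def_space S D = subspace_on X D.
Proof.
move=> oD; have [dD oD'] := (def_openT _).1 oD.
have E V : def_open S D V <-> def_open S setT V /\ V `<=` D.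
  split=> [[dV [W oW eV]]|[/def_openT[dV oV] VD]]; last first.
    by split=> //; exists V => //; rewrite setIidr.
  by split; [apply/def_openT; split=> //; rewrite eV;
    exact: openI|rewrite eV => x []].
apply: eq_spaceData => //= [C|V f].
  split=> [[oC h]|[[oC h] CD]].
    by split; [split=> // V /oC/E[]|move=> V /oC/E[]].
  by split=> // V CV; apply/E; split; [exact: oC|exact: CD].
by split=> [[/E[oV VD] cf df]|[VD [oV cf df]]]; split=> //; apply/E.
Qed.

Lemma space_iso_refl (Y : spaceData R 'rV[R]_k) : is_space Y -> space_iso Y Y.
Proof.
move=> sY; suff m : space_morphism Y Y id by exists id, id; split.
split; [split|].
- by rewrite image_id.
- move=> C aC; rewrite (_ : [set _ | _ in _] = C) //.
  have oC V : C V -> gpts (gts Y) `&` id @^-1` V = V.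
    by move=> /(gadm_open (space_gts sY) aC)/(gopen_sub (space_gts sY)) VY;
      exact: setIidr.
  apply/seteqP; split=> [_ [V CV <-]|V CV]; first by rewrite oC.
  by exists V => //; exact: oC.
- move=> V h sh; rewrite [X in sheaf Y X](_ : _ = V) //.
  by apply: setIidr; exact: gopen_sub (space_gts sY) _ (sheaf_open sY sh).
Qed.

Lemma affine_def_open D : def_open S setT D ->
  affine_definable_space S (subspace_on X D).
Proof.
move=> oD; have sD := is_space_subspace is_space_def oD; split=> //.
exists k, D; split; first by have [] := (def_openT _).1 oD.
by rewrite (def_space_open oD); exact: space_iso_refl.
Qed.

Lemma definable_open_box (a b : 'rV[R]_k) : definable S (open_box a b).
Proof.
apply/definable_dfn; apply: dfn_fin => i.
apply: (@eq_dfn _ _ (fun v => a ord0 i < v i /\ v i < b ord0 i)).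
  by move=> v; rewrite mxE; split=> /andP.
by dfn_tac.
Qed.

Lemma open_open_box (a b : 'rV[R]_k) : open (open_box a b).
Proof.
suff H (s : seq 'I_k) : open [set y :
  'rV[R]_k | forall i, i \in s -> a ord0 i < y ord0 i < b ord0 i].
  have := H (enum 'I_k); congr open; apply/seteqP; split=> y h i; last by move=> _;
    exact: h.
  by apply: h; rewrite mem_enum.
elim: s => [|i s IH].
  by rewrite (_ : mkset _ = setT); [exact: openT|apply/seteqP; split].
have oi : open [set y : 'rV[R]_k | a ord0 i < y ord0 i < b ord0 i].
  apply: open_row => y /andP[ay yb];
    exists (Num.min (y ord0 i - a ord0 i) (b ord0 i - y ord0 i)).
    by rewrite lt_min !subr_gt0 ay yb.
  move=> z /(_ i); rewrite lt_min !ltr_norml => /andP[/andP[? ?] /andP[? ?]].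
  by apply/andP; split; lra.
rewrite (_ : mkset _ = [set y : 'rV[R]_k | a ord0 i < y ord0 i < b ord0 i] `&`
   [set y : 'rV[R]_k | forall i, i \in s -> a ord0 i < y ord0 i < b ord0 i]);
     first exact: openI.
apply/seteqP; split=> y.
  by move=> h; split=> [|j js]; apply: h; rewrite in_cons ?eqxx // js orbT.
by move=> [yi ys] j; rewrite in_cons => /predU1P[->//|]; exact: ys.
Qed.

Lemma def_open_box (a b : 'rV[R]_k) : def_open S setT (open_box a b).
Proof.
by apply/def_openT; split; [exact: definable_open_box|exact: open_open_box].
Qed.

Lemma open_box_inside (W : set 'rV[R]_k) x : open W -> W x ->
  exists a b, open_box a b x /\ open_box a b `<=` W.
Proof.
move=> oW Wx; have [d d0 hd] := open_ballP oW Wx.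
exists (\row_i (x ord0 i - d)), (\row_i (x ord0 i + d)); split.
  by move=> i; rewrite !mxE; apply/andP; split; lra.
move=> y xy; apply: hd => i; have := xy i; rewrite !mxE => /andP[? ?].
by rewrite ltr_norml; apply/andP; split; lra.
Qed.

Section Glued.
Variable F : set (set 'rV[R]_k).
Hypothesis oF : F `<=` def_open S setT.
Hypothesis covF : \bigcup_(M in F) M = setT.
Local Notation N := (glue_space X F).

(** Every point has a box inside a member of [F], and there the glued space is the affine one. *)
Lemma comes_from_glue : comes_from S k N.
Proof.
have sX := is_space_def; have sN := is_space_glue sX oF.
have subN M : F M -> subspace_on N M = subspace_on X M.
  by move=> FM; exact: (subspace_glue sX oF FM (@subset_refl _ M)).
have boxN x (W : set 'rV[R]_k) : open W -> W x -> exists a b, [/\ open_box a b x,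
    open_box a b `<=` W, glue_open X F (open_box a b) &
    subspace_on N (open_box a b) = subspace_on X (open_box a b)].
  move=> oW Wx; have [M FM Mx] : (\bigcup_(M in F) M) x by rewrite covF.
  have [_ oM] := (def_openT _).1 (oF FM).
  have [a [b [abx abM]]] := open_box_inside (openI oM oW) (conj Mx Wx).
  exists a, b; split=> //; first by move=> y /abM[].
    by apply/(glue_openE sX oF FM); [move=> y /abM[]|exact: def_open_box].
  by apply: (subspace_glue sX oF FM) => y /abM[].
split.
- split=> //; exists F; split=> //; first exact: gadm_glue sX oF.
  by move=> M FM; rewrite subN //; apply: affine_def_open; exact: oF.
- exact: covF.
- apply/seteqP; split=> [W [C oC ->]|W oW].
    apply: bigcup_open => V /oC[VF oV].
    rewrite -[V]setIT -covF -bigcup_setIr.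
    by apply: bigcup_open => _ [M /oV/def_openT[_ ?] <-].
  exists [set V | glue_open X F V /\ V `<=` W]; first by move=> V [].
  apply/seteqP; split=> [x Wx|x [V [_ VW] /VW]//].
  by have [a [b [abx abW oab _]]] := boxN _ _ oW Wx; exists (open_box a b).
- move=> x; have [a [b [abx _ oab eab]]] := boxN x setT openT I.
  exists a, b; split=> //; rewrite eab.
  have sB := is_space_subspace sX (def_open_box a b); split=> //.
  exists [set open_box a b]; split.
  + exact: finite_set1.
  + by move=> _ ->; split=> //; exact: def_open_box.
  + by rewrite bigcup_set1.
  + move=> _ ->; rewrite (_ : subspace_on (subspace_on _ _) _ = subspace_on X
    (open_box a b)).
      exact/affine_def_open/def_open_box.
    apply: eq_spaceData => //= [V|C|V f].
    * by split=> [[[]]|[]].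
    * by split=> [[[]]|[]].
    * by split=> [[? []]|[]].
Qed.

(** [F'] is admissible in its own gluing, hence in the other one; its traces on [M] are then
    admissible in the affine space and have a finite subcover. Gluings are told apart by how their
    pieces cover one another. *)
Lemma gts_glue_eq_cover F' M : F' `<=` def_open S setT ->
  \bigcup_(M in F') M = setT ->
  gts N = gts (glue_space X F') -> F M ->
  exists2 C, finite_set C & C `<=` F' /\ M `<=` \bigcup_(V in C) V.
Proof.
move=> oF' covF' eN FM; have : gadm (gts N) F' by rewrite eN;
  exact: gadm_glue is_space_def oF'.
move=> [_ /(_ M FM)] [_ [C [fC /= CF' eC]]].
have hf V : exists W, C V -> F' W /\ V `<=` W.
  have [/CF'[W F'W <-]|nCV] := pselect (C V); last by exists set0.
  by exists W => _; split=> // x [].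
have [r hr] := choice hf.
exists (r @` C); first exact: finite_image.
split=> [_ [V /hr[F'V _] <-]//|x Mx].
have : (\bigcup_(V in [set V `&` M | V in F']) V) x by rewrite bigcup_setIl covF'.
rewrite -eC => -[V CV Vx]; exists (r V); first by exists V.
by have [_] := hr _ CV; apply.
Qed.

End Glued.

Lemma admissible_union_glue (I : Type) (M : I -> set 'rV[R]_k) :
  (forall i, def_open S setT (M i)) ->
  is_admissible_union (range (fun i => def_space S (M i))) (glue_space X (range M)).
Proof.
move=> oM; have sX := is_space_def.
have oF : range M `<=` def_open S setT by move=> _ [i _ <-].
have E : [set gpts (gts Y) | Y in range (fun i => def_space S (M i))] = range M.
  by rewrite image_comp.
split.
- exact: is_space_glue.
- by rewrite /= -E bigcup_image.
- by rewrite E; exact: gadm_glue sX oF.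
- move=> _ [i _ <-]; rewrite (def_space_open (oM i)) /=.
  by apply: (subspace_glue sX oF (M := M i)) => //; exists i.
Qed.

End DefSpace.

(** * The plane *)

Section Plane.
Variables (R : realType) (S : expansion R).

Definition halfplane (l : R) (n : nat) : set 'rV[R]_2 :=
  [set x | x ord0 ord_max < l * x ord0 ord0 + n%:R].

Lemma def_open_halfplane l n : def_open S setT (halfplane l n).
Proof.
apply/def_openT; split.
  by apply: definable_set; dfn_tac.
apply: open_row => x /= xl; have l1 : 0 < `|l| + 1 by have := normr_ge0 l; lra.
(* Moving both coordinates by less than [d] changes the gap between the two sides of the inequality
   by at most half of it. *)
have [d d0 dE] : exists2 d : R, 0 < d &
    `|l| * d + d = (l * x ord0 ord0 + n%:R - x ord0 ord_max) / 2.
  exists ((l * x ord0 ord0 + n%:R - x ord0 ord_max) / 2 / (`|l| + 1)).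
    by rewrite !divr_gt0 // subr_gt0.
  by rewrite -[X in _ + X]mul1r -mulrDl mulrC divfK // gt_eqF.
exists d => // y yx; have h0 := yx ord0; have := yx ord_max.
rewrite ltr_norml => /andP[_ h1].
have : `|l * (y ord0 ord0 - x ord0 ord0)| <= `|l| * d.
  by rewrite normrM ler_wpM2l // ltW.
rewrite ler_norml mulrBr => /andP[h2 _].
rewrite /halfplane /= in xl *; lra.
Qed.

Definition plane_space (l : R) : spaceData R 'rV[R]_2 :=
  glue_space (def_space S setT) (range (halfplane l)).

Lemma halfplane_cover l : \bigcup_(M in range (halfplane l)) M = setT.
Proof.
apply/seteqP; split=> // x _.
pose n := (Num.truncn `|x ord0 ord_max - l * x ord0 ord0|).+1.
exists (halfplane l n); first by exists n.
have := truncnS_gt `|x ord0 ord_max - l * x ord0 ord0|.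
have := ler_norm (x ord0 ord_max - l * x ord0 ord0).
by rewrite /halfplane /= -/n; lra.
Qed.

Lemma plane_space_comes_from l : comes_from S 2 (plane_space l).
Proof.
apply: comes_from_glue; last exact: halfplane_cover.
by move=> _ [n _ <-]; exact: def_open_halfplane.
Qed.

Lemma finite_subchain (T : Type) (M : nat -> set T) (C : set (set T)) :
  {homo M : m n / (m <= n)%N >-> m `<=` n} -> finite_set C -> C `<=` range M ->
  exists n, \bigcup_(V in C) V `<=` M n.
Proof.
move=> monoM /finite_seqP[s ->]; elim: s => [_|V s IH sM].
  by exists 0%N => x [V].
have [|n hn] := IH; first by move=> W sW; apply: sM; rewrite /= in_cons sW orbT.
have [|m _ em] := sM V; first by rewrite /= mem_head.
exists (maxn m n) => x [W /=]; rewrite in_cons => /predU1P[->|sW Wx].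
  by rewrite -em; apply: monoM; exact: leq_maxl.
by apply: (monoM n); [exact: leq_maxr|apply: hn; exists W].
Qed.

Lemma plane_space_inj l l' : gts (plane_space l) = gts (plane_space l') -> l = l'.
Proof.
move=> e; apply/eqP; apply: contrapT => /negP/eqP ne.
have oF l0 : range (halfplane l0) `<=` def_open S setT.
  by move=> _ [n _ <-]; exact: def_open_halfplane.
have [|C fC [CF cov]] := gts_glue_eq_cover (@oF l') (halfplane_cover l') e
  (M := halfplane l 0); first by exists 0%N.
have [|n hn] := finite_subchain _ fC CF.
  move=> m k mk x; rewrite /halfplane /= => /lt_le_trans; apply.
  by rewrite lerD2l ler_nat.
(* The witness lies on the line of slope [l] through height -1, inside [halfplane l 0]; at abscissa
   [t] this line meets the boundary of [halfplane l' n]. *)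
pose t := (n%:R + 1) / (l - l').
have ht : (l - l') * t = n%:R + 1.
  by rewrite /t mulrC divfK // subr_eq0; apply/eqP.
pose x : 'rV[R]_2 := \row_i (if i == ord0 then t else l * t - 1).
have x0 : x ord0 ord0 = t by rewrite mxE eqxx.
have x1 : x ord0 ord_max = l * t - 1 by rewrite mxE.
have /cov/hn : halfplane l 0 x by rewrite /halfplane /= x0 x1; lra.
rewrite /halfplane /= x0 x1 => h.
have : (l - l') * t < n%:R + 1 by rewrite mulrBl; lra.
by rewrite ht ltxx.
Qed.

Lemma uncountable_plane : ~ countable (distinct_spaces (comes_from S 2%N)).
Proof.
move=> cD; apply: (@itv_uncountable R 0 1 ltr01).
have cI : countable [set gts (plane_space l) | l in [set l | 0 < l < 1]].
  apply: sub_countable cD; apply: subset_card_le => _ [l _ <-].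
  by exists (plane_space l) => //; exact: plane_space_comes_from.
rewrite -(@eq_countable _ _ [set gts (plane_space l) | l in [set l | 0 < l < 1]]) //.
by apply: inj_card_eq => l l' _ _; exact: plane_space_inj.
Qed.

End Plane.

(** * The four spaces on the line *)

Section Line.
Variables (R : realType) (S : expansion R).
Local Notation X := (real_line S).

(* [p] (resp. [m]) tells whether the pieces are unbounded above (resp. below). *)
Definition line_piece (p m : bool) (n : nat) : set 'rV[R]_1 :=
  [set x | (p \/ x ord0 ord0 < n%:R) /\ (m \/ - n%:R < x ord0 ord0)].

Definition line_space (p m : bool) : spaceData R 'rV[R]_1 :=
  glue_space X (range (line_piece p m)).

Lemma def_open_line_piece p m n : def_open S setT (line_piece p m n).
Proof.
apply/def_openT; split.
  by apply: definable_set; dfn_tac.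
apply: open_row => x [hp hm].
have [d1 d10 h1] : exists2 d, 0 < d & forall y :
  'rV[R]_1, (forall i, `|y ord0 i - x ord0 i| < d) ->
    p \/ y ord0 ord0 < n%:R.
  case: hp => [hp|hp]; first by exists 1 => // y _; left.
  exists (n%:R - x ord0 ord0); first by rewrite subr_gt0.
  by move=> y /(_ ord0); rewrite ltr_norml => /andP[? ?]; right; lra.
have [d2 d20 h2] : exists2 d, 0 < d & forall y :
  'rV[R]_1, (forall i, `|y ord0 i - x ord0 i| < d) ->
    m \/ - n%:R < y ord0 ord0.
  case: hm => [hm|hm]; first by exists 1 => // y _; left.
  exists (x ord0 ord0 + n%:R); first by lra.
  by move=> y /(_ ord0); rewrite ltr_norml => /andP[? ?]; right; lra.
exists (Num.min d1 d2); first by rewrite lt_min d10 d20.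
by move=> y yx; split; [apply: h1|apply: h2] => i; have := yx i;
  rewrite lt_min => /andP[].
Qed.

Lemma line_piece_open p m : range (line_piece p m) `<=` def_open S setT.
Proof. by move=> _ [n _ <-]; exact: def_open_line_piece. Qed.

Lemma line_piece_mono p m : {homo line_piece p m : n k / (n <= k)%N >-> n `<=` k}.
Proof.
move=> n k; rewrite -(ler_nat R) => nk x [hp hm].
by split; [case: hp => ?; [left|right; lra]|case: hm => ?; [left|right; lra]].
Qed.

Lemma line_piece_norm p m (x : 'rV[R]_1) n :
  `|x ord0 ord0| < n%:R -> line_piece p m n x.
Proof. by rewrite ltr_norml => /andP[? ?]; split; right. Qed.

Lemma line_piece_cover p m : \bigcup_(M in range (line_piece p m)) M = setT.
Proof.
apply/seteqP; split=> // x _.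
exists (line_piece p m (Num.truncn `|x ord0 ord0|).+1); first by eexists.
by apply: line_piece_norm; exact: truncnS_gt.
Qed.

Lemma line_space_comes_from p m : comes_from S 1 (line_space p m).
Proof. exact: comes_from_glue (@line_piece_open p m) (line_piece_cover p m). Qed.

Lemma line_space_inj p m p' m' :
  gts (line_space p m) = gts (line_space p' m') -> p = p' /\ m = m'.
Proof.
have H p1 m1 p2 m2 : gts (line_space p1 m1) = gts (line_space p2 m2) ->
    (p1 -> p2) /\ (m1 -> m2).
  move=> e; have [|C fC [CF cov]] := gts_glue_eq_cover (@line_piece_open p2 m2)
    (line_piece_cover p2 m2) e (M := line_piece p1 m1 1); first by exists 1%N.
  have [n hn] := finite_subchain (@line_piece_mono p2 m2) fC CF.
  have n0 := ler0n R n.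
  (* The points [n] and [- n] lie outside [line_piece p2 m2 n] unless that piece is unbounded on
     their side. *)
  split=> h.
    have : line_piece p1 m1 1 (\row_(_ < 1) (n%:R : R)).
      by rewrite /line_piece /= mxE; split; [left|right; lra].
    by move=> /cov/hn[[//|]]; rewrite mxE ltxx.
  have : line_piece p1 m1 1 (\row_(_ < 1) (- n%:R : R)).
    by rewrite /line_piece /= mxE; split; [right; lra|left].
  by move=> /cov/hn[_ [//|]]; rewrite mxE ltxx.
move=> e; have [pp mm] := H _ _ _ _ e; have [pp' mm'] := H _ _ _ _ (esym e).
by split; apply/idP/idP.
Qed.

Lemma real_line_space : line_space true true = X.
Proof.
have sX : is_space X by exact: is_space_def.
have eF n : line_piece true true n = setT.
  by apply/seteqP; split=> // x _; split; left.
have subT (Y : spaceData R 'rV[R]_1) : is_space Y -> gpts (gts Y) = setT ->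
    subspace_on Y setT = Y.
  move=> sY eY; have gY := space_gts sY.
  apply: eq_spaceData => //= [V|C|V f]; split=> [[]//|h]; split=> //.
have : subspace_on (line_space true true) setT = subspace_on X setT.
  apply: (subspace_glue sX (@line_piece_open true true) (M := setT)) => //.
  by exists 0%N.
rewrite !subT //.
  exact: is_space_glue sX (@line_piece_open true true).
exact: line_piece_cover.
Qed.

Lemma line_space_union p m (M : nat -> set 'rV[R]_1) :
  (forall n, M n = line_piece p m n) ->
  is_admissible_union (range (fun n => def_space S (M n))) (line_space p m).
Proof.
move=> /funext ->.
exact: admissible_union_glue (fun n => def_open_line_piece p m n).
Qed.

End Line.

(** * Classification on the line *)

Section CoverEq.
Variables (T : Type) (F : set (set T)).

Lemma gopen_cover_sub (Y Y' : gtsData T) : is_gts Y -> is_gts Y' ->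
  gadm Y F -> gadm Y' F -> \bigcup_(M in F) M = gpts Y ->
  (forall M V, F M -> V `<=` M -> gopen Y V -> gopen Y' V) ->
  gopen Y `<=` gopen Y'.
Proof.
move=> gY gY' aF aF' eF h V oV; apply: (gts_A8 gY' aF').
  by rewrite eF; exact: gopen_sub gY _ oV.
move=> M FM; apply: (h M) => //.
by apply: gopenI => //; exact: (gadm_open gY aF).
Qed.

Lemma gadm_cover_sub (Y Y' : gtsData T) : is_gts Y -> is_gts Y' ->
  gadm Y F -> gadm Y' F -> \bigcup_(M in F) M = gpts Y -> gopen Y `<=` gopen Y' ->
  (forall M C, F M -> (forall V, C V -> V `<=` M) -> gadm Y C -> gadm Y' C) ->
  gadm Y `<=` gadm Y'.
Proof.
move=> gY gY' aF aF' eF oYY' h C aC.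
have oC := gadm_open gY aC; have oW := gts_A4 gY aC.
have WF : \bigcup_(V in C) V `<=` \bigcup_(M in F) M.
  by rewrite eF; exact: gopen_sub gY _ oW.
have aW := gts_A5 gY' aF' (oYY' _ oW) WF.
pose D (Q : set T) := [set Q `&` V | V in C].
have aD Q : [set (\bigcup_(V in C) V) `&` M | M in F] Q ->
    gadm Y' (D Q) /\ \bigcup_(V in D Q) V = Q.
  move=> [M FM <-]; split.
    apply: (h M) => //; first by move=> _ [V CV <-] x [[]].
    apply: gts_A5 => //.
    by apply: gopenI => //; exact: (gadm_open gY aF).
  apply/seteqP; split=> [x [_ [V CV <-] []]//|x [[V CV Vx] Mx]].
  by exists (((\bigcup_(V in C) V) `&` M) `&` V); [exists V|split=> //; split=> //;
    exists V].
apply: (gts_A7 gY' _ (gts_A6 gY' aW aD)).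
- by move=> V /oC/oYY'.
- apply/seteqP; split=> [x [_ [_ [M FM <-] [V CV <-]] [_ Vx]]|x Wx];
  first by exists V.
  have [M FM Mx] := WF _ Wx; have [V CV Vx] := Wx.
  exists (((\bigcup_(V in C) V) `&` M) `&` V) => //.
  by exists ((\bigcup_(V in C) V) `&` M); [exists M|exists V].
- by move=> _ [_ [M FM <-] [V CV <-]]; exists V => // x [].
Qed.

(** A family admissible on both sides makes everything local: openness by (A8), admissibility by
    cutting with (A5), composing with (A6) and coarsening with (A7). *)
Lemma gts_eq_on_cover (Y Y' : gtsData T) : is_gts Y -> is_gts Y' ->
  gadm Y F -> gadm Y' F -> \bigcup_(M in F) M = gpts Y -> gpts Y = gpts Y' ->
  (forall M V, F M -> V `<=` M -> gopen Y V <-> gopen Y' V) ->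
  (forall M C, F M -> (forall V, C V -> V `<=` M) -> gadm Y C <-> gadm Y' C) ->
  Y = Y'.
Proof.
move=> gY gY' aF aF' eF eYY' ho ha; have eF' := etrans eF eYY'.
have o1 : gopen Y `<=` gopen Y'.
  by apply: gopen_cover_sub => // M V FM VM /(ho M V FM VM).
have o2 : gopen Y' `<=` gopen Y.
  by apply: gopen_cover_sub => // M V FM VM /(ho M V FM VM).
have a1 : gadm Y `<=` gadm Y'.
  by apply: gadm_cover_sub => // M C FM CM /(ha M C FM CM).
have a2 : gadm Y' `<=` gadm Y.
  by apply: gadm_cover_sub => // M C FM CM /(ha M C FM CM).
case: Y Y' eYY' {gY gY' aF aF' eF eF' ho ha} o1 o2 a1 a2 => [? ? ?] [? ? ?] /= ->.
by move=> o1 o2 a1 a2; congr GtsData; apply/seteqP.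
Qed.

End CoverEq.

Section Classification.
Variables (R : realType) (S : expansion R).
Hypothesis S_omin : o_minimal S.
Variable N : spaceData R 'rV[R]_1.
Hypothesis hN : comes_from S 1 N.
Local Notation X := (real_line S).
Local Notation c x := ((x : 'rV[R]_1) ord0 ord0).
Local Notation row t := (\row_(_ < 1) (t : R)).

Let sN : is_space N. Proof. by case: hN => -[]. Qed.
Let gN : is_gts (gts N). Proof. exact: space_gts sN. Qed.

Lemma row_c x : row (c x) = x.
Proof. by apply/rowP => i; rewrite mxE (ord1 i). Qed.

Lemma gopen_open V : gopen (gts N) V -> open V.
Proof.
move=> oV; case: hN => _ _ eN _.
suff : strong_open (gts N) V by rewrite eN.
by exists [set V]; [move=> _ ->|rewrite bigcup_set1].
Qed.

Definition agree (B : set 'rV[R]_1) :=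
  gopen (gts N) B /\ subspace_on N B = subspace_on X B.

Lemma agree_gopen B V : agree B -> V `<=` B ->
  gopen (gts N) V <-> def_open S setT V.
Proof.
move=> [oB e] VB; have := congr1 (fun Y => gopen (gts Y) V) e => /= e'.
by split=> oV; [have : (def_open S setT V /\ V `<=` B) by rewrite -e'|
  have : (gopen (gts N) V /\ V `<=` B) by rewrite e'] => -[].
Qed.

Lemma agree_gadm B C : agree B -> (forall V, C V -> V `<=` B) ->
  gadm (gts N) C -> gadm (gts X) C.
Proof.
move=> [oB e] CB aC; have := congr1 (fun Y => gadm (gts Y) C) e => /= e'.
have : (gadm (gts N) C /\ (forall V, C V -> V `<=` B)) by [].
by rewrite e' => -[].
Qed.

Lemma agree_sheaf B V f : agree B -> V `<=` B -> sheaf N V f -> sheaf X V f.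
Proof.
move=> [oB e] VB sf; have := congr1 (fun Y => sheaf Y V f) e => /= e'.
have : (V `<=` B /\ sheaf N V f) by [].
by rewrite e' => -[].
Qed.

(** Compactness of the segment reduces the boxes around its points to finitely many. *)
Lemma agree_cover m : exists C, [/\ finite_set C, forall B, C B -> agree B &
  [set x | `|c x| <= m] `<=` \bigcup_(B in C) B].
Proof.
have [_ _ _ box] := hN.
have hb x : exists ab : 'rV[R]_1 * 'rV[R]_1, open_box ab.1 ab.2 x /\
  agree (open_box ab.1 ab.2).
  by have [a [b [abx oab _ e]]] := box x; exists (a, b).
have [ab hab] := choice hb.
pose B x := open_box (ab x).1 (ab x).2.
have : compact [set x : 'rV[R]_1 | `|c x| <= m].
  rewrite (_ : mkset _ = [set v : 'rV[R]_1 | forall i, `[- m, m]%classic (v ord0 i)]).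
    exact: (@rV_compact _ 1 (fun=> `[- m, m]%classic) (fun=> @segment_compact _ _ _)).
  apply/seteqP; split=> x /=.
    by move=> xm i; rewrite (ord1 i) in_itv /= -ler_norml.
  by move=> /(_ ord0); rewrite in_itv /= -ler_norml.
rewrite compact_cover => cK.
have [|x _|D _ cD] := cK _ setT B.
- by move=> x _; exact: open_open_box.
- by exists x => //; exact: (hab x).1.
exists (B @` [set` D]); split.
- exact: finite_image.
- by move=> _ [x _ <-]; exact: (hab x).2.
- by move=> x /cD[y Dy By]; exists (B y) => //; exists y.
Qed.

Lemma gopen_bounded V m : def_open S setT V -> (forall x, V x -> `|c x| <= m) ->
  gopen (gts N) V.
Proof.
move=> oV Vm; have [C [fC aC cov]] := agree_cover m.
rewrite (_ : V = \bigcup_(W in [set V `&` B | B in C]) W).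
  apply: (gts_A2 gN (finite_image _ fC) _).1 => _ [B /aC aB <-].
  apply/(agree_gopen aB); first by move=> x [].
  apply: def_openI => //; apply/(agree_gopen aB) => //; exact: aB.1.
by rewrite bigcup_setIr setIidl // => x /Vm/cov.
Qed.

Definition ball0 (m : R) : set 'rV[R]_1 := [set x | `|c x| < m].

Lemma def_open_ball0 m : def_open S setT (ball0 m).
Proof.
apply/def_openT; split; first by apply: definable_set; dfn_tac.
apply: open_row => x xm; exists (m - `|c x|); first by rewrite subr_gt0.
move=> y /(_ ord0) yx; rewrite /ball0 /=.
by have := ler_distD (c x) (c y) 0; rewrite !subr0; lra.
Qed.

Lemma gopen_ball0 m : gopen (gts N) (ball0 m).
Proof. by apply: (@gopen_bounded _ m); [exact: def_open_ball0|move=> x /ltW]. Qed.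

Lemma def_open_bounded V m : gopen (gts N) V -> def_open S setT (V `&` ball0 m).
Proof.
move=> oV; have [C [fC aC cov]] := agree_cover m.
rewrite (_ : _ `&` _ = \bigcup_(W in [set (V `&` ball0 m) `&` B | B in C]) W).
  apply: def_open_bigcup; first exact: finite_image.
  move=> _ [B /aC aB <-]; apply/(agree_gopen aB); first by move=> x [].
  by apply: gopenI => //; [apply: gopenI => //; exact: gopen_ball0|exact: aB.1].
by rewrite bigcup_setIr [RHS]setIidl // => x [_ /ltW/cov].
Qed.

(** A substitute for compactness: on [K] admissible families are essentially finite, as they are by
    definition in a definable set. *)
Definition small (K : set 'rV[R]_1) := forall C, gadm (gts N) C ->
  exists D, [/\ finite_set D, D `<=` C &
    K `&` \bigcup_(V in C) V `<=` \bigcup_(V in D) V].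

Lemma small_sub K L : K `<=` L -> small L -> small K.
Proof.
move=> KL sL C aC; have [D [fD DC h]] := sL C aC; exists D; split=> // x [Kx Cx].
by apply: h; split=> //; exact: KL.
Qed.

Lemma small_bigcup (F : set (set 'rV[R]_1)) : finite_set F ->
  (forall K, F K -> small K) -> small (\bigcup_(K in F) K).
Proof.
move=> fF sF C aC.
have h K : exists D, F K -> [/\ finite_set D, D `<=` C &
    K `&` \bigcup_(V in C) V `<=` \bigcup_(V in D) V].
  have [/sF/(_ C aC)[D hD]|n] := pselect (F K); first by exists D.
  by exists set0.
have [D hD] := choice h.
exists (\bigcup_(K in F) D K); split.
- by apply: bigcup_finite => // K /hD[].
- by move=> V [K /hD[_ + _]]; apply.
- move=> x [[K FK Kx] Cx]; have [_ _ hK] := hD _ FK.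
  have [V DV Vx] := hK x (conj Kx Cx).
  by exists V => //; exists K.
Qed.

Lemma smallU K L : small K -> small L -> small (K `|` L).
Proof.
move=> sK sL; apply: (@small_sub _ (\bigcup_(M in [set K; L]) M)).
  by move=> x [?|?]; [exists K => //; left|exists L => //; right].
by apply: small_bigcup; [exact: finite_set2|move=> _ [->|->]].
Qed.

(** By (A5) a family may first be cut down to [U]; finitely many traces then lift back to members of
    the family. *)
Lemma small_of_gadm U : gopen (gts N) U ->
  (forall C, gadm (gts N) C -> (forall V, C V -> V `<=` U) ->
     exists D, [/\ finite_set D, D `<=` C &
       \bigcup_(V in C) V `<=` \bigcup_(V in D) V]) ->
  small U.
Proof.
move=> oU h C aC; have oC := gts_A4 gN aC.
have aC' := gts_A5 gN aC (gopenI gN oU oC) (@subIsetr _ _ _).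
have [|D [fD DC cov]] := h _ aC'; first by move=> _ [V CV <-] x [[]].
have hf W : exists V, D W -> C V /\ W `<=` V.
  have [/DC[V CV <-]|nD] := pselect (D W); last by exists set0.
  by exists V => _; split=> // x [].
have [r hr] := choice hf.
exists (r @` D); split; first exact: finite_image.
  by move=> _ [W /hr[CV _] <-].
move=> x [Ux Cx]; have : (\bigcup_(V in [set (U `&` \bigcup_(V in C) V) `&` V | V
  in C]) V) x.
  by rewrite bigcup_setIr.
move=> /cov[W DW Wx]; exists (r W); first by exists W.
by have [_] := hr _ DW; apply.
Qed.

Lemma small_agree B : agree B -> small B.
Proof.
move=> aB; apply: small_of_gadm; first exact: aB.1.
move=> C aC CB; have [_ [D [fD DC eD]]] := agree_gadm aB CB aC.
by exists D; split=> //; rewrite eD.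
Qed.

Lemma small_ball0 m : small (ball0 m).
Proof.
have [C [fC aC cov]] := agree_cover m.
apply: (@small_sub _ (\bigcup_(B in C) B)); first by move=> x /ltW/cov.
by apply: small_bigcup => // B /aC; exact: small_agree.
Qed.

(** * Transfer of the results on curves to an affine piece of [N] *)

Section AffinePiece.
Variables (U : set 'rV[R]_1) (n : nat) (D : set 'rV[R]_n).
Variables (f : 'rV[R]_1 -> 'rV[R]_n) (g : 'rV[R]_n -> 'rV[R]_1).
Hypothesis oU : gopen (gts N) U.
Hypothesis dD : definable S D.
Hypothesis mf : space_morphism (subspace_on N U) (def_space S D) f.
Hypothesis mg : space_morphism (def_space S D) (subspace_on N U) g.
Hypothesis gfK : forall x, U x -> g (f x) = x.
Hypothesis fgK : forall y, D y -> f (g y) = y.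

Let fU x : U x -> D (f x).
Proof. by move=> Ux; case: mf => -[h _] _; apply: h; exists x. Qed.

Let gD y : D y -> U (g y).
Proof. by move=> Dy; case: mg => -[h _] _; apply: h; exists y. Qed.

Let gopen_pre V : def_open S D V -> gopen (gts N) (U `&` f @^-1` V).
Proof.
move=> oV; case: mf => -[_ sf] _.
(* Strict continuity speaks of admissible families, so a single open set is treated as a one-member
   family. *)
have [|aC _] := sf [set V].
  split; first by move=> _ ->.
  by exists [set V]; split=> //; exact: finite_set1.
by apply: (gadm_open gN aC); exists V.
Qed.

Let def_open_pre V : gopen (gts N) V -> V `<=` U -> def_open S D (D `&` g @^-1` V).
Proof.
move=> oV VU; case: mg => -[_ sg] _.
have [|oC _] := sg [set V].
  split; last by move=> _ ->.
  by apply: gts_A3 => // _ ->.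
by apply: oC; exists V.
Qed.

Local Notation UR := [set t : R | U (row t)].
Local Notation FR := (fun t : R => f (row t)).

Let F_cont u : UR u -> forall e : R, 0 < e ->
  exists2 d : R, 0 < d & forall w, `|w - u| < d -> UR w /\ row_close e (FR u) (FR w).
Proof.
move=> Uu e e0.
pose W := D `&` [set y | row_close e (FR u) y].
have oW : def_open S D W.
  split.
    apply: definableI => //; apply: definable_set; rewrite /row_close; dfn_tac.
  exists [set y | row_close e (FR u) y] => //.
  have -> : [set y | row_close e (FR u) y] = ball (FR u) e.
    apply/seteqP; split=> y; rewrite -ball_normE /= distrC => h.
      by apply/norm_row_lt => // i; rewrite !mxE; exact: h.
    by move=> i; move/norm_row_lt: h => /(_ e0 i); rewrite !mxE.
  exact: ball_open.
have [|d d0 hd] := open_ballP (gopen_open (gopen_pre oW)) (x := row u).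
  by split=> //; split; [exact: fU|move=> i; rewrite subrr normr0].
exists d => // w wu.
have [|Uw [_ cw]] := hd (row w); first by move=> i; rewrite !mxE.
by split.
Qed.

Let near0 (u e : R) : 0 < e -> gopen (gts N) [set x | `|c x - u| < e].
Proof.
move=> e0; apply: (@gopen_bounded _ (`|u| + e)).
  apply/def_openT; split; first by apply: definable_set; dfn_tac.
  apply: open_row => x /= xu; exists (e - `|c x - u|); first by rewrite subr_gt0.
  by move=> y /(_ ord0) yx; have := ler_distD (c x) (c y) u; lra.
by move=> x /= xu; have := ler_distD u (c x) 0; rewrite !subr0; lra.
Qed.

Let F_inv u : UR u -> forall e : R, 0 < e ->
  exists2 d : R, 0 < d & forall w, UR w -> row_close d (FR u) (FR w) -> `|w - u| < e.
Proof.
move=> Uu e e0.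
have [_ [W oW eW]] := def_open_pre (gopenI gN oU (near0 u e0)) (@subIsetl _ _ _).
have FW w : UR w -> W (FR w) <-> `|w - u| < e.
  move=> Uw; have : (D `&` W) (FR w) <-> (D `&` g @^-1` (U `&` [set x | `|c x - u|
    < e])) (FR w).
    by rewrite eW.
  rewrite /= !gfK // mxE => E; split=> h.
    by have [_ []] : _ /\ (U (row w) /\ `|w - u| < e) := E.1 (conj (fU Uw) h).
  by have [] := E.2 (conj (fU Uw) (conj Uw h)).
have [|d d0 hd] := open_ballP oW (x := FR u); first by apply/FW;
  rewrite ?subrr ?normr0.
exists d => // w Uw cl; apply/FW => //; exact: hd.
Qed.

Let U_def m : dfn S (fun v => UR (v 0%N) /\ `|v 0%N| <= m).
Proof.
have [dU _] := (def_openT _ _).1 (def_open_bounded (m + 1) oU).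
apply: (@eq_dfn _ _ (fun v => (U `&` ball0 (m + 1)) (\row_(_ < 1) v 0%N) /\
  `|v 0%N| <= m)).
  move=> v; split=> [[[Uv _] ?]//|[Uv vm]]; split=> //; split=> //.
  by rewrite /ball0 /= mxE; lra.
apply: dfn_and; last by dfn_tac.
by apply: dfn_set => // i; exact: dterm_var.
Qed.

(** Coordinates are sections over [D], and morphisms pull sections back; this is how the sheaf
    yields local definability of the chart. *)
Let sheaf_coord i : sheaf N U (fun x => f x ord0 i).
Proof.
have sD : sheaf (def_space S D) D (fun y => y ord0 i).
  split.
  - by split=> //; exists setT; [exact: openT|rewrite setIT].
  - apply: within_continuous_dist => x _ e e0; exists e => // y _ yx.
    by move/norm_row_lt: yx => /(_ e0 i); rewrite !mxE.
  - apply/dfn_graph; apply: (@eq_dfn _ _ (fun v =>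
    D (\row_(i < n) v i) /\ v i = v n)).
      by move=> v; rewrite mxE.
    by dfn_tac.
have := mf.2 _ _ sD; rewrite /= (_ : U `&` f @^-1` D = U) => [[]//|].
by apply: setIidl => x /fU.
Qed.

Let F_def (m : R) i :
  dfn S (fun v => (UR (v 0%N) /\ `|v 0%N| <= m) /\ FR (v 0%N) ord0 i = v 1%N).
Proof.
(* On each of finitely many agreeing boxes a section of [N] is a section of the affine line, so its
   graph is definable. *)
have [C [fC aC cov]] := agree_cover m.
have dC : definable S (\bigcup_(G in [set graph_on (U `&` B) (fun x =>
  f x ord0 i) | B in C]) G).
  apply: definable_bigcup; first exact: finite_image.
  move=> _ [B /aC aB <-].
  have : sheaf N (U `&` B) (fun x => f x ord0 i).
    by apply: sheaf_restr (sheaf_coord i) => //; apply: gopenI => //; exact: aB.1.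
  by move=> /(agree_sheaf aB)[|//]; move=> x [].
pose V := U `&` [set x | `|c x| <= m].
have dV : definable S V.
  apply/definable_dfn; apply: eq_dfn (U_def m) => v.
  have -> : \row_(i < 1) v i = \row_(_ < 1) v 0%N.
    by apply/rowP => q; rewrite !mxE (ord1 q).
  by rewrite /V /= mxE.
have VC : V `<=` \bigcup_(B in C) (U `&` B).
  by move=> x [Ux /cov[B CB Bx]]; exists B.
have eC : \bigcup_(G in [set graph_on (U `&` B) (fun x => f x ord0 i) | B in C]) G =
    graph_on (\bigcup_(B in C) (U `&` B)) (fun x => f x ord0 i).
  apply/seteqP; split=> [_ [_ [B CB <-] [x Ux <-]]|_ [x [B CB Ux] <-]].
    by exists x => //; exists B.
  by exists (graph_on (U `&` B) (fun x => f x ord0 i)); [exists B|exists x].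
rewrite eC in dC; have := definable_graph_restr dV VC dC.
move=> /dfn_graph; apply: eq_dfn => v.
have -> : \row_(i < 1) v i = \row_(_ < 1) v 0%N by apply/rowP => q;
  rewrite !mxE (ord1 q).
by rewrite /V /= mxE.
Qed.

Let imgE : FR @` UR = D.
Proof.
apply/seteqP; split=> [_ [t Ut <-]|y Dy]; first exact: fU.
by exists (c (g y)); rewrite /= row_c; [exact: gD|exact: fgK].
Qed.

Let D_def : definable S (FR @` UR). Proof. by rewrite imgE. Qed.

Local Notation goodU := (good S UR FR).

Lemma gopen_good V : gopen (gts N) V -> V `<=` U -> goodU [set t | V (row t)].
Proof.
move=> oV VU; split; first by move=> t /VU.
have [dV _] := def_open_pre oV VU.
rewrite (_ : _ @` _ = D `&` g @^-1` V) //.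
apply/seteqP; split=> [_ [t Vt <-]|y [Dy Vy]].
  by split; [exact/fU/VU|rewrite /= gfK //; exact: VU].
by exists (c (g y)); rewrite /= row_c //; exact: fgK.
Qed.

(** The image of [A] is definable, and relatively open in [D] by continuity of the inverse chart;
    its preimage under the morphism [f] is therefore open in [N]. *)
Lemma good_gopen A : goodU A -> (forall t, A t -> exists2 d, 0 < d &
    forall w, `|w - t| < d -> A w) -> gopen (gts N) [set x | A (c x)].
Proof.
move=> gA oA; have [AU dA] := gA.
rewrite (_ : mkset _ = U `&` f @^-1` (FR @` A)).
  apply: gopen_pre; split=> //.
  (* The union of the balls around image points of [A] whose trace on [D] stays in the image of
     [A]. *)
  exists [set y | exists a d, [/\ A a, 0 < d, (forall w,
    UR w -> row_close d (FR a) (FR w) -> A w) &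
      row_close d (FR a) y]].
    apply: open_row => y [a [d [Aa d0 hd ay]]].
    have [e e0 he] : exists2 e, 0 < e & forall i, `|y ord0 i - FR a ord0 i| + e <= d.
      pose m := \big[Num.max/0]_i `|y ord0 i - FR a ord0 i|.
      exists (d - m) => [|i]; last first.
        have : `|y ord0 i - FR a ord0 i| <= m by exact: (le_bigmax _ _ i).
        lra.
      by rewrite subr_gt0; apply: bigmax_lt.
    exists e => // z zy; exists a, d; split=> // i.
    by have := ler_distD (y ord0 i) (z ord0 i) (FR a ord0 i); have := zy i;
      have := he i; lra.
  apply/seteqP; split=> [_ [a Aa <-]|y [Dy [a [d [Aa d0 hd ay]]]]].
    split; first exact/fU/AU.
    have [e e0 he] := oA a Aa; have [d d0 hd] := F_inv (AU _ Aa) e0.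
    exists a, d; split=> //; last by move=> i; rewrite subrr normr0.
    by move=> w Uw /(hd _ Uw)/he.
  exists (c (g y)); last by rewrite /= row_c; exact: fgK.
  by apply: hd; rewrite /= row_c ?fgK //; exact: gD.
apply/seteqP; split=> x /=.
  by move=> Ax; split; [have := AU _ Ax; rewrite /= row_c|exists (c x) => //;
    rewrite row_c].
move=> [Ux [a Aa e]]; have := AU _ Aa => /= Ua.
by have := congr1 g e; rewrite !gfK // => <-; rewrite mxE.
Qed.

Lemma gopen_eventually_const V : gopen (gts N) V -> V `<=` U ->
  eventually_const [set t | V (row t)].
Proof.
move=> oV VU.
exact: (@good_eventually_const _ _ S_omin _ UR FR F_cont F_inv U_def F_def D_def
  _ (gopen_good oV VU)).
Qed.

Lemma gopen_tail s : eventually_in s UR -> exists b0, forall b, b0 <= b ->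
  gopen (gts N) [set x | b < toward s (c x)].
Proof.
move=> iU; have [b0 hb] := @good_tail _ _ S_omin _ UR FR F_cont F_inv U_def F_def
  D_def
  s iU.
exists b0 => b /hb gb.
apply: (good_gopen gb) => t /= bt; exists (toward s t - b); first by rewrite subr_gt0.
move=> w; rewrite -(toward_norm s) towardB ltr_norml => /andP[? ?] /=; lra.
Qed.

Lemma small_affine : small U.
Proof.
apply: small_of_gadm => // C aC CU; case: mg => -[_ sg] _.
have [|oC [E [fE EC eE]]] := sg C; first by [].
have hf W : exists V, E W -> C V /\ W = D `&` g @^-1` V.
  have [/EC[V CV <-]|nE] := pselect (E W); last by exists set0.
  by exists V.
have [r hr] := choice hf.
exists (r @` E); split; first exact: finite_image.
  by move=> _ [W /hr[CV _] <-].
move=> x [V CV Vx]; have Ux := CU _ CV _ Vx.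
have : (\bigcup_(W in [set gpts (gts (def_space S D)) `&` g @^-1` V | V in C]) W)
  (f x).
  exists (D `&` g @^-1` V); first by exists V.
  by split; [exact: fU|rewrite /= gfK].
rewrite -eE => -[W EW Wx]; exists (r W); first by exists W.
have [_ eW] := hr _ EW.
have [_] : (D `&` g @^-1` r W) (f x) by rewrite -eW.
by rewrite /= gfK.
Qed.

End AffinePiece.

Lemma exists_affine_cover : exists C, [/\ gadm (gts N) C,
  \bigcup_(U in C) U = setT, (forall U, C U -> gopen (gts N) U),
  (forall U, C U -> small U) &
  (forall U, C U -> (forall V, gopen (gts N) V -> V `<=` U ->
      eventually_const [set t | V (row t)]) /\
    (forall s, eventually_in s [set t | U (row t)] -> exists b0, forall b, b0 <= b ->
      gopen (gts N) [set x | b < toward s (c x)]))].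
Proof.
have [[_ [C [aC eC affC]]] eN _ _] := hN; rewrite eN in eC.
exists C; split=> //.
- exact: gadm_open gN _ aC.
- move=> U CU; have oU := gadm_open gN aC CU.
  have [_ [n [D [dD [f [g [mf mg gfK fgK]]]]]]] := affC U CU.
  exact: small_affine oU mf mg gfK.
- move=> U CU; have oU := gadm_open gN aC CU.
  have [_ [n [D [dD [f [g [mf mg gfK fgK]]]]]]] := affC U CU; split.
    move=> V; exact: (gopen_eventually_const oU dD mf mg gfK fgK).
  move=> s; exact: (gopen_tail oU dD mf mg gfK fgK).
Qed.

Lemma gts_classification : exists p m, gts N = gts (line_space S p m).
Proof.
have [C [aC eC oC sC hC]] := exists_affine_cover.
have [e eP] : exists e : bool -> bool, forall s,
    e s <-> exists U, C U /\ eventually_in s [set t | U (row t)].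
  exists (fun s => `[< exists U, C U /\ eventually_in s [set t | U (row t)] >]) => s.
  by split=> /asboolP.
pose P := line_piece (R := R) (e false) (e true).
have PP n x : P n x <-> forall s, e s \/ toward s (c x) < n%:R.
  rewrite /P /line_piece /=; split=> [[hf ht]|h].
    by case; [case: ht => [?|?]; [left|right; rewrite ltrNl]|].
  split; first exact: (h false).
  by have [?|?] := h true; [left|right; rewrite ltrNl].
pose tail s b : set 'rV[R]_1 := [set x | b < toward s (c x)].
have tail_open s : e s -> exists b0, forall b, b0 <= b -> gopen (gts N) (tail s b).
  by move=> /eP[U [CU iU]]; have [_] := hC U CU; exact.
have tail_small s b : e s -> small (tail s b).
  move=> /eP[U [CU [M hM]]].
  apply: (@small_sub _ (U `|` ball0 (`|b| + `|M| + 1))); last first.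
    by apply: smallU; [exact: sC|exact: small_ball0].
  move=> x; rewrite /tail /= => bx; have [Mx|xM] := ltP M (toward s (c x)).
    by left; have := hM _ Mx; rewrite /= row_c.
  right; rewrite /ball0 /= -(toward_norm s); move: bx xM.
  have := ler_norm M; have := ler_norm (- b); rewrite normrN.
  have := normr_ge0 M; have := normr_ge0 b.
  by move=> ? ? ? ? ? ?; rewrite ltr_norml; apply/andP; split; lra.
have P_small n : small (P n).
  apply: (@small_sub _ (ball0 (n%:R + 1) `|` \bigcup_(K in [set tail s n%:R | s in
    [set s | e s]]) K)).
    move=> x /PP hx; have [xn|nx] := ltP `|c x| (n%:R + 1); first by left.
    right; have [s sx] : exists s, n%:R < toward s (c x).
      by apply: lt_norm_toward; lra.
    have [es|] := hx s; last by lra.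
    by exists (tail s n%:R) => //; exists s.
  apply: smallU; first exact: small_ball0.
  apply: small_bigcup; first exact/finite_image/finite_finset.
  by move=> _ [s es <-]; exact: tail_small.
have split_tails V k : V = (V `&` ball0 (k + 1)) `|`
    (V `&` tail false k `|` V `&` tail true k).
  apply/seteqP; split=> x; last by case=> [[]|[[]|[]]].
  move=> Vx; have [xk|kx] := ltP `|c x| (k + 1); first by left.
  have [[] sx] : exists s, k < toward s (c x) by apply: lt_norm_toward; lra.
    by right; right.
  by right; left.
have two_ends (Q : bool -> R -> Prop) :
  (forall s, exists k, forall k', k <= k' -> Q s k') ->
    exists k, Q false k /\ Q true k.
  move=> h; have [k1 h1] := h false; have [k2 h2] := h true.
  by exists (Num.max k1 k2); split; [apply: h1|apply: h2]; rewrite le_max lexx ?orbT.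
have setU_gopen A B : gopen (gts N) A -> gopen (gts N) B -> gopen (gts N) (A `|` B).
  move=> oA oB; rewrite (_ : A `|` B = \bigcup_(V in [set A; B]) V).
    by apply: (gts_A2 gN (finite_set2 A B) _).1 => _ [->|->].
  apply/seteqP; split=> [x [?|?]|x [_ [->|->] ?]]; try by [left|right].
  - by exists A => //; left.
  - by exists B => //; right.
have def_openU A B : def_open S setT A -> def_open S setT B -> def_open S setT (A
  `|` B).
  move=> /def_openT[dA oA] /def_openT[dB oB]; apply/def_openT.
  by split; [exact: definableU|exact: openU].
have P_gopenE n V : V `<=` P n -> gopen (gts N) V <-> def_open S setT V.
  move=> VP; split=> oV.
    have dtail s k : def_open S setT (tail s k).
      apply/def_openT; split.
        by apply: definable_set; rewrite /toward; case: s; dfn_tac.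
      apply: open_row => x /= kx; exists (toward s (c x) - k);
        first by rewrite subr_gt0.
      move=> y /(_ ord0); rewrite -(toward_norm s) towardB ltr_norml /tail /= =>
        /andP[? ?]; lra.
    (* Far out, [V] contains or misses the whole tail. If [e s] fails, [P n] stops at [n]; otherwise
       some affine [U] contains the end, and open subsets of [U] are constant near it. *)
    have [k [hk1 hk2]] : exists k, def_open S setT (V `&` tail false k) /\
        def_open S setT (V `&` tail true k).
      apply: (two_ends (fun s k => def_open S setT (V `&` tail s k))) => s.
      have o0 : def_open S setT (set0 : set 'rV[R]_1).
        by apply/def_openT; split; [exact: definable0|exact: open0].
      have [es|nes] := boolP (e s); last first.
        exists n%:R => k nk; rewrite (_ : _ `&` _ = set0) //.
        rewrite -subset0 => x [/VP/PP/(_ s)[|xn kx]]; first by rewrite (negbTE nes).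
        by have := lt_trans xn (le_lt_trans nk kx); rewrite ltxx.
      have [U [CU [M hM]]] := (eP s).1 es; have [evU _] := hC U CU.
      have [[M' hM']|[M' hM']] := evU _ (gopenI gN oV (oC _ CU)) (@subIsetr _ _ _) s.
        exists M' => k M'k; rewrite (_ : _ `&` _ = tail s k) //.
        apply/seteqP; split=> [x []//|x kx]; split=> //.
        by have [] := hM' (c x) (le_lt_trans M'k kx); rewrite row_c.
      exists (Num.max M M') => k; rewrite ge_max => /andP[Mk M'k].
      rewrite (_ : _ `&` _ = set0) // -subset0 => x [Vx kx].
      apply: (hM' (c x)); first exact: le_lt_trans kx.
      by rewrite /= row_c; split=> //; have := hM _ (le_lt_trans Mk kx);
        rewrite /= row_c.
    rewrite (split_tails V k); apply: (def_openU); first exact: def_open_bounded.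
    exact: def_openU.
  (* Conversely, o-minimality gives the same dichotomy for a definable [V]. A full tail inside [P n]
     forces [e s], and then far tails are open in [N]. *)
  have [k [hk1 hk2]] : exists k, gopen (gts N) (V `&` tail false k) /\
        gopen (gts N) (V `&` tail true k).
    apply: (two_ends (fun s k => gopen (gts N) (V `&` tail s k))) => s.
    have o0 : gopen (gts N) set0 := (gts_A1 gN).1.
    pose W := [set t : R | V (row (toward s t))].
    have dW : dfn S (fun v => W (v 0%N)).
      have [dV _] := (def_openT _ _).1 oV; rewrite /W.
      apply: (@dfn_set _ _ _ V (fun _ v => toward s (v 0%N)) dV) => _.
      by rewrite /toward; case: (s); dterm_tac.
    have [M [hM|hM]] := dfn1_pinfty S_omin dW; last first.
      exists M => k Mk; rewrite (_ : _ `&` _ = set0) // -subset0 => x [Vx kx].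
      by apply: (hM (toward s (c x)));
        [exact: le_lt_trans kx|rewrite /W /= towardK row_c].
    have es : e s.
      have [|u uW uM] := @eventually_in_ex R false W (Num.max M n%:R);
        first by exists M.
      move: uM; rewrite gt_max /= => /andP[_ nu].
      have /PP/(_ s)[//|] := VP _ uW; rewrite mxE towardK; lra.
    have [b0 hb0] := tail_open s es.
    exists (Num.max M b0) => k; rewrite ge_max => /andP[Mk bk].
    rewrite (_ : _ `&` _ = tail s k); first exact: hb0.
    apply/seteqP; split=> [x []//|x kx]; split=> //.
    by have := hM _ (le_lt_trans Mk kx); rewrite /W /= towardK row_c.
  rewrite (split_tails V k); apply: (setU_gopen); last exact: setU_gopen.
  apply: (@gopen_bounded _ (k + 1)); first by apply: def_openI => //;
    exact: def_open_ball0.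
  by move=> x [_ /ltW].
(* In both spaces admissible families inside [P n] are those with finite subcovers: in [N] by
   smallness, in the affine line by definition. *)
have P_gadmE n C' : (forall V, C' V -> V `<=` P n) ->
    gadm (gts N) C' <-> gadm (gts X) C'.
  move=> C'P; split=> [aC'|[oC' [D [fD DC' eD]]]].
    split; first by move=> V C'V; apply/(P_gopenE n);
      [exact: C'P|exact: (gadm_open gN aC')].
    have [D [fD DC' cov]] := P_small n _ aC'; exists D; split=> //.
    apply/seteqP; split=> x [V DV Vx]; first by exists V => //; exact: DC'.
    by apply: cov; split; [exact: C'P Vx|exists V].
  apply: (gadm_finite_subcover gN _ fD DC'); last by rewrite eD.
  by move=> V C'V; apply/(P_gopenE n); [exact: C'P|exact: oC'].
have oP n : def_open S setT (P n) := def_open_line_piece S _ _ n.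
(* The affine covering refines [range P]: where [e s] fails, a member of [C] does not contain a
   neighbourhood of the end, hence misses one. *)
have aP : gadm (gts N) (range P).
  apply: (gts_A7 gN _ aC).
  - by move=> _ [n _ <-]; apply/(P_gopenE n).
  - by rewrite eC line_piece_cover.
  - move=> U CU; have [evU _] := hC U CU.
    have bound s : exists n : nat, forall x, U x -> e s \/ toward s (c x) < n%:R.
      have [es|nes] := boolP (e s); first by exists 0%N => x _; left.
      have [iU|[M hM]] := evU _ (oC _ CU) (@subset_refl _ _) s.
        by case/negP: nes; apply/eP; exists U.
      exists (Num.truncn `|M|).+1 => x Ux; right.
      apply: (@le_lt_trans _ _ M); last exact:
        le_lt_trans (ler_norm _) (truncnS_gt _).
      by rewrite leNgt; apply/negP => /hM; apply; rewrite /= row_c.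
    have [n1 h1] := bound false; have [n2 h2] := bound true.
    exists (P (maxn n1 n2)); first by exists (maxn n1 n2).
    have le1 : n1%:R <= (maxn n1 n2)%:R :> R by rewrite ler_nat leq_maxl.
    have le2 : n2%:R <= (maxn n1 n2)%:R :> R by rewrite ler_nat leq_maxr.
    move=> x Ux; apply/PP => -[].
      by have [?|/lt_le_trans/(_ le2)] := h2 x Ux; [left|right].
    by have [?|/lt_le_trans/(_ le1)] := h1 x Ux; [left|right].
exists (e false), (e true).
have sX : is_space X := is_space_def S 1.
have oF := @line_piece_open R S (e false) (e true).
have [_ eN _ _] := hN.
apply: (@gts_eq_on_cover _ (range P)) => //.
- exact: is_gts_glue sX oF.
- exact: gadm_glue sX oF.
- by rewrite eN line_piece_cover.
- by rewrite eN /= line_piece_cover.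
- move=> _ V [n _ <-] VP; apply: iff_trans (P_gopenE n V VP) _; apply: iff_sym.
  by apply: (glue_openE sX oF (M := P n)) => //; exists n.
- move=> _ C' [n _ <-] C'P; apply: iff_trans (P_gadmE n C' C'P) _.
  have := subspace_glue sX oF (M := P n) (U := P n) _ (@subset_refl _ _).
  move=> /(_ (ex_intro2 _ _ n I erefl)) eqS.
  have := congr1 (fun Y => gadm (gts Y) C') eqS => /= e'.
  split=> h; first by have [] : (gadm (gts (line_space S (e false) (e true))) C' /\
    forall V, C' V -> V `<=` P n) by rewrite e'.
  by have [] : (gadm (gts X) C' /\ forall V, C' V -> V `<=` P n) by rewrite -e'.
Qed.

End Classification.

Theorem theorem9 (R : realType) (S : expansion R) (S_omin : o_minimal S) :
  (exists Rloc Rlocp Rlocm : spaceData R 'rV[R]_1,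
    [/\ is_admissible_union (loc_family S) Rloc,
        is_admissible_union (locp_family S) Rlocp,
        is_admissible_union (locm_family S) Rlocm &
        [/\ [set real_line S; Rloc; Rlocp; Rlocm] `<=` comes_from S 1%N,
            distinct_spaces (comes_from S 1%N) =
              distinct_spaces [set real_line S; Rloc; Rlocp; Rlocm] &
            (distinct_spaces (comes_from S 1%N) #= `I_4)%card]]) /\
  ~ countable (distinct_spaces (comes_from S 2%N)).
Proof.
split; last exact: uncountable_plane.
pose L := line_space S.
have four : [set real_line S; L false false; L false true; L true false]
    = [set L pm.1 pm.2 | pm in [set: bool * bool]].
  apply/seteqP; split=> [_ [[[->|->]|->]|->]|_ [[[] []] _ <-]].
  - by exists (true, true) => //; exact: real_line_space.
  - by exists (false, false).
  - by exists (false, true).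
  - by exists (true, false).
  - by do 3 left; exact: real_line_space.
  - by right.
  - by left; right.
  - by left; left; right.
have eqD : distinct_spaces (comes_from S 1%N) =
    [set gts (L pm.1 pm.2) | pm in [set: bool * bool]].
  apply/seteqP; split=> [_ [N hN <-]|_ [[p m] _ <-]].
    by have [p [m ->]] := gts_classification S_omin hN; exists (p, m).
  by exists (L p m) => //; exact: line_space_comes_from.
exists (L false false), (L false true), (L true false); split.
- apply: line_space_union => n; apply/seteqP; split=> x /=.
    by case/andP; split; right.
  by move=> [[//|xn] [//|nx]]; rewrite xn nx.
- apply: line_space_union => n; apply/seteqP; split=> x /=.
    by split; [right|left].
  by move=> [[//|xn] _].
- apply: line_space_union => n; apply/seteqP; split=> x /=.
    by split; [left|right].
  by move=> [_ [//|nx]].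
- rewrite four; split.
  + by move=> _ [[p m] _ <-]; exact: line_space_comes_from.
  + by rewrite eqD /distinct_spaces image_comp.
  (* The two binary digits of [k] enumerate the pairs of booleans. *)
  + rewrite eqD (_ : [set _ | _ in _] =
        [set gts (L (odd k) (odd k./2)) | k in `I_4]).
      apply: inj_card_eq => k l /set_mem kl /set_mem ll /line_space_inj[].
      by move: k l kl ll => [|[|[|[|?]]]] [|[|[|[|?]]]].
    apply/seteqP; split=> [_ [[p m] _ <-]|_ [k _ <-]]; last first.
      by exists (odd k, odd k./2).
    by exists (p + m.*2)%N; case: p m => -[].
Qed.
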